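(* Let $T: I\to I$ be a piecewise Möbius map on an interval $I$ of finite Lebesgue measure and let $\mathcal T:\Omega\to\Omega$ be a planar extension for $T$ such that (a) the vertical fibers of $\Omega$ are of positive (one-dimensional) Lebesgue measure bounded away from both zero and infinity; (b) the vertical fibers are bounded away from the locus of $y=-1/x$; (c) $T$ has at least one full cylinder for which the set of ratios of the Lebesgue measure of the $\mathcal T$-image of each vertical fiber above this cylinder to the Lebesgue measure of its receiving fiber is bounded away from zero and one; (d) $T$ has bounded non-full range. Let $\mu'$ be the normalization of $\mu$ to a probability measure on $\Omega$, let $\nu$ be the marginal measure of $\mu'$ on $I$, and let $\mathscr B,\mathscr B'$ denote the Borel algebras of $I,\Omega$ respectively. Then (i) $0<\mu(\Omega)<\infty$; (ii) $T$ is eventually expansive; (iii) $T$ is ergodic with respect to $\nu$; (iv) the system $(\mathcal T,\Omega,\mathscr B',\mu')$ is the natural extension of $(T,I,\mathscr B,\nu)$; in particular, the two-dimensional system is also ergodic.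
   Context: Matrices $M=\begin{pmatrix}a&b\\c&d\end{pmatrix}$ with $\det M=\pm1$, taken up to sign, act by $M\cdot x=\frac{ax+b}{cx+d}$. A piecewise Möbius interval map is a function $T:I\to I$ on an interval $I\subset\mathbb R$ with a partition $I=\bigcup_{\beta}K_\beta$ into intervals, each taken as large as possible, and matrices $M_\beta$ of determinant $\pm1$ such that $T(x)=M_\beta\cdot x$ for $x\in K_\beta$. The $K_\beta$ are the (rank one) cylinders of $T$. A cylinder $K_\beta$ is full if $T(K_\beta)=I$, and non-full otherwise. Let $R=\begin{pmatrix}0&-1\\1&0\end{pmatrix}$. For a real matrix $M=\begin{pmatrix}a&b\\c&d\end{pmatrix}$ with $\det M=\pm1$, taken up to sign, put $\mathcal T_M(x,y)=(M\cdot x,\ RMR^{-1}\cdot y)=\big(M\cdot x,\,-1/(M\cdot(-1/y))\big)$. The measure $\mu$ on $\mathbb R^2$ given by $d\mu=\frac{dx\,dy}{(1+xy)^2}$ is locally $\mathcal T_M$-invariant. Set $\mathcal T(x,y)=\mathcal T_{M_\beta}(x,y)$ for $x\in K_\beta$. A planar extension for $T$ is the system $(\mathcal T,\Omega,\mathscr B',\mu)$ where $\Omega\subset\mathbb R^2$ projects onto $I$ (first coordinate), $\mathcal T$ is bijective on $\Omega$ up to $\mu$-measure zero, and $\mathscr B'$ is the Borel algebra of $\Omega$. The vertical fiber of $\Omega$ above $x\in I$ is $F_x=\Omega\cap(\{x\}\times\mathbb R)$; $\mathcal T$ maps $F_x$ into the receiving fiber $F_{T(x)}$. In (c), the ratio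 for $x$ in the cylinder is the one-dimensional Lebesgue measure of $\mathcal T(F_x)$ divided by that of $F_{T(x)}$. $T$ has bounded non-full range if there is a full cylinder such that the $T$-orbits of the endpoints of all non-full cylinders avoid the interior of this full cylinder. $T$ is eventually expansive if for some $r\in\mathbb N$ there is $c>1$ such that $|(T^r)'(x)|\ge c$ for all $x$ in the domain of $T^r$. The marginal measure $\nu$ of $\mu'$ is $\nu(E)=\mu'(\Omega\cap(E\times\mathbb R))$ for Borel $E\subset I$. The natural extension of a system is its minimal invertible extension (Rohlin), well defined up to isomorphism. Adjectives such as injective, surjective, bijective, disjoint are meant up to measure zero. *)

(* Defs.v *)
From HB Require Import structures.
From mathcomp Require Import all_boot all_order all_algebra.
From mathcomp Require Import all_classical all_reals all_analysis.

Set Implicit Arguments.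
Unset Strict Implicit.
Unset Printing Implicit Defensive.

Import Order.TTheory GRing.Theory Num.Theory.
Import numFieldNormedType.Exports.

Local Open Scope classical_set_scope.
Local Open Scope ring_scope.

(** * Measure-theoretic systems

    A system is given by a map [f] and a set function [m] on an ambient
    measurable type, together with a measurable set [X] carrying it; its
    sigma-algebra consists of the measurable sets included in [X].
    All notions are modulo [m]-null sets. *)

Definition eq_mod0 (R : realType) d (Y : measurableType d)
    (m : set Y -> \bar R) (A B : set Y) : Prop :=
  m (A `+` B) = 0%E.

Definition trace_algebra d (Y : measurableType d) (X : set Y) : set (set Y) :=
  [set A | measurable A /\ A `<=` X].

(* Every member of F agrees with some member of G up to a null set. *)
Definition sub_mod0 (R : realType) d (Y : measurableType d)
    (m : set Y -> \bar R) (F G : set (set Y)) : Prop :=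
  forall A, F A -> exists2 B, G B & eq_mod0 m A B.

(* Pull-back, inside X, of a family of sets. *)
Definition pullback (Y Z : Type) (X : set Y) (f : Y -> Z) (F : set (set Z)) :
    set (set Y) :=
  [set X `&` f @^-1` A | A in F].

Definition measure_preserving (R : realType) d (Y : measurableType d)
    (f : Y -> Y) (X : set Y) (m : set Y -> \bar R) : Prop :=
  [/\ measurable X, measurable_fun X f &
      forall A, trace_algebra X A -> m (X `&` f @^-1` A) = m A].

Definition ergodic (R : realType) d (Y : measurableType d)
    (f : Y -> Y) (X : set Y) (m : set Y -> \bar R) : Prop :=
  measure_preserving f X m /\
  forall A, trace_algebra X A -> eq_mod0 m A (X `&` f @^-1` A) ->
    m A = 0%E \/ m (X `\` A) = 0%E.

Definition invertible_mod0 (R : realType) d (Y : measurableType d)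
    (f : Y -> Y) (X : set Y) (m : set Y -> \bar R) : Prop :=
  exists (g : Y -> Y) (N : set Y),
    [/\ measurable_fun X g, m.-negligible N &
        forall p, (X `\` N) p -> [/\ X (f p), X (g p), g (f p) = p & f (g p) = p]].

Definition factor_map (R : realType) d (Y : measurableType d)
    d' (Y' : measurableType d')
    (f : Y -> Y) (X : set Y) (m : set Y -> \bar R)
    (f' : Y' -> Y') (X' : set Y') (m' : set Y' -> \bar R)
    (phi : Y -> Y') : Prop :=
  [/\ measurable_fun X phi,
      forall E, trace_algebra X' E -> m (X `&` phi @^-1` E) = m' E &
      exists2 N : set Y, m.-negligible N &
        forall p, (X `\` N) p -> X' (phi p) /\ phi (f p) = f' (phi p)].

(* The systems lying between (f, X, m) and its factor (f', X', m') correspond,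
   mod 0, to the sub-sigma-algebras S of that of X with f^-1 S included in S
   and phi^-1(algebra of X') included in S; the intermediate system is
   invertible iff moreover S is included in f^-1 S.  Minimality says that every
   invertible intermediate system is, mod 0, the whole of (f, X, m). *)
Definition minimal_invertible (R : realType) d (Y : measurableType d)
    d' (Y' : measurableType d')
    (f : Y -> Y) (X : set Y) (m : set Y -> \bar R)
    (X' : set Y') (phi : Y -> Y') : Prop :=
  forall S : set (set Y),
    sigma_algebra X S -> S `<=` trace_algebra X ->
    sub_mod0 m (pullback X phi (trace_algebra X')) S ->
    sub_mod0 m (pullback X f S) S ->
    sub_mod0 m S (pullback X f S) ->
    sub_mod0 m (trace_algebra X) S.

Definition natural_extension (R : realType) d (Y : measurableType d)
    d' (Y' : measurableType d')
    (f : Y -> Y) (X : set Y) (m : set Y -> \bar R)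
    (f' : Y' -> Y') (X' : set Y') (m' : set Y' -> \bar R)
    (phi : Y -> Y') : Prop :=
  [/\ measure_preserving f' X' m',
      measure_preserving f X m,
      invertible_mod0 f X m,
      factor_map f X m f' X' m' phi &
      minimal_invertible f X m X' phi].

(** * Piecewise Moebius interval maps *)

Definition mobius (R : realType) (M : 'M[R]_2) (x : R) : R :=
  (M 0 0 * x + M 0 1) / (M 1 0 * x + M 1 1).

Definition det_pm1 (R : realType) (M : 'M[R]_2) : Prop :=
  \det M = 1 \/ \det M = -1.

(* The denominator condition rules out the default value 1 / 0 = 0. *)
Definition acts_as (R : realType) (T : R -> R) (M : 'M[R]_2) (J : set R) : Prop :=
  forall x, J x -> M 1 0 * x + M 1 1 != 0 /\ T x = mobius M x.

(* T : I -> I is the restriction to I of a function on R.  As usual the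
   cylinders K b partition I up to a null set (for the Gauss map, 0 lies in no
   nondegenerate cylinder), and T is Borel, which is automatic on the cylinders
   and so only concerns that null set.  Maximality of a cylinder is up to its
   endpoints: for a continuous T a common endpoint of two adjacent cylinders
   could be put in either of them. *)
Record piecewise_mobius (R : realType) (I : set R) (T : R -> R)
    (B : Type) (K : B -> set R) (M : B -> 'M[R]_2) : Prop := PiecewiseMobius {
  pm_dom : is_interval I ;
  pm_self : set_fun I I T ;
  pm_borel : measurable_fun I T ;
  pm_sub : forall b, K b `<=` I ;
  pm_interval : forall b, is_interval (K b) ;
  pm_nondegenerate : forall b, (K b)° !=set0 ;
  pm_disjoint : trivIset setT K ;
  pm_cover : (@lebesgue_measure R).-negligible (I `\` \bigcup_b K b) ;
  pm_det : forall b, det_pm1 (M b) ;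
  pm_mobius : forall b, acts_as T (M b) (K b) ;
  pm_maximal : forall b J N, is_interval J -> K b `<=` J -> J `<=` I ->
    det_pm1 N -> acts_as T N J -> J `<=` closure (K b) }.

Definition full_cylinder (R : realType) (I : set R) (T : R -> R) (Kb : set R) :
    Prop :=
  (@lebesgue_measure R).-negligible (I `\` T @` Kb).

(* The orbit of an endpoint e of a cylinder consists of the one-sided limits at
   e, from inside the cylinder, of the iterates of T: e itself need not belong
   to the cylinder, nor even to I (as for the right endpoint of I = [a, b)).
   The case n = 0 gives e itself. *)
Definition endpoint_orbit (R : realType) (T : R -> R) (Kb : set R) : set R :=
  [set l | exists e n, (e = inf Kb \/ e = sup Kb) /\
     iter n T x @[x --> within Kb° (nbhs e)] --> l].

Definition bounded_nonfull_range (R : realType) (I : set R) (T : R -> R)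
    (B : Type) (K : B -> set R) : Prop :=
  exists2 b0, full_cylinder I T (K b0) &
    forall b, ~ full_cylinder I T (K b) ->
      forall l, endpoint_orbit T (K b) l -> ~ (K b0)° l.

(* Points at which T^r is defined and smooth: the first r points of the orbit
   are interior to cylinders. *)
Definition iter_domain (R : realType) (T : R -> R) (B : Type) (K : B -> set R)
    (r : nat) : set R :=
  [set x | forall k, (k < r)%N -> exists b, (K b)° (iter k T x)].

Definition eventually_expansive (R : realType) (T : R -> R)
    (B : Type) (K : B -> set R) : Prop :=
  exists (r : nat) (c : R), 1 < c /\
    forall x, iter_domain T K r x -> c <= `|derive1 (iter r T) x|.

(** * Planar extensions *)

Definition Rrot (R : realType) : 'M[R]_2 :=
  \matrix_(i, j) (if (i < j)%N then -1 else if (j < i)%N then 1 else 0).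

Definition planar_mobius (R : realType) (M : 'M[R]_2) (p : R * R) : R * R :=
  (mobius M p.1, mobius (Rrot R *m M *m invmx (Rrot R)) p.2).

(* Outside the union of the cylinders (a null set) the value is immaterial. *)
Definition planar_map (R : realType) (T : R -> R)
    (B : Type) (K : B -> set R) (M : B -> 'M[R]_2) (p : R * R) : R * R :=
  if pselect (exists b, K b p.1) is left h
  then planar_mobius (M (projT1 (cid h))) p
  else (T p.1, p.2).

Definition mu_plane (R : realType) (A : set (R * R)) : \bar R :=
  (\int[@lebesgue_measure R \x @lebesgue_measure R]_(p in A)
     (((1 + p.1 * p.2) ^+ 2)^-1)%:E)%E.

Record planar_extension (R : realType) (I : set R) (T : R -> R)
    (B : Type) (K : B -> set R) (M : B -> 'M[R]_2) (Omega : set (R * R)) : Prop :=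
  PlanarExtension {
  pe_borel : measurable Omega ;
  pe_proj : fst @` Omega = I ;
  pe_bij : exists N N' : set (R * R),
    [/\ (@mu_plane R).-negligible N, (@mu_plane R).-negligible N' &
        set_bij (Omega `\` N) (Omega `\` N') (planar_map T K M)] }.

(* [xsection Omega x] is the vertical fiber above x, as a subset of R. *)
Definition fibers_bounded_measure (R : realType) (I : set R)
    (Omega : set (R * R)) : Prop :=
  exists c C : R, 0 < c /\
    forall x, I x ->
      (c%:E <= lebesgue_measure (xsection Omega x) <= C%:E)%E.

(* Distance in the plane, for the sup norm, which is equivalent to the
   Euclidean one. *)
Definition away_from_locus (R : realType) (Omega : set (R * R)) : Prop :=
  exists2 delta : R, 0 < delta &
    forall p, Omega p -> forall s : R, s != 0 ->
      delta <= `|p - (s, - s^-1)|.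

Definition fiber_ratio (R : realType) (T : R -> R)
    (B : Type) (K : B -> set R) (M : B -> 'M[R]_2) (Omega : set (R * R))
    (x : R) : \bar R :=
  (lebesgue_measure [set (planar_map T K M (x, y)).2 | y in xsection Omega x]
   / lebesgue_measure (xsection Omega (T x)))%E.

Definition full_cylinder_with_bounded_ratios (R : realType) (I : set R)
    (T : R -> R) (B : Type) (K : B -> set R) (M : B -> 'M[R]_2)
    (Omega : set (R * R)) : Prop :=
  exists b, full_cylinder I T (K b) /\
    exists2 eps : R, 0 < eps &
      forall x, K b x ->
        (eps%:E <= fiber_ratio T K M Omega x)%E /\
        (eps%:E <= `|fiber_ratio T K M Omega x - 1|)%E.

Definition mu_normalized (R : realType) (Omega : set (R * R)) (A : set (R * R)) :
    \bar R :=
  (mu_plane (Omega `&` A) / mu_plane Omega)%E.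

Definition marginal (R : realType) (Omega : set (R * R)) (E : set R) : \bar R :=
  mu_normalized Omega (Omega `&` (E `*` setT)).

(* Main.v *)
(* Conditions (a) and (b) bound the density of mu on Omega, so mu(Omega) is finite
   and nu is dominated by a multiple of Lebesgue measure and has its null sets on I.
   By (d) the image of a branch of an iterate of T that meets the full cylinder U
   covers U, and by (c) a second branch of T covers U: otherwise almost every fibre
   above U would be mapped onto its receiving fibre, with ratio 1.

   If an interval is mapped injectively by the iterates of T, then at least every
   second image has a further preimage under T, disjoint from the previous image, so
   the invariance of nu makes the nu-measures of the images grow.  Hence no interval
   stays in one cylinder forever, and Lebesgue density with bounded distortion of the
   branches covering U gives ergodicity of T.  Distortion and the maximal ergodic
   inequality then bound nu below by a multiple of Lebesgue measure, so the growth is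
   geometric, which is the expansion.

   In the coordinates (x, y / (1 + x y)) the iterates of the planar map are affine on
   the fibres, with factors tending to 0.  So the fibre coordinate of an image is
   nearly a function of the x of its preimage, and an invertible intermediate
   sigma-algebra, which contains the sets depending on x only, contains everything.
   The sets that some iterate pulls back close to sets depending on x only form
   such a sigma-algebra, so invariant sets depend on x only, and ergodicity lifts
   from T. *)
Require Import Defs.
From HB Require Import structures.
From mathcomp Require Import all_boot all_order all_algebra.
From mathcomp Require Import all_classical all_reals all_analysis.
From mathcomp Require Import measurable_realfun ring lra.

Set Implicit Arguments.
Unset Strict Implicit.
Unset Printing Implicit Defensive.

Import Order.TTheory GRing.Theory Num.Theory.
Import numFieldNormedType.Exports.

Local Open Scope classical_set_scope.
Local Open Scope ring_scope.

(** * Changes of variables *)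

(** The obstacle is that expansion is a conclusion: at the start nothing makes cylinders shrink. The
    bookkeeping with the invariant measure is therefore done twice. At first Lebesgue measure is
    only known to be absolutely continuous with respect to it, so two steps gain a fixed amount of
    mass; this excludes an interval that is never cut and so makes cylinders shrink, as the density
    argument requires. Ergodicity then sharpens absolute continuity to an inequality between the
    measures, and the gain becomes a fixed proportion of the current mass. The derivative is read
    off from the growth of short intervals centred at a point, whose images have explicit lengths.
    Condition (d) is carried by a set [Q] that contains the ends of all images of cylinders and
    misses [U k0]. Distortion needs no derivative estimate, because an inverse branch defined on all
    of [U k0] has its pole outside. Minimality of the extension and its ergodicity come from one
    generation statement, applied to two different sigma-algebras. *)

Section density_measure.
Context d (X : measurableType d) (R : realType) (m : {measure set X -> \bar R}).
Variables (w : X -> R) (mw : measurable_fun setT w) (w0 : forall x, 0 <= w x).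
Local Open Scope ereal_scope.

(** The proofs about [w] are arguments so that the measure structure declared below can be attached
    to the applied term. *)
Definition density_measure of measurable_fun setT w & (forall x, (0 <= w x)%R) :=
  fun A : set X => \int[m]_(x in A) (w x)%:E.

Local Notation nu := (density_measure mw w0).

Let nu0 : nu set0 = 0.
Proof. by rewrite /density_measure integral_set0. Qed.

Let nu_ge0 A : 0 <= nu A.
Proof. by apply: integral_ge0 => x _; rewrite lee_fin. Qed.

Let nu_sigma_additive : semi_sigma_additive nu.
Proof.
move=> F mF tF mUF; rewrite /density_measure ge0_integral_bigcup//=.
- apply: is_cvg_ereal_nneg_natsum => n _.
  by apply: integral_ge0 => x _; rewrite lee_fin.
- exact/measurable_EFinP/measurable_funTS.
- by move=> x _; rewrite lee_fin.
Qed.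

HB.instance Definition _ := isMeasure.Build _ _ _ nu nu0 nu_ge0 nu_sigma_additive.

Import HBNNSimple.

(** True for indicators by definition, for simple functions by linearity, and in general by monotone
    convergence along the simple approximations [h]. *)
Lemma integral_density_measure (f : X -> \bar R) :
  measurable_fun setT f -> (forall x, 0 <= f x) ->
  \int[nu]_x f x = \int[m]_x (f x * (w x)%:E).
Proof.
move=> mf f0.
pose h := nnsfun_approx measurableT mf.
have hf x : (h n x)%:E @[n --> \oo] --> f x.
  by apply: cvg_nnsfun_approx.
transitivity (lim (\int[nu]_x (h n x)%:E @[n --> \oo])).
  rewrite -monotone_convergence//.
  - by apply: eq_integral => x _; apply/esym/cvg_lim => //; exact: hf.
  - by move=> n; exact/measurable_EFinP.
  - by move=> n x _; rewrite lee_fin.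
  - by move=> x _ a b ab; rewrite lee_fin; exact/lefP/nd_nnsfun_approx.
have mw' : measurable_fun setT (EFin \o w) by exact/measurable_EFinP.
transitivity (lim (\int[m]_x ((h n x)%:E * (w x)%:E) @[n --> \oo])); last first.
  rewrite -monotone_convergence//.
  - apply: eq_integral => x _; apply/cvg_lim => //.
    by apply: cvgeZr; [by []|exact: hf].
  - by move=> n; apply: emeasurable_funM => //; exact/measurable_EFinP.
  - by move=> n x _; rewrite mule_ge0// lee_fin.
  - move=> x _ a b ab; rewrite lee_wpmul2r// ?lee_fin//.
    exact/lefP/nd_nnsfun_approx.
suff E n : \int[nu]_x (h n x)%:E = \int[m]_x ((h n x)%:E * (w x)%:E).
  by under eq_fun do rewrite E.
transitivity (\int[nu]_x (\sum_(y \in range (h n))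
    (y * \1_(h n @^-1` [set y]) x)%:E)).
  by apply: eq_integral => t tE; rewrite /= fimfunE -fsumEFin.
have indich (k : {measure set X -> \bar R}) r :
    measurable_fun setT (fun x => (r * \1_(h n @^-1` [set r]) x)%:E).
  by apply/measurable_EFinP; exact: measurable_funM.
rewrite ge0_integral_fsum//; [|by move=> r; exact: indich
  |by move=> y x _; exact: nnfun_muleindic_ge0].
transitivity (\int[m]_x (\sum_(y \in range (h n))
    (y * \1_(h n @^-1` [set y]) x)%:E * (w x)%:E)); last first.
  apply: eq_integral => x _.
  rewrite -ge0_mule_fsuml => [|y]; last exact: nnfun_muleindic_ge0.
  by rewrite fsumEFin // -(fimfunE _ x).
rewrite ge0_integral_fsum//; last 2 first.
- by move=> y; apply: emeasurable_funM => //; exact: indich.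
- move=> y x _; apply: mule_ge0; last by rewrite lee_fin.
  exact: nnfun_muleindic_ge0.
apply: eq_fsbigr => r; rewrite inE => -[t _ rE].
have r0 : (0 <= r)%R by rewrite -rE.
have mA : measurable (h n @^-1` [set r]).
  by rewrite -[X in measurable X]setTI; exact: measurable_funP.
transitivity (r%:E * nu (h n @^-1` [set r])).
  under eq_integral do rewrite EFinM.
  by rewrite ge0_integralZl_EFin ?integral_indic ?setIT//; exact/measurable_EFinP.
under eq_integral do rewrite EFinM -muleA.
rewrite ge0_integralZl_EFin//; last 2 first.
- by move=> x _; rewrite mule_ge0 ?lee_fin.
- by apply: emeasurable_funM => //; exact/measurable_EFinP.
congr (_ * _); rewrite /density_measure integral_mkcond.
apply: eq_integral => x _; rewrite patchE indicE.
by case: ifPn => _; rewrite ?mul1e ?mul0e.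
Qed.

End density_measure.

Section change_of_variables.
Context (R : realType).
Local Notation lambda := (@lebesgue_measure R).
Local Open Scope ereal_scope.

(** [w] stands for the absolute value of the derivative of [phi]. Integrals over the whole line
    tolerate the default values that a total function takes at a pole. *)
Definition substitution (phi w : R -> R) := forall f : R -> \bar R,
  measurable_fun setT f -> (forall x, 0 <= f x) ->
  \int[lambda]_x (f (phi x) * (w x)%:E) = \int[lambda]_x f x.

(** The push-forward of the measure with density [w] is determined by half-open intervals, so it is
    Lebesgue measure as soon as it gives them their lengths. *)
Lemma substitution_ocitv (phi w : R -> R) (mphi : measurable_fun setT phi)
    (mw : measurable_fun setT w) (w0 : forall x, (0 <= w x)%R) :
  (forall a b : R, (a <= b)%R ->
    density_measure lambda mw w0 (phi @^-1` `]a, b]%classic) = (b - a)%:E) ->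
  substitution phi w.
Proof.
move=> abE f mf f0.
pose phi' : measurableTypeR R -> measurableTypeR R := phi.
have mphi' : measurable_fun setT phi' by [].
pose m := pushforward (density_measure lambda mw w0 : {measure set _ -> \bar R}) phi'.
have mE A : measurable A -> lambda A = m A.
  pose m' : {measure set (measurableTypeR R) -> \bar R} :=
    measure_function_pushforward__canonical__measure_function_Measure
      (density_measure lambda mw w0 : {measure set _ -> \bar R}) mphi'.
  move=> mA; apply: (@lebesgue_measure_unique R m') => // X [[a b] _ <-] /=.
  rewrite lebesgue_measure_itv/= lte_fin; case: ltP => [ab|ba].
    by rewrite [RHS](abE a b (ltW ab)) EFinB.
  rewrite set_itv_ge ?bnd_simp -?leNgt//.
  by rewrite /m' /= /pushforward preimage_set0 measure0.
transitivity (\int[m]_x f x); last first.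
  by apply: eq_measure_integral => A mA _; first [exact: mE|exact/esym/mE].
rewrite /m ge0_integral_pushforward//.
rewrite preimage_setT; apply/esym.
apply: (@integral_density_measure _ _ _ lambda w mw w0 (f \o phi)) => [|x /=//].
exact: measurableT_comp.
Qed.

Lemma substitution_affine (s t : R) : s != 0%R ->
  substitution (fun x => s * x + t)%R (fun=> `|s|)%R.
Proof.
move=> s0.
have ma : measurable_fun setT (fun x => s * x + t)%R.
  by apply: measurable_funD => //; exact: measurable_funM.
have w0 : forall x : R, (0 <= (fun=> `|s|) x)%R by [].
apply: (@substitution_ocitv _ _ ma (measurable_cst _) w0) => a b ab.
rewrite /density_measure.
rewrite -[LHS]/(\int[lambda]_(x in _) (cst `|s|%:E) x) integral_cst; last first.
  by rewrite -[X in measurable X]setTI; exact: ma.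
have [s1|s1|s1] := ltgtP 0%R s; last by rewrite -s1 eqxx in s0.
- rewrite (_ : _ @^-1` _ = `]((a - t) / s)%R, ((b - t) / s)%R]%classic).
    rewrite [X in _ * X]lebesgue_measure_itv/= lte_fin ltr_pM2r ?invr_gt0// ltrD2r.
    case: ltP => [ab'|ba]; last first.
      by rewrite mule0; congr EFin; apply/esym/eqP; rewrite subr_eq0 eq_le ba ab.
    rewrite -EFinB -EFinM (gtr0_norm s1); congr EFin; field; exact: s0.
  apply/seteqP; split => x /=; rewrite !in_itv/= => /andP[]; rewrite ltr_pdivrMr//
    ler_pdivlMr// ltrBlDr lerBrDr mulrC => ? ?; apply/andP; split=> //.
- rewrite (_ : _ @^-1` _ = `[((b - t) / s)%R, ((a - t) / s)%R[%classic).
    rewrite [X in _ * X]lebesgue_measure_itv/= lte_fin ltr_nM2r ?invr_lt0// ltrD2r.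
    case: ltP => [ab'|ba]; last first.
      by rewrite mule0; congr EFin; apply/esym/eqP; rewrite subr_eq0 eq_le ba ab.
    rewrite -EFinB -EFinM (ltr0_norm s1); congr EFin; field; exact: s0.
  apply/seteqP; split => x /=; rewrite !in_itv/= => /andP[]; rewrite ltr_ndivlMr//
    ler_ndivrMr// lerBrDr ltrBlDr mulrC => ? ?; apply/andP; split=> //.
Qed.

Let w (x : R) := ((x ^+ 2)^-1)%R.

(** The default value sends 0 to 0; elsewhere inversion is continuous, so the point 0 is split
    off. *)
Lemma measurable_inv : measurable_fun setT (fun x : R => x^-1)%R.
Proof.
rewrite -(setUv [set 0%R]); apply/measurable_funU => //; first exact: measurableC.
split; first exact: measurable_fun_set1.
apply: open_continuous_measurable_fun.
  by apply: closed_openC; exact: closed_eq.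
by move=> x; rewrite inE /= => /eqP x0; exact: inv_continuous.
Qed.

Let mw : measurable_fun setT w.
Proof.
by apply: (measurableT_comp measurable_inv); exact: measurable_funX.
Qed.

Let w0 x : (0 <= w x)%R.
Proof. by rewrite invr_ge0 sqr_ge0. Qed.

Local Notation nu := (density_measure lambda mw w0).

Let nuN (A : set R) : measurable A -> nu (-%R @^-1` A) = nu A.
Proof.
move=> mA; rewrite /density_measure.
transitivity (\int[pushforward lambda (-%R : _ -> measurableTypeR R)]_(x in A)
   (w x)%:E); last first.
  by apply: eq_measure_integral => B mB _; exact: lebesgue_measureN.
rewrite ge0_integral_pushforward//.
- by apply: eq_integral => x _; rewrite /w /= sqrrN.
- exact/measurable_EFinP/measurable_funTS.
- by move=> x _; rewrite lee_fin.
Qed.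

Let nu1 (x : R) : nu [set x] = 0.
Proof.
apply: null_set_integral => //; last exact: lebesgue_measure_set1.
exact/measurable_EFinP/measurable_funTS.
Qed.

Let nu_ray (b : R) : (0 < b)%R -> nu `[b, +oo[%classic = (b^-1)%:E.
Proof.
move=> b0; rewrite /density_measure.
have bP x : (b <= x -> 0 < x)%R by move=> /(lt_le_trans b0).
rewrite (@ge0_continuous_FTC2y _ _ (fun x => - x^-1)%R _ 0%R).
- by rewrite add0e -EFinN opprK.
- by move=> x _; exact: w0.
- apply: continuous_in_subspaceT => x; rewrite inE/= in_itv/= andbT => /bP x0.
  apply: cvgV; first by rewrite sqrf_eq0 gt_eqF.
  exact: exprn_continuous.
- rewrite -oppr0; apply: cvgN; apply/gtr0_cvgV0 => //.
  by near=> x; near: x; exact: nbhs_pinfty_gt.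
- move=> x /ltW/bP x0; apply: derivableN; apply: derivableV => //.
  by rewrite gt_eqF.
- apply: cvg_at_right_filter; apply: cvgN; apply: cvgV; last exact: cvg_id.
  by rewrite gt_eqF.
- move=> x; rewrite in_itv/= andbT => /ltW/bP x0.
  rewrite derive1E deriveN; last by apply: derivableV => //; rewrite gt_eqF.
  rewrite deriveV//; last by rewrite gt_eqF.
  by rewrite derive_id /w scaleNr opprK [_ *: _]mulr1.
Unshelve. all: by end_near. Qed.

(** Everything reduces to []0, c]], whose preimage is the ray from [c^-1] on, of mass [c].
    Reflection treats the negative side, and a general interval is a difference or a union of such
    pieces according to the position of 0. *)
Lemma substitution_inv : substitution (fun x : R => x^-1)%R w.
Proof.
apply: (@substitution_ocitv _ _ measurable_inv mw w0) => a b ab.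
set phi := fun x : R => x^-1%R.
have mp A : measurable A -> measurable (phi @^-1` A).
  by move=> mA; rewrite -[X in measurable X]setTI; exact: measurable_inv.
have phi1 (x : R) : nu (phi @^-1` [set x]) = 0.
  rewrite (_ : phi @^-1` _ = [set x^-1]%R) ?nu1//.
  by apply/seteqP; split => y /=; rewrite /phi; [move=> <-|move=> ->]; rewrite invrK.
have pos (c : R) : (0 <= c)%R -> nu (phi @^-1` `]0%R, c]%classic) = c%:E.
  rewrite le_eqVlt => /orP[/eqP <-|c0].
    by rewrite set_itv_ge ?bnd_simp ?ltxx// preimage_set0 measure0.
  rewrite (_ : phi @^-1` _ = `[c^-1%R, +oo[%classic).
    by rewrite nu_ray ?invr_gt0// invrK.
  apply/seteqP; split => x /=; rewrite !in_itv/= andbT /phi invr_gt0.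
    by move=> /andP[x0]; rewrite invf_ple ?posrE.
  move=> cx; have x0 : (0 < x)%R by rewrite (lt_le_trans _ cx)// invr_gt0.
  by rewrite x0/= invf_ple ?posrE.
(* Reflection turns []-c, 0]] into [[0, c[], which differs from []0, c]] only in its endpoints, and
   these have preimages of mass zero. *)
have neg (c : R) : (0 <= c)%R -> nu (phi @^-1` `](- c)%R, 0%R]%classic) = c%:E.
  move=> c0; rewrite -nuN; last exact: mp.
  rewrite (_ : -%R @^-1` _ = phi @^-1` `[0%R, c[%classic); last first.
    apply/seteqP; split => x /=; rewrite !in_itv/= /phi invrN.
      by rewrite ltrN2 oppr_le0 andbC.
    by rewrite ltrN2 oppr_le0 andbC.
  move: c0; rewrite le_eqVlt => /orP[/eqP <-|c0].
    by rewrite set_itv_ge ?bnd_simp ?ltxx// preimage_set0 measure0.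
  rewrite -(pos _ (ltW c0)) -(setU1itv false) ?bnd_simp// -(setUitv1 true) ?bnd_simp// !preimage_setU.
  rewrite [X in nu X = _]setUC.
  by rewrite !measureU0//; first [exact: mp|exact: phi1].
have [a0|a0] := leP 0%R a.
  have b0 := le_trans a0 ab.
  have /eqP : nu (phi @^-1` `]0%R, b]) = nu (phi @^-1` `]0%R, a]) + nu (phi @^-1` `]a, b]).
    rewrite -measureU//; try exact: mp.
      by rewrite -preimage_setU -itv_bndbnd_setU ?bnd_simp.
    rewrite -preimage_setI (_ : _ `&` _ = set0) ?preimage_set0//.
    by apply/seteqP; split => x//=; rewrite !in_itv/= => -[/andP[_ +]] /andP[]; case: leP.
  by rewrite !pos// addeC -sube_eq ?fin_num_adde_defl// => /eqP <-.
have [b0|b0] := leP b 0%R.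
  have /eqP : nu (phi @^-1` `](- - a)%R, 0%R]) = nu (phi @^-1` `](- - b)%R, 0%R]) + nu (phi @^-1` `]a, b]).
    rewrite -measureU//; try exact: mp.
      by rewrite -preimage_setU !opprK [in RHS]setUC -itv_bndbnd_setU ?bnd_simp.
    rewrite opprK -preimage_setI (_ : _ `&` _ = set0) ?preimage_set0//.
    by apply/seteqP; split => x//=; rewrite !in_itv/= => -[/andP[+ _]] /andP[_]; case: leP.
  rewrite !neg ?oppr_ge0// ?(ltW a0)// addeC -sube_eq ?fin_num_adde_defl// => /eqP <-.
  by rewrite -EFinB opprK addrC.
have -> : `]a, b]%classic = `](- - a)%R, 0%R]%classic `|` `]0%R, b]%classic.
  by rewrite opprK; apply: itv_bndbnd_setU; rewrite bnd_simp ltW.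
rewrite preimage_setU measureU//; try exact: mp.
  rewrite [X in X + _]neg ?oppr_ge0 ?ltW// [X in _ + X]pos ?ltW//.
  by rewrite -EFinD addrC.
rewrite opprK -preimage_setI (_ : _ `&` _ = set0) ?preimage_set0//.
by apply/seteqP; split => x//=; rewrite !in_itv/= => -[/andP[_ +]] /andP[+ _]; case: leP.
Qed.

Lemma substitution_comp (phi w1 psi w2 : R -> R) :
  measurable_fun setT phi -> measurable_fun setT w1 -> (forall x, (0 <= w1 x)%R) ->
  substitution phi w1 -> substitution psi w2 ->
  substitution (phi \o psi) (fun x => w1 (psi x) * w2 x)%R.
Proof.
move=> mphi mw1 w10 phiP psiP f mf f0.
rewrite -(phiP f)//.
rewrite -(psiP (fun x => f (phi x) * (w1 x)%:E))//.
- by apply: eq_integral => x _; rewrite EFinM muleA.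
- apply: emeasurable_funM; first exact: measurableT_comp.
  exact/measurable_EFinP.
- by move=> x; rewrite mule_ge0// lee_fin.
Qed.

(** [p] is meant to be a pole, the one point where default values can make two expressions of the
    same map disagree. *)
Lemma eq_substitution (phi w1 psi w2 : R -> R) (p : R) :
  measurable_fun setT phi -> measurable_fun setT w1 -> (forall x, (0 <= w1 x)%R) ->
  measurable_fun setT psi -> measurable_fun setT w2 -> (forall x, (0 <= w2 x)%R) ->
  (forall x, x != p -> phi x = psi x /\ w1 x = w2 x) ->
  substitution phi w1 -> substitution psi w2.
Proof.
move=> mphi mw1 w10 mpsi mw2 w20 e phiP f mf f0.
rewrite -(phiP f)//; apply: ge0_ae_eq_integral => //.
- apply: emeasurable_funM; first exact: measurableT_comp.
  exact/measurable_EFinP.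
- apply: emeasurable_funM; first exact: measurableT_comp.
  exact/measurable_EFinP.
- by move=> x _; rewrite mule_ge0// lee_fin.
- by move=> x _; rewrite mule_ge0// lee_fin.
- exists [set p]; split => //; first exact: lebesgue_measure_set1.
  move=> x /= /not_implyP[_ xE]; apply: contrapT => /eqP /e[ephi ew].
  by apply: xE; rewrite ephi ew.
Qed.

End change_of_variables.

(** * Change of variables for Moebius maps *)

Section mobius_theory.
Context (R : realType).
Implicit Types (M : 'M[R]_2) (x y : R).

Definition denom M x := M 1 0 * x + M 1 1.

(* The absolute value of the derivative of [mobius M]. *)
Definition mobius_jac M x := (denom M x ^+ 2)^-1.

Lemma mobius_jac_ge0 M x : 0 <= mobius_jac M x.
Proof. by rewrite invr_ge0 sqr_ge0. Qed.

Lemma det_mx2 M : \det M = M 0 0 * M 1 1 - M 0 1 * M 1 0.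
Proof.
rewrite (expand_det_row _ 0) !big_ord_recl big_ord0 addr0 /cofactor !det_mx11 !mxE.
rewrite /= !expr0 !mul1r.
rewrite (_ : lift 0 0 = 1); last exact/val_inj.
rewrite (_ : lift 1 0 = 0); last exact/val_inj.
by rewrite /bump /= expr1 mulN1r mulrN.
Qed.

Lemma det_pm1E M : det_pm1 M ->
  `|M 0 0 * M 1 1 - M 0 1 * M 1 0| = 1 /\ M 0 0 * M 1 1 - M 0 1 * M 1 0 != 0.
Proof.
by rewrite /det_pm1 det_mx2 => -[->|->]; rewrite ?normrN normr1; split => //.
Qed.

Lemma measurable_denom M : measurable_fun setT (denom M).
Proof. by apply: measurable_funD => //; exact: measurable_funM. Qed.

Lemma measurable_mobius_jac M : measurable_fun setT (mobius_jac M).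
Proof.
apply: (measurableT_comp (@measurable_inv R)).
exact: (measurable_funX _ (measurable_denom M)).
Qed.

Lemma measurable_mobius M : measurable_fun setT (mobius M).
Proof.
apply: measurable_funM.
  by apply: measurable_funD => //; exact: measurable_funM.
exact: (measurableT_comp (@measurable_inv R) (measurable_denom M)).
Qed.

Lemma mobius_sub M x y : denom M x != 0 -> denom M y != 0 ->
  mobius M x - mobius M y =
  (M 0 0 * M 1 1 - M 0 1 * M 1 0) * (x - y) / (denom M x * denom M y).
Proof. by rewrite /mobius /denom => x0 y0; field; rewrite x0 y0. Qed.

(** If the lower left entry [c] is nonzero, the map is [a / c - (D / c ^ 2) / (x + d / c)]: an
    affine map after an inversion after a translation, and the chain rule for substitutions applies.
    If [c = 0] the map is affine. *)
Lemma substitution_mobius M : det_pm1 M -> substitution (mobius M) (mobius_jac M).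
Proof.
move=> /det_pm1E[D1 D0]; have [c0|c0] := eqVneq (M 1 0) 0.
  move: D1 D0; rewrite c0 mulr0 subr0 => ad1 ad0.
  have [a0 d0] : M 0 0 != 0 /\ M 1 1 != 0.
    by move: ad0; rewrite mulf_eq0 negb_or => /andP[].
  have := @substitution_affine R (M 0 0 / M 1 1) (M 0 1 / M 1 1).
  rewrite mulf_neq0 ?invr_neq0// => /(_ isT).
  rewrite (_ : (fun x => _) = mobius M); last first.
    by apply/funext => x; rewrite /mobius c0; field; rewrite ?mul0r ?add0r d0.
  rewrite (_ : (fun _ => `|_|) = mobius_jac M)//.
  apply/funext => x; rewrite /mobius_jac /denom c0 mul0r add0r.
  rewrite (_ : _ / _ = (M 0 0 * M 1 1) / M 1 1 ^+ 2); last by field.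
  by rewrite normrM ad1 mul1r ger0_norm// invr_ge0 sqr_ge0.
set D := _ - _ in D1 D0.
have s0 : - D / M 1 0 ^+ 2 != 0.
  by rewrite mulf_neq0 ?oppr_eq0 ?invr_eq0 ?sqrf_eq0.
have ma : measurable_fun setT (fun x => (- D / M 1 0 ^+ 2) * x + M 0 0 / M 1 0).
  by apply: measurable_funD => //; exact: measurable_funM.
have mt : measurable_fun setT (fun x : R => 1 * x + M 1 1 / M 1 0).
  by apply: measurable_funD => //; exact: measurable_funM.
have mw : measurable_fun setT (fun x : R => (x ^+ 2)^-1).
  by apply: (measurableT_comp (@measurable_inv R)); exact: measurable_funX.
have w0 (x : R) : 0 <= (x ^+ 2)^-1 by rewrite invr_ge0 sqr_ge0.
have P1 := substitution_comp (@measurable_inv R) mw w0 (@substitution_inv R)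
  (substitution_affine (M 1 1 / M 1 0) (oner_neq0 R)).
have P2 := substitution_comp ma (measurable_cst _) (fun=> normr_ge0 _)
  (substitution_affine (M 0 0 / M 1 0) s0) P1.
apply: eq_substitution P2 => //.
- apply: measurableT_comp => //; apply: measurableT_comp => //.
  exact: measurable_inv.
- apply: measurable_funM => //; apply: measurable_funM => //.
  exact: (measurableT_comp mw mt).
- by move=> x; rewrite !mulr_ge0// w0.
- exact: measurable_mobius.
- exact: measurable_mobius_jac.
- exact: mobius_jac_ge0.
- instantiate (1 := - M 1 1 / M 1 0).
  move=> x xp.
  have x0 : M 1 0 * x + M 1 1 != 0.
    apply: contra xp => /eqP e; apply/eqP.
    by apply: (mulfI c0); rewrite mulrCA divff// mulr1; lra.
  have x1 : 1 * x + M 1 1 / M 1 0 != 0.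
    by rewrite (_ : _ + _ = (M 1 0 * x + M 1 1) / M 1 0) ?mulf_neq0 ?invr_eq0//; field.
  split.
    by rewrite /= /mobius /D; field; rewrite x0 c0.
  rewrite /mobius_jac /denom /= normr1 mulr1 normrM normrN D1 mul1r.
  rewrite ger0_norm ?w0//; field.
  by rewrite x0 c0.
Qed.

End mobius_theory.

(** * Finite measures and the maximal ergodic inequality *)

Section finite_measures.
Context d (X : measurableType d) (R : realType) (m : {finite_measure set X -> \bar R}).
Implicit Types A B : set X.

Definition mass A : R := fine (m A).

Lemma massE A : measurable A -> (mass A)%:E = m A.
Proof. by move=> mA; rewrite /mass fineK// fin_num_measure. Qed.

Lemma mass_ge0 A : 0 <= mass A.
Proof. by rewrite /mass fine_ge0. Qed.

Lemma le_mass A B : measurable A -> measurable B -> A `<=` B -> mass A <= mass B.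
Proof.
by move=> mA mB AB; rewrite -lee_fin !massE//; apply: le_measure; rewrite ?inE.
Qed.

Lemma massU A B : measurable A -> measurable B -> A `&` B = set0 ->
  mass (A `|` B) = mass A + mass B.
Proof.
move=> mA mB AB; apply: EFin_inj.
by rewrite EFinD !massE ?measureU//; exact: measurableU.
Qed.

Lemma mass_eq0 A : measurable A -> (mass A == 0) = (m A == 0%E).
Proof. by move=> mA; rewrite -massE// eqe. Qed.

Lemma measureU_eq0 A B : measurable A -> measurable B -> m A = 0%E -> m B = 0%E ->
  m (A `|` B) = 0%E.
Proof. by move=> mA mB A0 B0; rewrite measureU0. Qed.

Lemma measure_sub0 A B : measurable A -> measurable B -> A `<=` B -> m B = 0%E ->
  m A = 0%E.
Proof. by move=> mA mB AB B0; apply: (subset_measure0 mA mB AB). Qed.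

Lemma massC A : measurable A -> mass (~` A) = mass setT - mass A.
Proof.
move=> mA; rewrite -(setUv A) massU ?setICr//; last exact: measurableC.
by rewrite addrC addKr.
Qed.

Lemma mass_bigcup_ge (F : (set X)^nat) (c : R) : (forall n, measurable (F n)) ->
  nondecreasing_seq F -> (forall n, mass (F n) <= c) -> mass (\bigcup_n F n) <= c.
Proof.
move=> mF ndF Fc.
have mU : measurable (\bigcup_n F n) by exact: bigcup_measurable.
rewrite -lee_fin massE//.
have := nondecreasing_cvg_mu mF mU ndF (mu := m).
move/cvg_lim => <-//; apply: lime_le; last first.
  by apply: nearW => n /=; rewrite -massE// lee_fin.
by apply/cvg_ex; exists (m (\bigcup_n F n)); exact: nondecreasing_cvg_mu.
Qed.

Lemma mass_bigcap_ge (F : (set X)^nat) (c : R) : (forall n, measurable (F n)) ->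
  nonincreasing_seq F -> (forall n, c <= mass (F n)) -> c <= mass (\bigcap_n F n).
Proof.
move=> mF niF Fc.
have mU : measurable (\bigcap_n F n) by exact: bigcap_measurableType.
have : mass (\bigcup_n ~` F n) <= mass setT - c.
  apply: mass_bigcup_ge => [n|i j ij|n]; first exact: measurableC.
    by apply/subsetPset/subsetC/subsetPset/niF.
  by rewrite massC// lerD2l lerN2.
by rewrite -setC_bigcap massC// lerD2l lerN2.
Qed.

(** A reverse Fatou inequality for sets: the upper limit is a decreasing intersection of unions, and
    finiteness gives continuity from above. *)
Lemma mass_lim_sup_set (F : (set X)^nat) (c : R) : (forall n, measurable (F n)) ->
  (forall n, c <= mass (F n)) -> c <= mass (lim_sup_set F).
Proof.
move=> mF Fc; apply: mass_bigcap_ge => [n|i j ij|n].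
- by apply: bigcup_measurable => k _; exact: mF.
- by apply/subsetPset => x [k /= jk Fkx]; exists k => //=; exact: leq_trans ij jk.
- apply: le_trans (Fc n) _; apply: le_mass => //.
    by apply: bigcup_measurable => k _; exact: mF.
  by move=> x Fnx; exists n => /=.
Qed.

End finite_measures.

Section absolute_continuity.
Context d (X : measurableType d) (R : realType).
Variables l m : {finite_measure set X -> \bar R}.

(** Borel-Cantelli: otherwise sets of [l]-mass at least [s] and of [m]-mass below [2 ^ -(n + 1)]
    would have an upper limit that is [m]-null and still of [l]-mass at least [s]. *)
Lemma mass_abs_continuous (s : R) : 0 < s ->
  (forall A, measurable A -> m A = 0%E -> l A = 0%E) ->
  exists2 t : R, 0 < t & forall A, measurable A -> s <= mass l A -> t <= mass m A.
Proof.
move=> s0 lm; apply: contrapT => no.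
have F_ n : {A | [/\ measurable A, s <= mass l A & mass m A < 1 / (2 ^ n.+1)%:R]}.
  apply/cid; apply: contrapT => non; apply: no; exists (1 / (2 ^ n.+1)%:R).
    by rewrite divr_gt0// ltr0n expn_gt0.
  move=> A mA sA; rewrite leNgt; apply/negP => Am; apply: non.
  by exists A.
pose F n := sval (F_ n).
have mF n : measurable (F n) by rewrite /F; case: (F_ n) => A [].
have sF n : s <= mass l (F n) by rewrite /F; case: (F_ n) => A [].
have Fs n : mass m (F n) < 1 / (2 ^ n.+1)%:R by rewrite /F; case: (F_ n) => A [].
have mL : measurable (lim_sup_set F).
  by apply: bigcapT_measurable => n; apply: bigcup_measurable => k _; exact: mF.
have m0 : m (lim_sup_set F) = 0%E.
  apply: lim_sup_set_cvg0 => //.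
  apply: (@le_lt_trans _ _ 1%:E); last exact: ltry.
  have e1 := @epsilon_trick0 R 1 xpredT ler01.
  apply: le_trans e1.
  apply: lee_nneseries => // n _; rewrite -[leLHS](massE m (mF n)) lee_fin.
  exact/ltW.
by have := mass_lim_sup_set mF sF; rewrite /mass lm//= leNgt s0.
Qed.

End absolute_continuity.

(** * Occupation times of a set under an ergodic map *)

Section occupation.
Context d (X : measurableType d) (R : realType).
Variables m : {finite_measure set X -> \bar R}.
Variables (T : X -> X) (mT : measurable_fun setT T).
Hypothesis inv : forall A, measurable A -> m (T @^-1` A) = m A.

Lemma measurable_preimage_iter n A : measurable A -> measurable (iter n T @^-1` A).
Proof.
move=> mA; elim: n => [//|n IH].
rewrite (_ : _ @^-1` _ = T @^-1` (iter n T @^-1` A)).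
  by rewrite -[X in measurable X]setTI; exact: mT.
by apply/seteqP; split => x /=; rewrite -iterSr.
Qed.

Variables (E : set X) (mE : measurable E).

Variable a : R.
Hypothesis a0 : 0 < a.

(* The maximum over [k <= n] of [\sum_(i < k) (\1_E (iter i T x) - a)]. *)
Fixpoint max_excess n x : R :=
  if n is n'.+1 then Num.max 0 (\1_E x - a + max_excess n' (T x)) else 0.

Lemma max_excess_ge0 n x : 0 <= max_excess n x.
Proof. by case: n => [|n] //=; rewrite le_max lexx. Qed.

Lemma measurable_max_excess n : measurable_fun setT (max_excess n).
Proof.
elim: n => [|n IH] /=; first exact: measurable_cst.
apply: measurable_maxr => //; apply: measurable_funD.
  by apply: measurable_funB => //; exact: measurable_indic.
exact: measurableT_comp.
Qed.

Lemma max_excess_nd n x : max_excess n x <= max_excess n.+1 x.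
Proof.
elim: n x => [|n IH] x; first exact: max_excess_ge0.
by rewrite [leLHS]/= [leRHS]/= ge_max !le_max lexx/= lerD2l IH orbT.
Qed.

Lemma max_excess_le n x : max_excess n x <= n%:R.
Proof.
elim: n x => [|n IH] x /=; first exact: lexx.
rewrite ge_max ler0n/= -natr1 addrC lerD//.
rewrite indicE; case: (x \in E) => /=; move: a0; lra.
Qed.

(* Garsia's proof of the maximal ergodic inequality. *)
Lemma maximal_ergodic n : a * mass m [set x | 0 < max_excess n x] <= mass m E.
Proof.
case: n => [|n].
  rewrite (_ : [set x | _] = set0); last by apply/seteqP; split => x //=; rewrite ltxx.
  by rewrite /mass measure0 mulr0 fine_ge0.
set M := max_excess n.+1; set P := [set x | 0 < M x].
have mM : measurable_fun setT M := measurable_max_excess n.+1.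
have mP : measurable P.
  rewrite (_ : P = M @^-1` `]0, +oo[%classic); last first.
    by apply/seteqP; split => x /=; rewrite in_itv/= andbT.
  by rewrite -[X in measurable X]setTI; exact: mM.
have iM : (\int[m]_x (M x)%:E \is a fin_num)%E.
  rewrite ge0_fin_numE; last by apply: integral_ge0 => x _; rewrite lee_fin max_excess_ge0.
  apply: (@le_lt_trans _ _ (\int[m]_x (cst (n.+1%:R%:E)) x)%E).
    apply: ge0_le_integral => //.
    - by move=> x _; rewrite lee_fin max_excess_ge0.
    - exact/measurable_EFinP.
    - by move=> x _; rewrite lee_fin max_excess_le.
  by rewrite integral_cst// -[X in (_ * X)%E](massE m measurableT) -EFinM ltry.
(* On [P] the maximum is the recursive term, so [M] is at most [1_E - a] plus [M] at the image; off
   [P] the function [M] vanishes. After integration the two integrals of [M] cancel by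
   invariance. *)
have key : (\int[m]_x ((M x)%:E + (a * \1_P x)%:E) <=
            \int[m]_x ((\1_(E `&` P) x)%:E + (M (T x))%:E))%E.
  apply: ge0_le_integral => //.
  - by move=> x _; rewrite -EFinD lee_fin addr_ge0// ?max_excess_ge0// mulr_ge0// ltW.
  - apply: emeasurable_funD; first exact/measurable_EFinP.
    by apply/measurable_EFinP; apply: measurable_funM => //; exact: measurable_indic.
  - apply: emeasurable_funD.
      by apply/measurable_EFinP/measurable_indic; exact: measurableI.
    by apply/measurable_EFinP; exact: measurableT_comp.
  - move=> x _; rewrite -!EFinD lee_fin !indicE in_setI.
    have [Px|nPx] := boolP (x \in P); last first.
      rewrite andbF mulr0 addr0 add0r.
      apply: le_trans (max_excess_ge0 _ _).
      by rewrite leNgt; apply: contra nPx; rewrite inE.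
    rewrite andbT mulr1; move: (Px); rewrite inE /P /= /M /= => Px'.
    have := max_excess_nd n (T x); rewrite -/M => nd.
    have E1 : Num.max 0 (\1_E x - a + max_excess n (T x)) = \1_E x - a + max_excess n (T x).
      by apply/max_idPr; move: Px'; rewrite lt_max ltxx/= => /ltW.
    rewrite E1 indicE; move: nd; rewrite /= /M /=; lra.
rewrite ge0_integralD//= in key; last 4 first.
- by move=> x _; rewrite lee_fin max_excess_ge0.
- exact/measurable_EFinP.
- by move=> x _; rewrite lee_fin mulr_ge0// ltW.
- by apply/measurable_EFinP; apply: measurable_funM => //; exact: measurable_indic.
rewrite ge0_integralD//= in key; last 3 first.
- by apply/measurable_EFinP/measurable_indic; exact: measurableI.
- by move=> x _; rewrite lee_fin max_excess_ge0.
- by apply/measurable_EFinP; exact: measurableT_comp.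
have MT : (\int[m]_x (M (T x))%:E = \int[m]_x (M x)%:E)%E.
  transitivity (\int[pushforward m T]_x (M x)%:E)%E.
    by rewrite ge0_integral_pushforward//=; [exact/measurable_EFinP|move=> x _; rewrite lee_fin max_excess_ge0].
  by apply: eq_measure_integral => A mA _; exact: inv.
rewrite MT addeC leeD2rE// in key.
move: key; under eq_integral do rewrite EFinM.
have a0' := ltW a0.
rewrite ge0_integralZl_EFin//; last by apply/measurable_EFinP/measurable_indic.
have mEP := measurableI _ _ mE mP.
rewrite !integral_indic ?setIT// => {}key.
have : ((a * mass m P)%:E <= (mass m (E `&` P))%:E)%E.
  by rewrite EFinM (massE m mP) (massE m mEP).
by rewrite lee_fin => /le_trans; apply; exact: le_mass.
Qed.

(** Points whose excess over the rate [a] never passes [k]. The union over [k] is exactly invariant,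
    since one application of [T] changes the excess by a bounded amount. *)
Let Lim k := [set x | forall n, max_excess n x <= k%:R].

Let mLim k : measurable (Lim k).
Proof.
rewrite (_ : Lim k = \bigcap_n max_excess n @^-1` `]-oo, k%:R]%classic).
  apply: bigcap_measurableType => n _; rewrite -[X in measurable X]setTI.
  exact: measurable_max_excess.
apply/seteqP; split => [x h n _ /=|x h n]; first by rewrite in_itv/=; exact: h.
by have := h n I; rewrite /= in_itv.
Qed.

Let ndLim : nondecreasing_seq Lim.
Proof.
move=> i j ij; apply/subsetPset => x h n; apply: le_trans (h n) _.
by rewrite ler_nat.
Qed.

Let LimT : T @^-1` (\bigcup_k Lim k) = \bigcup_k Lim k.
Proof.
apply/seteqP; split => x /= [k _ h].
  exists k.+1 => // n; case: n => [|n] /=; first exact: ler0n.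
  have := h n; rewrite ge_max ler0n/= -natr1 indicE.
  by case: (x \in E) => /=; move: a0; lra.
have [p ap] : exists p : nat, a <= p%:R.
  by exists (Num.truncn a).+1; rewrite ltW// truncnS_gt.
exists (p + k)%N => // n; have := h n.+1; rewrite /= ge_max => /andP[_].
rewrite natrD indicE; move: ap.
case: (x \in E) => /=; lra.
Qed.

Hypothesis ergo : forall A, measurable A -> m (A `+` T @^-1` A) = 0%E ->
  m A = 0%E \/ m (~` A) = 0%E.
Variable l : {finite_measure set X -> \bar R}.
Hypothesis lm : forall A, measurable A -> m A = 0%E -> l A = 0%E.

Let excess_ge n x :
  \sum_(i < n) (\1_(iter i T @^-1` E) x - a) <= max_excess n x.
Proof.
elim: n x => [|n IH] x; first by rewrite big_ord0.
rewrite big_ord_recl /= le_max; apply/orP; right.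
rewrite lerD//; apply: le_trans (IH (T x)); apply: ler_sum => i _.
rewrite !indicE (_ : (x \in _) = (T x \in iter i T @^-1` E))//.
by apply/idP/idP; rewrite !inE /= -iterS iterSr.
Qed.

(** The left side is the [l]-integral of the number of visits to [E] before time [n]: at most
    [a * n + k] on [Lim k], and at most [n] elsewhere. *)
Let sum_visits n k : \sum_(i < n) mass l (iter i T @^-1` E) <=
  (a * n%:R + k%:R) * mass l setT + n%:R * mass l (~` Lim k).
Proof.
have mE' i : measurable (iter i T @^-1` E) by exact: measurable_preimage_iter.
have mLC : measurable (~` Lim k) by exact: measurableC.
rewrite -lee_fin EFinD -sumEFin.
apply: (@le_trans _ _ (\int[l]_x ((a * n%:R + k%:R)%:E + (n%:R * \1_(~` Lim k) x)%:E))%E).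
  rewrite [leLHS](_ : _ = \int[l]_x (\sum_(i < n) (\1_(iter i T @^-1` E) x)%:E))%E; last first.
    rewrite ge0_integral_sum//; last first.
      by move=> i; exact/measurable_EFinP/measurable_indic.
    by apply: eq_bigr => i _; rewrite integral_indic// setIT massE.
  apply: ge0_le_integral => //.
  - by move=> x _; apply: sume_ge0.
  - apply: emeasurable_sum => i; exact/measurable_EFinP/measurable_indic.
  - apply: emeasurable_funD => //.
    by apply/measurable_EFinP; apply: measurable_funM => //; exact: measurable_indic.
  - move=> x _; rewrite sumEFin -EFinD lee_fin indicE.
    have [|] := boolP (x \in ~` Lim k).
      move=> _; rewrite mulr1 -[leLHS]add0r lerD//.
        by rewrite addr_ge0// mulr_ge0// ltW.
      apply: (@le_trans _ _ (\sum_(i < n) 1)); last by rewrite sumr_const card_ord.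
      by apply: ler_sum => i _; rewrite indicE lern1 leq_b1.
    rewrite notin_setE /= => /contrapT /(_ n) xk.
    have := le_trans (excess_ge n x) xk.
    rewrite sumrB sumr_const card_ord -mulr_natr mulr0 addr0; lra.
rewrite ge0_integralD//=; last 2 first.
- by move=> x _; rewrite lee_fin addr_ge0// mulr_ge0// ltW.
- by apply/measurable_EFinP; apply: measurable_funM => //; exact: measurable_indic.
rewrite leeD//.
  by rewrite integral_cst// EFinM [X in (_ <= _ * X)%E]massE.
under eq_integral do rewrite EFinM.
rewrite ge0_integralZl_EFin//; last exact/measurable_EFinP/measurable_indic.
by rewrite integral_indic// setIT EFinM [X in (_ <= _ * X)%E]massE.
Qed.

(** By ergodicity the points of bounded excess are null or conull. In the null case almost every
    point has positive excess, and the maximal inequality contradicts the hypothesis on [E]. In the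
    conull case, also for [l], the set [E] is visited at rate at most [a], and averaging over [n]
    bounds [c]. *)
Lemma occupation_bound_lt (c : R) : mass m E < a * mass m setT ->
  (forall n, c <= mass l (iter n T @^-1` E)) -> c <= a * mass l setT.
Proof.
move=> Ea cl.
have mU : measurable (\bigcup_k Lim k) by apply: bigcup_measurable.
have [m0|m0] : m (\bigcup_k Lim k) = 0%E \/ m (~` \bigcup_k Lim k) = 0%E.
  by have := ergo mU; rewrite LimT setYK measure0; apply.
- have : mass m (\bigcup_n [set x | 0 < max_excess n x]) <= mass m E / a.
    apply: mass_bigcup_ge => [n|i j ij|n].
    - rewrite (_ : [set x | _] = max_excess n @^-1` `]0, +oo[%classic).
        by rewrite -[X in measurable X]setTI; exact: measurable_max_excess.
      by apply/seteqP; split => x /=; rewrite in_itv/= andbT.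
    - apply/subsetPset => x /= /lt_le_trans; apply.
      have /nondecreasing_seqP h : forall n, max_excess n x <= max_excess n.+1 x.
        by move=> n; exact: max_excess_nd.
      exact: h.
    - by rewrite ler_pdivlMr// mulrC maximal_ergodic.
  have : mass m (~` (\bigcup_k Lim k)) <= mass m (\bigcup_n [set x | 0 < max_excess n x]).
    apply: le_mass.
    - exact: measurableC.
    - apply: bigcup_measurable => n _.
      rewrite (_ : [set x | _] = max_excess n @^-1` `]0, +oo[%classic).
        by rewrite -[X in measurable X]setTI; exact: measurable_max_excess.
      by apply/seteqP; split => x /=; rewrite in_itv/= andbT.
    - move=> x nx; apply: contrapT => no; apply: nx; exists 0%N => // n.
      by rewrite leNgt; apply/negP => nx; apply: no; exists n.
  rewrite massC// {2}/mass m0 subr0 => /le_trans /[apply].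
  by rewrite ler_pdivlMr// mulrC leNgt Ea.
- have lU0 : mass l (~` \bigcup_k Lim k) = 0.
    by rewrite /mass lm//; exact: measurableC.
  have step k : c <= a * mass l setT + mass l (~` Lim k).
    rewrite leNgt; apply/negP; set q := (X in X < _) => qc.
    have cq : 0 < c - q by rewrite subr_gt0.
    pose n := (Num.truncn (k%:R * mass l setT / (c - q))).+1.
    have nP : k%:R * mass l setT < n%:R * (c - q).
      by rewrite -ltr_pdivrMr// truncnS_gt.
    have : n%:R * c <= (a * n%:R + k%:R) * mass l setT + n%:R * mass l (~` Lim k).
      apply: le_trans (sum_visits n k).
      rewrite -[n in n%:R]card_ord mulr_natl -sumr_const.
      by apply: ler_sum => i _; exact: cl.
    by move: nP; rewrite /q; lra.
  suff : c - a * mass l setT <= mass l (\bigcap_k ~` Lim k).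
    by rewrite -setC_bigcup lU0; lra.
  apply: mass_bigcap_ge => [n|i j ij|n].
  - exact: measurableC.
  - by apply/subsetPset/subsetC/subsetPset/ndLim.
  - by have := step n; lra.
Qed.

End occupation.

(** A substitute for the ergodic theorem. It converts Lebesgue estimates on the preimages of [E]
    into a lower bound for the invariant measure of [E]. *)
Lemma occupation_bound d (X : measurableType d) (R : realType)
    (l m : {finite_measure set X -> \bar R}) (T : X -> X) (E : set X) (c : R) :
  measurable_fun setT T ->
  (forall A, measurable A -> m (T @^-1` A) = m A) ->
  (forall A, measurable A -> m (A `+` T @^-1` A) = 0%E ->
    m A = 0%E \/ m (~` A) = 0%E) ->
  (forall A, measurable A -> m A = 0%E -> l A = 0%E) ->
  measurable E ->
  (forall n, c <= mass l (iter n T @^-1` E)) ->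
  c * mass m setT <= mass l setT * mass m E.
Proof.
move=> mT inv ergo lm mE cl.
have lE := mass_ge0 l E; have mE0 := mass_ge0 m E.
have lX := mass_ge0 l setT; have mX := mass_ge0 m setT.
rewrite leNgt; apply/negP => lt.
have c_gt0 : 0 < c.
  by rewrite ltNge; apply/negP => c0; move: lt; rewrite ltNge; nra.
have m_gt0 : 0 < mass m setT.
  by rewrite lt_neqAle mX andbT; apply/eqP => e; move: lt; rewrite -e; nra.
have l_gt0 : 0 < mass l setT.
  rewrite lt_neqAle lX andbT; apply/eqP => e.
  have := le_trans (cl 0%N) (le_mass l mE measurableT (@subsetT _ E)).
  by rewrite -e; lra.
(* A rate strictly between the two densities contradicts [occupation_bound_lt]. *)
pose a := (c / mass l setT + mass m E / mass m setT) / 2.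
have ac : mass m E / mass m setT < c / mass l setT.
  by rewrite ltr_pdivrMr// mulrAC ltr_pdivlMr// mulrC.
have a0 : 0 < a.
  have : 0 <= mass m E / mass m setT by rewrite divr_ge0.
  by rewrite /a; lra.
have Ea : mass m E < a * mass m setT by rewrite -ltr_pdivrMr// /a; lra.
have := occupation_bound_lt mT inv mE a0 ergo lm Ea cl.
by rewrite -ler_pdivrMr// /a; lra.
Qed.

(** * Moebius maps on intervals *)

Section mobius_intervals.
Context (R : realType).
Implicit Types (M N : 'M[R]_2) (x y a b : R).
Local Notation lambda := (@lebesgue_measure R).

Definition mx2 (a b c d : R) : 'M[R]_2 :=
  \matrix_(i, j) (if i == 0 then if j == 0 then a else b
                  else if j == 0 then c else d).

Lemma mx2E a b c d : [/\ mx2 a b c d 0 0 = a, mx2 a b c d 0 1 = b,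
  mx2 a b c d 1 0 = c & mx2 a b c d 1 1 = d].
Proof. by split; rewrite mxE. Qed.

(** The adjugate: the inverse up to the sign of the determinant, which the action does not see. *)
Definition mobius_inv M := mx2 (M 1 1) (- M 0 1) (- M 1 0) (M 0 0).

Lemma mobius_inv_det M : det_pm1 M -> det_pm1 (mobius_inv M).
Proof.
rewrite /det_pm1 !det_mx2; have [-> -> -> ->] := mx2E (M 1 1) (- M 0 1) (- M 1 0) (M 0 0).
by rewrite mulrNN [M 1 1 * _]mulrC.
Qed.

Lemma mobius_invK M x : det_pm1 M -> denom M x != 0 ->
  denom (mobius_inv M) (mobius M x) != 0 /\
  mobius (mobius_inv M) (mobius M x) = x.
Proof.
move=> /det_pm1E[_ D0] x0.
have [e1 e2 e3 e4] := mx2E (M 1 1) (- M 0 1) (- M 1 0) (M 0 0).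
have dE : denom (mobius_inv M) (mobius M x) =
    (M 0 0 * M 1 1 - M 0 1 * M 1 0) / denom M x.
  by rewrite /denom e3 e4 /mobius -!/(denom M x); rewrite /denom in x0 *; field.
have d0 : denom (mobius_inv M) (mobius M x) != 0.
  by rewrite dE mulf_neq0// invr_eq0.
split => //; rewrite {1}/mobius -/(denom _ _) dE e1 e2 /mobius -/(denom _ _).
by rewrite /denom in x0 *; field; rewrite x0 D0.
Qed.

Lemma denom_mulmx N M x : denom M x != 0 ->
  denom (N *m M) x = denom N (mobius M x) * denom M x.
Proof.
move=> x0; rewrite /denom !mxE !big_ord_recl !big_ord0 !addr0.
rewrite (_ : lift 0 0 = 1); last exact/val_inj.
by rewrite /mobius; rewrite /denom in x0; field.
Qed.

Lemma mobius_mulmx N M x : denom M x != 0 -> denom N (mobius M x) != 0 ->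
  mobius (N *m M) x = mobius N (mobius M x).
Proof.
move=> x0 Nx0; rewrite [LHS]/mobius -/(denom (N *m M) x) denom_mulmx//.
rewrite !mxE !big_ord_recl !big_ord0 !addr0 (_ : lift 0 0 = 1); last exact/val_inj.
rewrite [RHS]/mobius -/(denom N (mobius M x)); move: Nx0; set D := denom N _ => D0.
by rewrite /mobius; rewrite /denom in x0 *; field; rewrite D0 x0.
Qed.

Lemma det_pm1_mulmx N M : det_pm1 N -> det_pm1 M -> det_pm1 (N *m M).
Proof.
rewrite /det_pm1 det_mulmx => -[->|->] [->|->];
  rewrite ?(mulr1, mul1r, mulrNN); by [left|right].
Qed.

Lemma mobius_inj M x y : det_pm1 M -> denom M x != 0 -> denom M y != 0 ->
  mobius M x = mobius M y -> x = y.
Proof.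
move=> dM x0 y0 e.
by rewrite -(mobius_invK dM x0).2 e (mobius_invK dM y0).2.
Qed.

Definition pole_free M (X : set R) := forall x, X x -> denom M x != 0.

(** An affine function that changes sign has its zero in between, and that zero would be a pole. *)
Lemma denom_same_sign M a b x y : pole_free M `[a, b] -> a <= x <= b -> a <= y <= b ->
  0 < denom M x * denom M y.
Proof.
move=> pf xab yab.
have [fx fy] : denom M x != 0 /\ denom M y != 0 by split; apply: pf; rewrite /= in_itv.
rewrite lt_neqAle eq_sym mulf_neq0//= leNgt; apply/negP => neg.
have c0 : M 1 0 != 0.
  apply/eqP => c0; move: neg; rewrite /denom c0 !mul0r !add0r -expr2 ltNge.
  by rewrite sqr_ge0.
pose p := - M 1 1 / M 1 0.
have pE : denom M p = 0 by rewrite /denom /p; field.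
have dE t : denom M t = M 1 0 * (t - p) by rewrite /denom /p; field.
move: neg; rewrite !dE mulrACA -expr2 pmulr_rlt0; last first.
  by rewrite lt_neqAle sqr_ge0 eq_sym sqrf_eq0 c0.
move=> neg; have : a <= p <= b by move: xab yab neg; nra.
by move=> pab; have := pf p; rewrite pE eqxx /= in_itv/= pab => /(_ isT).
Qed.

(** The difference formula makes the map strictly monotone, in the direction given by the sign of
    the determinant, and the intermediate value theorem fills the image. [Num.min] and [Num.max]
    treat both directions at once. *)
Lemma mobius_itv M a b : det_pm1 M -> a < b -> pole_free M `[a, b] ->
  Num.min (mobius M a) (mobius M b) < Num.max (mobius M a) (mobius M b) /\
  mobius M @` `]a, b[ =
  `]Num.min (mobius M a) (mobius M b), Num.max (mobius M a) (mobius M b)[%classic.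
Proof.
move=> dM ab pf.
have pf' x : a <= x <= b -> denom M x != 0 by move=> xab; apply: pf; rewrite /= in_itv.
have aab : a <= a <= b by rewrite lexx ltW.
have bab : a <= b <= b by rewrite lexx ltW.
have mono x y : a <= x <= b -> a <= y <= b -> x < y ->
    0 < (\det M) * (mobius M y - mobius M x).
  move=> xab yab xy; have := denom_same_sign pf yab xab => dxy.
  rewrite mobius_sub ?pf'// -det_mx2 mulrA mulrA -expr2.
  rewrite (_ : \det M ^+ 2 = 1); last by case: dM => ->; rewrite ?sqrrN expr1n.
  by rewrite mul1r divr_gt0// subr_gt0.
have mM : {within `[a, b], continuous (mobius M)}.
  apply: continuous_in_subspaceT => x; rewrite inE /= in_itv/= => xab.
  apply: (@cvgM _ _ _ _ (fun x => M 0 0 * x + M 0 1) (fun x => (denom M x)^-1)).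
    by apply: cvgD; [apply: cvgM; [exact: cvg_cst|exact: cvg_id]|exact: cvg_cst].
  apply: cvgV; first exact: pf'.
  by apply: cvgD; [apply: cvgM; [exact: cvg_cst|exact: cvg_id]|exact: cvg_cst].
have ne : mobius M a != mobius M b.
  by apply: contraTneq ab => e; rewrite (mobius_inj dM _ _ e) ?ltxx ?pf'.
have lt : Num.min (mobius M a) (mobius M b) < Num.max (mobius M a) (mobius M b).
  by rewrite lt_max !gt_min !ltxx /= orbF; move: ne; case: ltgtP.
split => //; apply/seteqP; split => [_ [x /= + <-]|y /=]; rewrite !in_itv/=.
  move=> /andP[ax xb].
  have xab : a <= x <= b by rewrite !ltW.
  have := mono _ _ aab xab ax; have := mono _ _ xab bab xb.
  rewrite gt_min lt_max; case: dM => ->; rewrite ?mul1r ?mulN1r ?opprB !subr_gt0.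
    by move=> -> ->; rewrite orbT.
  by move=> -> ->; rewrite orbT.
move=> /andP[y1 y2].
have [|x] := @IVT R (mobius M) a b y (ltW ab) mM; first by rewrite !ltW.
rewrite in_itv/= => /andP[ax xb] xy; exists x => //; rewrite in_itv/= !lt_neqAle ax xb !andbT.
move: y1 y2; rewrite -xy lt_max gt_min => y1 y2.
apply/andP; split; apply/eqP => e; move: y1 y2.
  by rewrite e !ltxx /=; case: ltgtP.
by rewrite -e !ltxx /= !orbF; case: ltgtP.
Qed.

(** With a pole at [e], the difference formula and the bound [C] would make [|x - y|] at most a
    multiple of [|x - e|], which is impossible for [x] close to [e] unless [y = e]. *)
Lemma denom_limit M (X : set R) (e C y : R) : det_pm1 M -> pole_free M X ->
  (forall x, X x -> `|mobius M x| <= C) ->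
  (forall t, 0 < t -> exists2 x, X x & `|x - e| < t) -> X y -> denom M e != 0.
Proof.
move=> dM pf XC lim Xy; have [->|ye] := eqVneq e y; first exact: pf.
apply/eqP => e0.
have C0 : 0 <= C by apply: le_trans (XC _ Xy).
(* Chosen so that the bounds below add up to [|e - y| <= k * |x - e|], against the choice of [x]
   with [|x - e| < |e - y| / (2 * k)]. *)
pose k := 2 * C * `|M 1 0| * `|denom M y| + 1.
have k0 : 0 < k by rewrite /k ltr_pwDr// !mulr_ge0.
have [|x Xx xe] := lim (`|e - y| / (2 * k)).
  by rewrite divr_gt0 ?normr_gt0 ?subr_eq0// mulr_gt0.
have : `|x - y| <= 2 * C * (`|M 1 0| * `|x - e|) * `|denom M y|.
  have xE : denom M x = M 1 0 * (x - e) by rewrite -[RHS]addr0 -e0 /denom; ring.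
  rewrite -normrM -xE.
  have E : `|mobius M x - mobius M y| = `|x - y| / (`|denom M x| * `|denom M y|).
    by rewrite mobius_sub ?pf// !normrM (det_pm1E dM).1 mul1r normfV normrM.
  have := ler_normB (mobius M x) (mobius M y); rewrite E.
  rewrite ler_pdivrMr ?mulr_gt0 ?normr_gt0 ?pf// => /le_trans; apply.
  rewrite -mulrA ler_wpM2r ?mulr_ge0//; have := XC _ Xx; have := XC _ Xy; lra.
have : `|e - y| <= `|x - y| + `|x - e|.
  rewrite -[e - y](_ : (x - y) - (x - e) = _); last by ring.
  exact: ler_normB.
move: xe; rewrite ltr_pdivlMr ?mulr_gt0// => xe tr dist.
have : k * `|x - e| = 2 * C * (`|M 1 0| * `|x - e|) * `|denom M y| + `|x - e|.
  by rewrite /k; ring.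
have : 0 < `|e - y| by rewrite normr_gt0 subr_eq0.
lra.
Qed.

(** Cylinders are mapped into a bounded interval, so this gives control up to their ends, where [T]
    need not follow the matrix. *)
Lemma pole_free_closed_itv M a b C : det_pm1 M -> a < b -> pole_free M `]a, b[ ->
  (forall x, a < x < b -> `|mobius M x| <= C) -> pole_free M `[a, b].
Proof.
move=> dM ab pf bd x; rewrite /= in_itv/= => xab.
have [y /andP[ay yb]] : exists y, a < y < b by exists ((a + b) / 2); rewrite !midf_lt.
apply: (@denom_limit M `]a, b[%classic x C y) => //.
- move=> t t0; pose s := Num.min (t / 2) ((b - a) / 4).
  have [st sab] : s <= t / 2 /\ s <= (b - a) / 4 by rewrite /s !ge_min !lexx orbT.
  have s0 : 0 < s by rewrite /s lt_min; apply/andP; split; lra.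
  have [xm|xm] := leP x ((a + b) / 2).
    exists (x + s); first by rewrite /= in_itv/=; apply/andP; split; lra.
    by rewrite addrAC subrr add0r gtr0_norm//; lra.
  exists (x - s); first by rewrite /= in_itv/=; apply/andP; split; lra.
  by rewrite addrAC subrr add0r normrN gtr0_norm//; lra.
- by rewrite /= in_itv/= ay.
Qed.

(** The pole lies outside []u, v[], so [|denom M|] is proportional to the distance to a point beyond
    one of the ends. The ratio of two such distances is worst when that point is the end itself,
    from which [y] keeps distance at least [u' - u] or [v - v']. *)
Lemma denom_distortion M u u' v' v x y : u < u' -> v' < v -> pole_free M `]u, v[ ->
  u < x < v -> u' <= y <= v' ->
  `|denom M x| <= (v - u) / Num.min (u' - u) (v - v') * `|denom M y|.
Proof.
move=> uu' vv' pf /andP[ux xv] /andP[uy yv].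
set e := Num.min _ _.
have e0 : 0 < e by rewrite lt_min !subr_gt0 uu'.
have [eu ev] : e <= u' - u /\ e <= v - v' by rewrite /e !ge_min !lexx orbT.
have K1 : 1 <= (v - u) / e by rewrite ler_pdivlMr// mul1r; lra.
have [c0|c0] := eqVneq (M 1 0) 0.
  by rewrite /denom c0 !mul0r add0r ler_peMl.
pose p := - M 1 1 / M 1 0.
have dE t : denom M t = M 1 0 * (t - p) by rewrite /denom /p; field.
have pn : ~ (u < p < v).
  by move=> puv; have := pf p; rewrite dE subrr mulr0 eqxx /= in_itv/= puv => /(_ isT).
rewrite !dE !normrM mulrCA ler_wpM2l//.
have [pu|pu] := leP p u.
  rewrite !gtr0_norm; try lra.
  have -> : x - p = (x - u) + (u - p) by ring.
  have -> : y - p = (y - u) + (u - p) by ring.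
  rewrite mulrDr lerD//; last by rewrite ler_peMl//; lra.
  rewrite mulrAC ler_pdivlMr//; nra.
have [pv|pv] := leP v p; last by case: pn; rewrite pu.
rewrite !ltr0_norm; try lra.
have -> : - (x - p) = (v - x) + (p - v) by ring.
have -> : - (y - p) = (v - y) + (p - v) by ring.
rewrite mulrDr lerD//; last by rewrite ler_peMl//; lra.
rewrite mulrAC ler_pdivlMr//; nra.
Qed.

Lemma measurable_mobius_preimage M (E : set R) : measurable E ->
  measurable (mobius M @^-1` E).
Proof.
by move=> mE; rewrite -[X in measurable X]setTI; exact: measurable_mobius.
Qed.

Lemma lebesgue_mobius_image M (X F : set R) : det_pm1 M -> measurable X ->
  measurable F -> pole_free M X -> F `<=` mobius M @` X ->
  lambda F = (\int[lambda]_(x in X `&` mobius M @^-1` F) (mobius_jac M x)%:E)%E.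
Proof.
move=> dM mX mF pf FX.
have mP := measurable_mobius_preimage M mF.
have := substitution_mobius dM (f := fun x => (\1_F x)%:E).
rewrite integral_indic// setIT => <-//; last first.
  exact/measurable_EFinP/measurable_indic.
rewrite [RHS]integral_mkcond; apply: eq_integral => x _.
rewrite patchE indicE in_setI.
have [Fx|Fx] := boolP (x \in mobius M @^-1` F); last first.
  have -> : (mobius M x \in F) = false by apply/negbTE; apply: contra Fx; rewrite !inE.
  by rewrite andbF mul0e.
have -> : (mobius M x \in F) by move: Fx; rewrite !inE.
rewrite andbT mul1e; case: ifPn => // nX.
(* At a pole the default inverse makes the Jacobian 0, so the pole contributes nothing even if its
   default value lies in [F]. *)
have [dx|dx] := eqVneq (denom M x) 0.
  by rewrite /mobius_jac dx expr0n invr0.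
move: Fx; rewrite inE /= => /FX[x' Xx' e].
by move: nX; rewrite -(mobius_inj dM (pf _ Xx') dx e) mem_set.
Qed.

(** The Jacobian integrates over the preimage to the measure of [E], and it is positive except at
    the pole. *)
Lemma lebesgue_mobius_preimage0 M (E : set R) : det_pm1 M -> measurable E ->
  lambda E = 0%E -> lambda (mobius M @^-1` E) = 0%E.
Proof.
move=> dM mE E0; have mP := measurable_mobius_preimage M mE.
have := substitution_mobius dM (f := fun x => (\1_E x)%:E).
rewrite integral_indic// setIT => I0.
have {}I0 : (\int[lambda]_(x in mobius M @^-1` E) `|(mobius_jac M x)%:E| = 0)%E.
  rewrite -[RHS]E0 -[RHS]I0//; last exact/measurable_EFinP/measurable_indic.
  rewrite [LHS]integral_mkcond; apply: eq_integral => x _.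
  rewrite patchE indicE.
  have -> : (x \in mobius M @^-1` E) = (mobius M x \in E) by apply/idP/idP; rewrite !inE.
  by case: ifPn => _; rewrite ?mul1e ?mul0e// gee0_abs// lee_fin mobius_jac_ge0.
have mJ : measurable_fun (mobius M @^-1` E) (fun x => (mobius_jac M x)%:E).
  by apply/measurable_EFinP/measurable_funTS; exact: measurable_mobius_jac.
have [N [mN N0 sN]] := (ae_eq_integral_abs lambda mP mJ).1 I0.
have [p pP] : exists p, forall x, denom M x = 0 -> x = p.
  have [c0|c0] := eqVneq (M 1 0) 0.
    exists 0 => x; rewrite /denom c0 mul0r add0r => d0.
    by have [_] := det_pm1E dM; rewrite c0 d0 !mulr0 subr0 eqxx.
  exists (- M 1 1 / M 1 0) => x; rewrite /denom => d0.
  by apply: (mulfI c0); rewrite mulrCA divff// mulr1; lra.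
apply: (negligibleP lambda mP).1.
apply: (@negligibleS _ _ _ _ (N `|` [set p])).
  move=> x Ex; have [dx|dx] := eqVneq (denom M x) 0; first by right; exact: pP.
  left; apply: sN => /= /(_ Ex) [] /eqP.
  by rewrite /mobius_jac invr_eq0 sqrf_eq0 (negbTE dx).
apply: negligibleU; first by exists N; split.
by exists [set p]; split => //; exact: lebesgue_measure_set1.
Qed.

End mobius_intervals.

Section mobius_pull_interval.
Context (R : realType).
Implicit Types (H : 'M[R]_2) (a b : R).

Lemma mobius_closed_itv H a b y : det_pm1 H -> a < b -> pole_free H `[a, b] ->
  Num.min (mobius H a) (mobius H b) <= y <= Num.max (mobius H a) (mobius H b) ->
  exists2 z, a <= z <= b & mobius H z = y.
Proof.
move=> dH ab pf yab; have [_ im] := mobius_itv dH ab pf.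
move: yab; rewrite le_eqVlt => /andP[/orP[/eqP <- _|y1]].
  by case: (leP (mobius H a) (mobius H b)) => _; [exists a|exists b]; rewrite ?lexx ?ltW.
rewrite le_eqVlt => /orP[/eqP ->|y2].
  by case: (leP (mobius H a) (mobius H b)) => _; [exists b|exists a]; rewrite ?lexx ?ltW.
have : (mobius H @` `]a, b[%classic) y by rewrite im /= in_itv/= y1.
by move=> [z + <-]; rewrite /= in_itv/= => /andP[az zb]; exists z; rewrite // !ltW.
Qed.

(** The interval lemma applied to the inverse map. That the new ends are sent exactly to [p] and [q]
    is what allows the ends of cylinders to be traced from rank to rank. *)
Lemma mobius_preimage_itv H a b p q : det_pm1 H -> a < b -> pole_free H `[a, b] ->
  Num.min (mobius H a) (mobius H b) <= p -> p < q ->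
  q <= Num.max (mobius H a) (mobius H b) ->
  exists a' b', [/\ a' < b', a <= a', b' <= b,
    [set z | a < z < b /\ p < mobius H z < q] = `]a', b'[%classic &
    (mobius H a' = p /\ mobius H b' = q) \/ (mobius H a' = q /\ mobius H b' = p)].
Proof.
move=> dH ab pf ap pq qb; have [lt im] := mobius_itv dH ab pf.
pose N := mobius_inv H; have dN : det_pm1 N by exact: mobius_inv_det.
have lift y : p <= y <= q -> exists2 z, a <= z <= b & mobius H z = y.
  move=> /andP[py yq]; apply: mobius_closed_itv => //.
  by rewrite (le_trans ap py) (le_trans yq qb).
have pf' z : a <= z <= b -> denom H z != 0 by move=> h; apply: pf; rewrite /= in_itv.
have NP y : p <= y <= q -> [/\ denom N y != 0, a <= mobius N y <= b & mobius H (mobius N y) = y].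
  move=> /lift[z zab <-]; have [d0 e] := mobius_invK dH (pf' _ zab).
  by split; rewrite /N ?e.
have pfN : pole_free N `[p, q] by move=> y; rewrite /= in_itv/= => /NP[].
have [ltN imN] := mobius_itv dN pq pfN.
have [_ /andP[Np1 Np2] Np] := NP p (introT andP (conj (lexx _) (ltW pq))).
have [_ /andP[Nq1 Nq2] Nq] := NP q (introT andP (conj (ltW pq) (lexx _))).
exists (Num.min (mobius N p) (mobius N q)), (Num.max (mobius N p) (mobius N q)).
split => //.
- by rewrite le_min Np1.
- by rewrite ge_max Np2.
- rewrite -imN; apply/seteqP; split => [z [/andP[az zb] Hz]|_ [y + <-]].
    exists (mobius H z); first by rewrite /= in_itv.
    by apply: (mobius_invK dH _).2; apply: pf'; rewrite !ltW.
  rewrite /= in_itv/= => /andP[py yq].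
  have [_ _ e] := NP y (introT andP (conj (ltW py) (ltW yq))).
  have : (mobius H @` `]a, b[%classic) y.
    by rewrite im /= in_itv/= (le_lt_trans ap py) (lt_le_trans yq qb).
  move=> [z + zy]; rewrite /= in_itv/= => zab; rewrite e py yq; split => //.
  rewrite -zy (mobius_invK dH _).2//; apply: pf'.
  by move: zab => /andP[? ?]; rewrite !ltW.
- by case: (leP (mobius N p) (mobius N q)) => _; [left|right].
Qed.

End mobius_pull_interval.

(* [Q] contains the endpoints of the images of the cylinders [`]u n, v n[] and is
   forward invariant, hence contains the endpoints of the images of all higher
   rank cylinders. *)
Record mobius_system (R : realType) (i0 i1 : R) (T : R -> R) (u v : nat -> R)
    (G : nat -> 'M[R]_2) (Q : set R) : Prop := MobiusSystem {
  ms_lt : i0 < i1 ;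
  ms_sub : forall n, `]u n, v n[ `<=` `]i0, i1[ ;
  ms_disjoint : forall i j x, `]u i, v i[%classic x -> `]u j, v j[%classic x -> i = j ;
  ms_det : forall n, det_pm1 (G n) ;
  ms_mobius : forall n x, `]u n, v n[%classic x ->
    denom (G n) x != 0 /\ T x = mobius (G n) x ;
  ms_image : forall n x, `]u n, v n[%classic x -> i0 <= T x <= i1 ;
  ms_ends : Q i0 /\ Q i1 ;
  ms_image_ends : forall n, u n < v n ->
    Q (mobius (G n) (u n)) /\ Q (mobius (G n) (v n)) ;
  ms_forward : forall n e, Q e -> `]u n, v n[%classic e -> Q (mobius (G n) e) }.

(** * Cylinders of higher rank and their branches *)

Section cylinders.
Context (R : realType).
Variables (i0 i1 : R) (T : R -> R) (u v : nat -> R) (G : nat -> 'M[R]_2).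
Variable Q : set R.
Hypothesis sys : mobius_system i0 i1 T u v G Q.
Local Notation U n := (`]u n, v n[%classic).
Local Notation J := (`]i0, i1[%classic).
Let i01 := ms_lt sys.
Let UJ := ms_sub sys.
Let tU := ms_disjoint sys.
Let detG := ms_det sys.
Let actG := ms_mobius sys.
Let TJ := ms_image sys.
Let Qi := ms_ends sys.
Let QU := ms_image_ends sys.
Let QT := ms_forward sys.

(** Absence of poles is required on the closed interval, so that its ends have images; these must
    lie in [Q], which is the form in which bounded non-full range reaches the iterates. *)
Definition branch n (C : set R) (H : 'M[R]_2) := exists a b,
  [/\ a < b, C = `]a, b[%classic /\ C `<=` J,
    [/\ det_pm1 H, pole_free H `[a, b] & forall z, C z -> iter n T z = mobius H z],
    Q (mobius H a) /\ Q (mobius H b) & mobius H @` C `<=` J].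

Definition defined n := [set x | J x /\ forall k, (k < n)%N -> exists j, U j (iter k T x)].

(** The rank [n] cylinder around [x], described by itineraries so that nesting is immediate;
    [cyl_branch] shows that it is an interval when [x] is [defined]. *)
Definition cyl n x := [set z | J z /\
  forall k, (k < n)%N -> exists j, U j (iter k T x) /\ U j (iter k T z)].

Lemma cyl_refl n x : defined n x -> cyl n x x.
Proof. by move=> [Jx h]; split => // k /h[j]; exists j. Qed.

Lemma pole_free_cylinder n : u n < v n -> pole_free (G n) `[u n, v n].
Proof.
move=> uv; apply: (@pole_free_closed_itv _ _ _ _ (Num.max `|i0| `|i1|)) => //.
- by move=> x Ux; have [] := actG Ux.
- move=> x xuv; have Ux : U n x by rewrite /= in_itv.
  rewrite -(actG Ux).2; have /andP[t1 t2] := TJ Ux.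
  rewrite ler_norml le_max; have := ler_norm (- i0); have := ler_norm i1; rewrite normrN.
  move=> n1 n0; apply/andP; split; last by rewrite (le_trans t2 n1) orbT.
  by rewrite lerNl le_max; apply/orP; left; apply: le_trans n0; rewrite lerN2.
Qed.

Lemma image_cylinder n : mobius (G n) @` U n `<=` J.
Proof.
have [uv|vu] := ltP (u n) (v n); last first.
  move=> y [x Ux _]; move: Ux; rewrite /= in_itv/= => /andP[ux xv].
  by have := lt_le_trans (lt_trans ux xv) vu; rewrite ltxx.
have [_ im] := mobius_itv (detG n) uv (pole_free_cylinder uv).
set p := Num.min _ _ in im; set q := Num.max _ _ in im.
have bd y : p < y < q -> i0 <= y <= i1.
  move=> pyq; have : (mobius (G n) @` U n) y by rewrite im /= in_itv.
  by move=> [x Ux <-]; rewrite -(actG Ux).2; exact: TJ Ux.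
rewrite im => y; rewrite /= !in_itv/= => /andP[py yq].
(* The image is open: [y] lies strictly between two other image points, hence strictly between [i0]
   and [i1]. *)
have h1 : p < (p + y) / 2 < q by apply/andP; split; lra.
have h2 : p < (y + q) / 2 < q by apply/andP; split; lra.
have /andP[? ?] := bd _ h1; have /andP[? ?] := bd _ h2.
by apply/andP; split; lra.
Qed.

Lemma branch0 x : branch 0 (cyl 0 x) 1%:M.
Proof.
have E y : mobius 1%:M y = y :> R.
  by rewrite /mobius !mxE /= mul1r addr0 mul0r add0r divr1.
have -> : cyl 0 x = J by apply/seteqP; split => [z []//|z Jz]; split.
exists i0, i1; split => //; rewrite ?E//.
- by split.
- split; [by rewrite /det_pm1 det1; left| |by move=> z _; rewrite E].
  by move=> z _; rewrite /denom !mxE /= mul0r add0r oner_eq0.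
- by move=> _ [z Jz <-]; rewrite E.
Qed.

Lemma cylS n x j : U j (iter n T x) ->
  cyl n.+1 x = [set z | cyl n x z /\ U j (iter n T z)].
Proof.
move=> Uj; apply/seteqP; split => z /= [].
  move=> Jz h; split; last by have [i [/tU /(_ Uj) <-]] := h n (leqnn _).
  by split => // k kn; apply: h; rewrite ltnS ltnW.
move=> [Jz h] Ujz; split => // k; rewrite ltnS leq_eqVlt => /predU1P[->|/h//].
by exists j.
Qed.

(** The new cylinder is the part of the old one landing in [U j]. Its ends are sent to [p] and [q],
    each an end of [U j] or an end of the old image inside [U j]; the first kind goes into [Q] by
    [ms_image_ends], the second by [ms_forward]. *)
Lemma branchS n x H j : defined n x -> U j (iter n T x) -> branch n (cyl n x) H ->
  branch n.+1 (cyl n.+1 x) (G j *m H).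
Proof.
move=> xdef Ujx [a [b [ab [CE CJ] [dH pfH TH] [Qa Qb] HJ]]].
have uv : u j < v j by move: Ujx; rewrite /= in_itv/= => /andP[]; exact: lt_trans.
have pfG := pole_free_cylinder uv.
have [lt im] := mobius_itv dH ab pfH.
set al := Num.min _ _ in lt im; set be := Num.max _ _ in lt im.
have [Qal Qbe] : Q al /\ Q be by rewrite /al /be; case: (leP (mobius H a)).
pose p := Num.max al (u j); pose q := Num.min be (v j).
have xab : a < x < b by have := cyl_refl xdef; rewrite CE /= in_itv.
have imC z : a < z < b -> al < mobius H z < be.
  move=> zab; have : (mobius H @` `]a, b[%classic) (mobius H z) by exists z; rewrite //= in_itv.
  by rewrite im /= in_itv.
have Tx : iter n T x = mobius H x by apply: TH; exact: cyl_refl.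
have pq : p < q.
  apply: (@lt_trans _ _ (mobius H x)).
    rewrite /p gt_max; have /andP[-> _] := imC _ xab.
    by move: Ujx; rewrite Tx /= in_itv/= => /andP[].
  rewrite /q lt_min; have /andP[_ ->] := imC _ xab.
  by move: Ujx; rewrite Tx /= in_itv/= => /andP[].
have alp : al <= p by rewrite /p le_max lexx.
have qbe : q <= be by rewrite /q ge_min lexx.
have [a' [b' [ab' aa' bb' E ends]]] := mobius_preimage_itv dH ab pfH alp pq qbe.
have C'E : cyl n.+1 x = `]a', b'[%classic.
  rewrite (cylS Ujx) -E; apply/seteqP; split => z /=.
    move=> [Cz]; have zab : a < z < b by move: Cz; rewrite CE /= in_itv.
    rewrite (TH _ Cz) in_itv/= => /andP[uz zv]; split => //.
    by have /andP[? ?] := imC _ zab; rewrite /p /q gt_max lt_min; apply/andP; split; apply/andP.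
  move=> [zab /andP[pz zq]]; have Cz : cyl n x z by rewrite CE /= in_itv.
  split => //; rewrite (TH _ Cz) /= in_itv/=.
  by move: pz zq; rewrite /p /q gt_max lt_min => /andP[_ ->] /andP[_ ->].
have C'C z : cyl n.+1 x z -> cyl n x z by rewrite (cylS Ujx) => -[].
have HP z : a' <= z <= b' -> u j <= mobius H z <= v j.
  have pqu : u j <= p by rewrite /p le_max lexx orbT.
  have qv : q <= v j by rewrite /q ge_min lexx orbT.
  have pquv y : p <= y <= q -> u j <= y <= v j.
    by move=> /andP[py yq]; rewrite (le_trans pqu py) (le_trans yq qv).
  rewrite le_eqVlt => /andP[/predU1P[<- _|az]].
    by apply: pquv; case: ends => -[-> _]; rewrite ?lexx ?(ltW pq).
  rewrite le_eqVlt => /predU1P[->|zb].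
    by apply: pquv; case: ends => -[_ ->]; rewrite ?lexx ?(ltW pq).
  have : `]a', b'[%classic z by rewrite /= in_itv/= az.
  by rewrite -E => -[_ /andP[pz zq]]; apply: pquv; rewrite !ltW.
have pfH' z : a' <= z <= b' -> denom H z != 0.
  by move=> /andP[az zb]; apply: pfH; rewrite /= in_itv/= (le_trans aa' az) (le_trans zb bb').
have pfG' z : a' <= z <= b' -> denom (G j) (mobius H z) != 0.
  by move=> /HP h; apply: pfG; rewrite /= in_itv.
have GHE z : a' <= z <= b' -> mobius (G j *m H) z = mobius (G j) (mobius H z).
  by move=> h; rewrite mobius_mulmx ?pfH' ?pfG'.
have aa : a' <= a' <= b' by rewrite lexx ltW.
have bb : a' <= b' <= b' by rewrite lexx ltW.
have Qp : Q (mobius (G j) p).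
  rewrite /p; have [_|ua] := leP al (u j); first by have [] := QU uv.
  apply: QT => //; rewrite /= in_itv/= ua/=.
  by apply: (le_lt_trans alp); apply: (lt_le_trans pq); rewrite /q ge_min lexx orbT.
have Qq : Q (mobius (G j) q).
  rewrite /q; have [bv|_] := ltP be (v j); last by have [] := QU uv.
  apply: QT => //; rewrite /= in_itv/= bv andbT.
  by apply: (lt_le_trans _ qbe); apply: (le_lt_trans _ pq); rewrite /p le_max lexx orbT.
exists a', b'; split => //.
- by split => // z /C'C /CJ.
- split; first exact: det_pm1_mulmx.
    move=> z; rewrite /= in_itv/= => zab.
    by rewrite denom_mulmx ?pfH'// mulf_neq0 ?pfH' ?pfG'.
  move=> z Cz; have zab : a' <= z <= b'.
    by move: Cz; rewrite C'E /= in_itv/= => /andP[? ?]; rewrite !ltW.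
  move: (Cz); rewrite (cylS Ujx) iterS => -[Cz' Ujz].
  by rewrite (actG Ujz).2 GHE// (TH _ Cz').
- rewrite !GHE//.
  by case: ends => -[-> ->].
- move=> _ [z Cz <-]; have zab : a' <= z <= b'.
    by move: Cz; rewrite C'E /= in_itv/= => /andP[? ?]; rewrite !ltW.
  move: (Cz); rewrite (cylS Ujx) => -[Cz' Ujz].
  rewrite GHE//; apply: (@image_cylinder j); exists (mobius H z) => //.
  by rewrite -(TH _ Cz').
Qed.

Lemma cyl_branch n x : defined n x -> exists H, branch n (cyl n x) H.
Proof.
elim: n => [|n IH] xdef; first by exists 1%:M; exact: branch0.
have xdef' : defined n x.
  by case: xdef => Jx h; split => // k kn; apply: h; rewrite ltnS ltnW.
have [H hH] := IH xdef'; have [j Uj] := xdef.2 n (leqnn _).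
by exists (G j *m H); exact: branchS.
Qed.

End cylinders.

(** * Dynamics of interval systems *)

Section dynamics.
Context (R : realType).
Variables (i0 i1 : R) (T : R -> R) (u v : nat -> R) (G : nat -> 'M[R]_2).
Variable Q : set R.
Hypothesis sys : mobius_system i0 i1 T u v G Q.
Local Notation U n := (`]u n, v n[%classic).
Local Notation J := (`]i0, i1[%classic).
Local Notation lambda := (@lebesgue_measure R).
Local Notation cyl := (cyl i0 i1 T u v).
Local Notation branch := (branch i0 i1 T Q).
Local Notation defined := (defined i0 i1 T u v).
Let UJ := ms_sub sys.
Let tU := ms_disjoint sys.
Let detG := ms_det sys.
Let actG := ms_mobius sys.

(** In the application [l] is Lebesgue measure on [J], [m] the marginal before normalization, [k0]
    the full cylinder of condition (d), and [j1] a second branch over it. *)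
Variables l m : {finite_measure set (measurableTypeR R) -> \bar R}.
Hypothesis mT : measurable_fun setT (T : measurableTypeR R -> measurableTypeR R).
Hypothesis lE : forall A : set R, measurable A -> l A = lambda (A `&` J).
Hypothesis cover : l (~` \bigcup_n U n) = 0%E.
Hypothesis inv : forall A : set R, measurable A -> m (T @^-1` A) = m A.
Variable S : R.
Hypothesis S0 : 0 < S.
Hypothesis mlS : forall A : set R, measurable A -> mass m A <= S * mass l A.
Hypothesis lm0 : forall A : set R, measurable A -> m A = 0%E -> l A = 0%E.
Variables k0 j1 : nat.
Hypothesis uv0 : u k0 < v k0.
Hypothesis QK : forall e, Q e -> ~ U k0 e.
Hypothesis full : J `<=` mobius (G k0) @` U k0.
Hypothesis j1k0 : j1 <> k0.
Hypothesis second : U k0 `<=` mobius (G j1) @` U j1.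

Let mTpre (A : set R) : measurable A -> measurable (T @^-1` A).
Proof. by move=> mA; rewrite -[X in measurable X]setTI; exact: mT. Qed.

Let mTn n (A : set R) : measurable A -> measurable (iter n T @^-1` A).
Proof. by move=> mA; exact: (measurable_preimage_iter mT). Qed.

Lemma inv_iter n (A : set R) : measurable A -> m (iter n T @^-1` A) = m A.
Proof.
move=> mA; elim: n => [//|n IH]; rewrite -IH -(inv (mTn n mA)).
by congr (m _); apply/seteqP; split => x /=; rewrite -iterS iterSr.
Qed.

(** The image is an interval whose ends lie in [Q], hence outside [U k0]; once it meets [U k0], its
    ends are on either side of [U k0]. *)
Lemma branch_cover n C H x : branch n C H -> C x -> U k0 (iter n T x) ->
  U k0 `<=` mobius H @` C.
Proof.
move=> [a [b [ab [CE CJ] [dH pf TH] [Qa Qb] HJ]]] Cx.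
have [_ im] := mobius_itv dH ab pf; rewrite (TH _ Cx) CE im.
have : (mobius H @` C) (mobius H x) by exists x.
rewrite CE im; set p := Num.min _ _; set q := Num.max _ _.
have [Qp Qq] : Q p /\ Q q by rewrite /p /q; case: (leP (mobius H a)).
move=> Hx; rewrite /= !in_itv/= in Hx * => /andP[ux xv].
have pu : p <= u k0.
  by rewrite leNgt; apply/negP => up; apply: (QK Qp); rewrite /= in_itv/= up; lra.
have vq : v k0 <= q.
  by rewrite leNgt; apply/negP => up; apply: (QK Qq); rewrite /= in_itv/= up andbT; lra.
by move=> y; rewrite /= !in_itv/= => /andP[? ?]; apply/andP; split; lra.
Qed.

Lemma mass_lE (A : set R) : measurable A -> A `<=` J -> (mass l A)%:E = lambda A.
Proof. by move=> mA AJ; rewrite massE// lE//; congr (lambda _); exact/setIidPl. Qed.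

(** On the closed cylinder the denominator is affine of constant sign, so its absolute value is at
    least the smaller end value [e]. The Jacobian is then at most the inverse of [e ^+ 2], and the
    constant is [e ^+ 2]. *)
Lemma cylinder_preimage_mass j : u j < v j -> exists2 c : R, 0 < c &
  forall V : set R, measurable V -> V `<=` mobius (G j) @` U j ->
    c * mass l V <= mass l (U j `&` T @^-1` V).
Proof.
move=> uv; have pf := pole_free_cylinder sys uv.
pose e := Num.min `|denom (G j) (u j)| `|denom (G j) (v j)|.
have eu : 0 < `|denom (G j) (u j)|.
  by rewrite normr_gt0; apply: pf; rewrite /= in_itv/= lexx ltW.
have ev : 0 < `|denom (G j) (v j)|.
  by rewrite normr_gt0; apply: pf; rewrite /= in_itv/= lexx ltW.
have e0 : 0 < e by rewrite lt_min eu.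
have eP x : U j x -> e <= `|denom (G j) x|.
  rewrite /= in_itv/= => /andP[ux xv].
  have ss := denom_same_sign pf (introT andP (conj (lexx _) (ltW uv))) (introT andP (conj (ltW uv) (lexx _))).
  have E : (v j - u j) * denom (G j) x =
      (v j - x) * denom (G j) (u j) + (x - u j) * denom (G j) (v j).
    by rewrite /denom; ring.
  have [e1 e2] : e <= `|denom (G j) (u j)| /\ e <= `|denom (G j) (v j)|.
    by rewrite /e !ge_min !lexx orbT.
  rewrite -(@ler_pM2l _ (v j - u j)) ?subr_gt0//.
  rewrite -[X in _ <= X * _](@gtr0_norm _ (v j - u j)) ?subr_gt0// -normrM E.
  have [du|du] := leP 0 (denom (G j) (u j)).
    have dv : 0 <= denom (G j) (v j) by move: ss; nra.
    rewrite !ger0_norm// in e1 e2 *; first nra.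
    by rewrite addr_ge0// mulr_ge0//; lra.
  have dv : denom (G j) (v j) <= 0 by move: ss; nra.
  rewrite !ler0_norm//; try exact: ltW.
    rewrite !ler0_norm// in e1 e2; last exact: ltW.
    nra.
  by rewrite -oppr_ge0 opprD -!mulrN addr_ge0// mulr_ge0//; lra.
exists (e ^+ 2); first by rewrite exprn_gt0.
move=> V mV VG.
have mP : measurable (U j `&` T @^-1` V) by apply: measurableI => //; exact: mTpre.
have PE : U j `&` T @^-1` V = U j `&` mobius (G j) @^-1` V.
  by apply/seteqP; split => x /= [Ux]; have [_ ->] := actG Ux.
have pfo : pole_free (G j) (U j) by move=> x Ux; have [] := actG Ux.
rewrite -lee_fin EFinM mass_lE//; last by apply: (subset_trans VG); exact: (image_cylinder sys).
rewrite mass_lE//; last by move=> x [/UJ].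
rewrite (lebesgue_mobius_image (detG j) _ mV pfo VG)// -PE.
rewrite muleC -lee_pdivlMr ?exprn_gt0// muleC.
apply: (@le_trans _ _ (\int[lambda]_(x in U j `&` T @^-1` V) (cst (e ^+ 2)^-1%:E) x)%E).
  apply: ge0_le_integral => //.
  - by move=> x _; rewrite lee_fin mobius_jac_ge0.
  - by apply/measurable_EFinP/measurable_funTS; exact: measurable_mobius_jac.
  - move=> x [Ux _]; have [d0 _] := actG Ux.
    have e2 : 0 < e ^+ 2 by rewrite exprn_gt0.
    have d2 : 0 < denom (G j) x ^+ 2 by rewrite exprn_even_gt0.
    rewrite lee_fin lef_pV2 ?posrE// -[leRHS]real_normK ?num_real//.
    by rewrite ler_sqr ?nnegrE ?(ltW e0) ?eP.
by rewrite integral_cst.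
Qed.

(** * Growth of the invariant measure along the images of an interval *)

Section gain.
Variables (n : nat) (x a b : R).
Hypothesis xdef : defined n x.
Hypothesis ab : a < b.
Hypothesis Wcyl : `]a, b[ `<=` cyl n x.

Let V k : set R := iter k T @` `]a, b[.

Let cylW k z : (k <= n)%N -> cyl n x z -> cyl k x z.
Proof.
by move=> kn [Jz h]; split => // j jk; apply: h; exact: leq_trans jk kn.
Qed.

Let defW k : (k <= n)%N -> defined k x.
Proof.
by move=> kn; case: xdef => Jx h; split => // j jk; apply: h; exact: leq_trans jk kn.
Qed.

Lemma iterate_itv k : (k <= n)%N -> (exists p q, p < q /\ V k = `]p, q[%classic) /\ V k `<=` J.
Proof.
have ab' := ab; move=> kn; have [H [a0 [b0 [ab0 [CE CJ] [dH pf TH] _ HJ]]]] := cyl_branch sys (defW kn).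
have WC z : a < z < b -> cyl k x z.
  by move=> h; apply: (cylW kn); apply: Wcyl; rewrite /= in_itv.
have WC0 z : a < z < b -> a0 < z < b0 by move=> /WC; rewrite CE /= in_itv.
have VE : V k = mobius H @` `]a, b[.
  apply/seteqP; split => y /= [z]; rewrite ?in_itv/= => zab <-; exists z; rewrite ?in_itv//.
    by rewrite -TH//; exact: WC.
  by rewrite TH//; exact: WC.
have [a0a bb0] : a0 <= a /\ b <= b0.
  split; rewrite leNgt; apply/negP => h.
    (* If [a < a0], this point of []a, b[] would lie to the left of [a0]. *)
    have /WC0 : a < Num.min ((a + b) / 2) ((a + a0) / 2) < b by rewrite lt_min gt_min; apply/andP; split; [apply/andP; split|apply/orP; left]; lra.
    by rewrite lt_min => /andP[/andP[_]]; lra.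
  have /WC0 : a < Num.max ((a + b) / 2) ((b + b0) / 2) < b by rewrite lt_max gt_max; apply/andP; split; [apply/orP; left|apply/andP; split]; lra.
  by rewrite gt_max => /andP[_ /andP[_]]; lra.
have pf' : pole_free H `[a, b].
  by move=> z; rewrite /= in_itv/= => /andP[? ?]; apply: pf; rewrite /= in_itv/=; lra.
have [lt im] := mobius_itv dH ab pf'.
split; last by rewrite VE => y [z zab <-]; apply: HJ; exists z => //; apply: WC; move: zab; rewrite /= in_itv.
by rewrite VE im; eexists; eexists; split; [exact: lt|].
Qed.

Let mV k : (k <= n)%N -> measurable (V k).
Proof. by move=> /iterate_itv[[p [q [_ ->]]] _]. Qed.

Let TV k : V k.+1 = T @` V k.
Proof.
apply/seteqP; split => y /=.
  by move=> [z zab <-]; exists (iter k T z) => //; exists z.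
by move=> [_ [z zab <-] <-]; exists z.
Qed.

Let VU k j : (k < n)%N -> U j (iter k T x) -> V k `<=` U j.
Proof.
move=> kn Uj _ [z /Wcyl [_ /(_ k kn) [i [Ui Uz]]] <-].
by rewrite (tU Uj Ui).
Qed.

Let mass_le k : (k < n)%N -> mass m (V k) <= mass m (V k.+1).
Proof.
move=> kn; rewrite /mass -(inv (mV kn)) -!/(mass _ _); apply: le_mass.
- by apply: mV; exact: ltnW.
- by apply: mTpre; exact: mV.
- by move=> y Vy; rewrite /= TV; exists y.
Qed.

(** [V k] lies in [U i], so the part of the preimage of [V k.+1] in [U j] is disjoint from it and
    adds to its mass. The Lebesgue mass of that part is at least [c] times that of [V k.+1], which
    is at least [mass m (V k) / S]. *)
Lemma gain_one k i j c : (k < n)%N -> U i (iter k T x) -> j <> i -> 0 < c ->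
  (forall V : set R, measurable V -> V `<=` mobius (G j) @` U j ->
    c * mass l V <= mass l (U j `&` T @^-1` V)) ->
  V k.+1 `<=` mobius (G j) @` U j ->
  exists2 E : set R, measurable E &
    E `<=` J /\ mass m (V k) + mass m E <= mass m (V k.+1) /\ c / S * mass m (V k) <= mass l E.
Proof.
move=> kn Ui ji c0 cP VG; have mVk := mV (ltnW kn); have mVk1 := mV kn.
have mE : measurable (U j `&` T @^-1` V k.+1) by apply: measurableI => //; exact: mTpre.
exists (U j `&` T @^-1` V k.+1) => //; split; first by move=> y [/UJ].
split.
  rewrite -massU//; last first.
    by apply/seteqP; split => // y [/(VU kn Ui) Uiy [/(tU Uiy) ij _]]; apply: ji.
  rewrite {2}/mass -(inv mVk1) -/(mass _ _); apply: le_mass.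
  - exact: measurableU.
  - exact: mTpre.
  - by move=> y [Vy|[]//]; rewrite /= TV; exists y.
apply: le_trans (cP _ mVk1 VG); rewrite -mulrA ler_pM2l// mulrC ler_pdivrMr//.
by rewrite mulrC; apply: le_trans (mass_le kn) (mlS mVk1).
Qed.

(* [T^-1 (V k.+1)] contains [V k] and a disjoint piece of another covering branch,
   unless [V k] lies in [U k0] and [V k.+1] does not; then the same happens for
   [V k.+1]. *)
Lemma gain_two c : 0 < c ->
  (forall j, j = k0 \/ j = j1 -> forall V : set R, measurable V ->
    V `<=` mobius (G j) @` U j -> c * mass l V <= mass l (U j `&` T @^-1` V)) ->
  forall k, (k.+1 < n)%N -> exists2 E : set R, measurable E &
    E `<=` J /\ mass m (V k) + mass m E <= mass m (V k.+2) /\ c / S * mass m (V k) <= mass l E.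
Proof.
move=> c0 cP k kn; have kn' := ltnW kn.
have [i Ui] := xdef.2 k kn'; have [i' Ui'] := xdef.2 k.+1 kn.
have Vfull k' : (k' <= n)%N -> V k' `<=` mobius (G k0) @` U k0.
  by move=> /iterate_itv[_ VJ]; exact: subset_trans VJ full.
have [ik|ik] := eqVneq i k0; last first.
  have [|E mE [EJ [E1 E2]]] := @gain_one k i k0 c kn' Ui _ c0 (cP _ (or_introl erefl)) (Vfull _ kn').
    by move=> e; rewrite e eqxx in ik.
  by exists E => //; split => //; split => //; apply: le_trans E1 (mass_le kn).
have [ik'|ik'] := eqVneq i' k0; last first.
  have [|E mE [EJ [E1 E2]]] := @gain_one k.+1 i' k0 c kn Ui' _ c0 (cP _ (or_introl erefl)) (Vfull _ kn).
    by move=> e; rewrite e eqxx in ik'.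
  have := mass_le kn' => h.
  exists E => //; split => //; split; first by apply: le_trans E1; rewrite lerD2r.
  by apply: le_trans E2; rewrite ler_wpM2l// divr_ge0// ltW.
have VG : V k.+1 `<=` mobius (G j1) @` U j1.
  by apply: subset_trans second; rewrite -ik'; exact: VU.
have [|E mE [EJ [E1 E2]]] := @gain_one k i j1 c kn' Ui _ c0 (cP _ (or_intror erefl)) VG.
  by rewrite ik.
by exists E => //; split => //; split => //; apply: le_trans E1 (mass_le kn).
Qed.

End gain.

Let uv1 : u j1 < v j1.
Proof.
have : U k0 ((u k0 + v k0) / 2) by rewrite /= in_itv/= !midf_lt.
by move=> /second[x + _]; rewrite /= in_itv/= => /andP[]; exact: lt_trans.
Qed.

Lemma gain_constant : exists2 c : R, 0 < c &
  forall j, j = k0 \/ j = j1 -> forall V : set R, measurable V ->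
    V `<=` mobius (G j) @` U j -> c * mass l V <= mass l (U j `&` T @^-1` V).
Proof.
have [c c0 cP] := cylinder_preimage_mass uv0.
have [c' c'0 c'P] := cylinder_preimage_mass uv1.
exists (Num.min c c'); first by rewrite lt_min c0.
move=> j [] -> V mV VG.
  by apply: le_trans (cP V mV VG); rewrite ler_wpM2r ?mass_ge0// ge_min lexx.
by apply: le_trans (c'P V mV VG); rewrite ler_wpM2r ?mass_ge0// ge_min lexx orbT.
Qed.

Lemma mass_itv (a b : R) : a <= b -> `]a, b[ `<=` J -> mass l `]a, b[%classic = b - a.
Proof.
move=> ab abJ; apply: EFin_inj; rewrite mass_lE// lebesgue_measure_itv/= lte_fin.
case: ltP => [_|ba]; first by rewrite EFinB.
by congr EFin; apply/eqP; rewrite eq_sym subr_eq0 eq_le ba.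
Qed.

(** Each piece gained has Lebesgue mass at least [c / S] times the mass of the initial interval,
    hence [m]-mass at least a fixed [w] by absolute continuity; enough gains exceed the total
    mass. *)
Lemma no_homterval x (a b : R) : a < b -> (forall n, defined n x) ->
  ~ (forall n, `]a, b[ `<=` cyl n x).
Proof.
move=> ab xdef Wcyl.
have [c c0 cP] := gain_constant.
have WJ : `]a, b[ `<=` J by move=> z /(Wcyl 0%N)[].
have mW : 0 < mass m `]a, b[%classic.
  rewrite lt_neqAle mass_ge0 andbT eq_sym; apply/eqP => W0.
  have : mass l `]a, b[%classic = 0.
    by rewrite /mass lm0//; apply/eqP; rewrite -mass_eq0// W0.
  by rewrite mass_itv ?ltW// => /eqP; rewrite subr_eq0 gt_eqF.
pose V k : set R := iter k T @` `]a, b[.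
have [w w0 wP] := @mass_abs_continuous _ _ _ l m (c / S * mass m `]a, b[%classic)
  (mulr_gt0 (divr_gt0 c0 S0) mW) lm0.
have V0 : V 0%N = `]a, b[%classic.
  by apply/seteqP; split => [y [z zab <-]//|y yab]; exists y.
have grow i : mass m `]a, b[%classic + i%:R * w <= mass m (V i.*2).
  elim: i => [|i IH]; first by rewrite mul0r addr0 V0.
  have [E mE [EJ [E1 E2]]] := gain_two (xdef i.*2.+2) ab (Wcyl i.*2.+2) c0 cP (ltnSn i.*2.+1).
  have : w <= mass m E.
    apply: wP => //; apply: le_trans E2; rewrite ler_wpM2l ?divr_ge0 ?(ltW c0) ?(ltW S0)//.
    by apply: (le_trans _ IH); rewrite lerDl mulr_ge0// ltW.
  by rewrite doubleS -natr1; move: E1 IH; rewrite -/(V _) -/(V _); lra.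
pose i := (Num.truncn (mass m setT / w)).+1.
have : mass m setT < i%:R * w by rewrite -ltr_pdivrMr// truncnS_gt.
have mV : measurable (V i.*2).
  by rewrite /V; have [[p [q [_ ->]]] _] := iterate_itv (xdef i.*2) ab (Wcyl i.*2) (leqnn _).
by have := grow i; have := le_mass m mV measurableT (@subsetT _ _); move: mW; lra.
Qed.

Lemma cyl_le n n' x : (n <= n')%N -> cyl n' x `<=` cyl n x.
Proof. by move=> nn z [Jz h]; split => // k kn; apply: h; exact: leq_trans nn. Qed.

(** Cylinders around [x] are nested intervals. If all of them reached distance [e], either they
    would all contain []x, x + e[], or from some rank on they would have to reach far to the left
    and all would contain []x - e, x[]. *)
Lemma cyl_shrink x e : 0 < e -> (forall n, defined n x) ->
  exists N, forall n, (N <= n)%N -> cyl n x `<=` ball x e.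
Proof.
move=> e0 xdef; apply: contrapT => no.
have conv n y z : cyl n x y -> y < z < x \/ x < z < y -> cyl n x z.
  have [H [a [b [ab [CE CJ] _ _ _]]]] := cyl_branch sys (xdef n).
  have := cyl_refl (xdef n); rewrite CE /= !in_itv/= => /andP[? ?] /andP[? ?].
  by move=> [] /andP[? ?]; apply/andP; split; lra.
have far n : exists2 y, cyl n x y & e <= `|x - y|.
  apply: contrapT => nf; apply: no; exists n => n' nn y Cy.
  rewrite /ball /=; rewrite ltNge; apply/negP => ey; apply: nf; exists y => //.
  exact: cyl_le nn _ Cy.
have [right|] := pselect (forall n, `]x, (x + e)[ `<=` cyl n x).
  by apply: (@no_homterval x x (x + e)) => //; rewrite ltrDl.
move=> /existsNP[n0 nr].
apply: (@no_homterval x (x - e) x) => //; first by rewrite gtrBl.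
move=> n z; rewrite /= in_itv/= => /andP[z1 z2].
have [y Cy ey] := far (maxn n n0).
have [xy|yx] := leP y x.
  apply: (cyl_le (leq_maxl n n0)); apply: conv Cy _; left.
  by move: ey; rewrite ger0_norm ?subr_ge0// => ey; apply/andP; split; lra.
case: nr => t; rewrite /= in_itv/= => /andP[t1 t2].
apply: (cyl_le (leq_maxr n n0)); apply: conv Cy _; right.
by move: ey; rewrite ltr0_norm ?subr_lt0// => ey; apply/andP; split; lra.
Qed.

Let mU : measurable (\bigcup_n U n).
Proof. exact: bigcup_measurable. Qed.

Let cover_m : m (~` \bigcup_n U n) = 0%E.
Proof.
apply/eqP; rewrite -mass_eq0; last exact: measurableC.
rewrite eq_le mass_ge0 andbT (le_trans (mlS _))//; first exact: measurableC.
by rewrite /mass cover mulr0.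
Qed.

Lemma ae_defined : m.-negligible (~` [set x | forall n, defined n x]) /\
  l.-negligible (~` [set x | forall n, defined n x]).
Proof.
(* Invariance makes all preimages of the uncovered set null for [m]; only afterwards does absolute
   continuity transfer this to [l]. *)
pose N := ~` J `|` \bigcup_k iter k T @^-1` (~` \bigcup_n U n).
have mN : measurable N.
  apply: measurableU; first exact: measurableC.
  by apply: bigcup_measurable => k _; apply: mTn; exact: measurableC.
have sN : ~` [set x | forall n, defined n x] `<=` N.
  move=> x; apply: contraPP => /not_orP[/contrapT Jx h] nd; apply: nd => n; split => // k _.
  apply: contrapT => no; apply: h; exists k => // -[j _ Uj]; apply: no; by exists j.
have mC : measurable (~` \bigcup_n U n) by exact: measurableC.
have JC : l (~` J) = 0%E by rewrite lE ?setICl ?measure0//; exact: measurableC.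
have JCm : m (~` J) = 0%E.
  apply/eqP; rewrite -mass_eq0; last exact: measurableC.
  rewrite eq_le mass_ge0 andbT (le_trans (mlS _))//; first exact: measurableC.
  by rewrite /mass JC mulr0.
have mN0 : m N = 0%E.
  apply/negligibleP => //.
  apply: negligibleU; first by apply/negligibleP => //; exact: measurableC.
  apply: negligible_bigcup => k; apply/negligibleP; first exact: mTn.
  exact: etrans (inv_iter k mC) cover_m.
by split; exists N; split => //; exact: lm0.
Qed.

(** * Bounded distortion over the full cylinder *)

Section distortion.
Variables (u' v' : R).
Hypothesis uu' : u k0 < u'.
Hypothesis uv' : u' < v'.
Hypothesis vv' : v' < v k0.
Local Notation K' := (`[u', v']%classic).

Let K'U : K' `<=` U k0.
Proof.
have h1 := uu'; have h2 := vv'.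
by move=> x; rewrite /= !in_itv/= => /andP[? ?]; apply/andP; split; lra.
Qed.

Let branch_pull n C H (E : set R) : branch n C H -> U k0 `<=` mobius H @` C ->
  measurable E -> E `<=` U k0 ->
  (mass l (C `&` iter n T @^-1` E))%:E =
    (\int[lambda]_(x in E) (mobius_jac (mobius_inv H) x)%:E)%E.
Proof.
move=> [a [b [ab [CE CJ] [dH pf TH] _ _]]] KC mE EK.
have mC : measurable C by rewrite CE.
have pfC : pole_free H C.
  by rewrite CE => z; rewrite /= in_itv/= => /andP[? ?]; apply: pf; rewrite /= in_itv/= !ltW.
have mF : measurable (C `&` iter n T @^-1` E) by apply: measurableI => //; exact: mTn.
have FE z : C z -> E (iter n T z) -> mobius (mobius_inv H) (iter n T z) = z.
  by move=> Cz _; rewrite (TH _ Cz) (mobius_invK dH (pfC _ Cz)).2.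
rewrite mass_lE//; last by move=> z [/CJ].
rewrite (@lebesgue_mobius_image _ (mobius_inv H) E)//.
- congr integral; apply/seteqP; split => [y [//]|y Ey]; split => //=.
  have [z Cz zy] := KC _ (EK _ Ey).
  have zE : mobius (mobius_inv H) y = z by rewrite -zy (mobius_invK dH (pfC _ Cz)).2.
  by rewrite zE (TH _ Cz) zy.
- exact: mobius_inv_det.
- move=> y /EK/KC[z Cz <-]; exact: (mobius_invK dH (pfC _ Cz)).1.
- move=> z [Cz Ez]; exists (iter n T z) => //; exact: FE.
Qed.

(** The inverse branch has no pole on [U k0], so its Jacobian anywhere on [U k0] is at least the
    inverse of [k ^+ 2] times its Jacobian anywhere on [K']. Integration over [E] in the first point
    and over [K'] in the second gives the claim; the second integration brings in the length of
    [K']. *)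
Lemma branch_distortion : exists2 c : R, 0 < c & forall n C H (E : set R),
  branch n C H -> U k0 `<=` mobius H @` C -> measurable E -> E `<=` U k0 ->
  c * mass l E * mass l (C `&` iter n T @^-1` K') <= mass l (C `&` iter n T @^-1` E).
Proof.
have h1 := uu'; have h2 := vv'; have h3 := uv'.
set k := (v k0 - u k0) / Num.min (u' - u k0) (v k0 - v').
have k_gt0 : 0 < k by rewrite divr_gt0 ?lt_min ?subr_gt0 ?uu' ?vv'.
exists ((k ^+ 2)^-1 / (v' - u')); first by rewrite divr_gt0 ?invr_gt0 ?exprn_gt0 ?subr_gt0.
move=> n C H E bH KC mE EK.
have [a [b [ab [CE CJ] [dH pf TH] _ _]]] := bH.
set N := mobius_inv H.
have pfN : pole_free N (U k0).
  move=> y /KC[z Cz <-]; apply: (mobius_invK dH _).1; apply: pf; move: Cz; rewrite CE.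
  by rewrite /= !in_itv/= => /andP[? ?]; rewrite !ltW.
have jac x y : U k0 x -> K' y -> (k ^+ 2)^-1 * mobius_jac N y <= mobius_jac N x.
  move=> Ux Ky; have dx := pfN _ Ux; have dy := pfN _ (K'U Ky).
  have := @denom_distortion _ N (u k0) u' v' (v k0) x y uu' vv' pfN.
  rewrite -/k; move: Ux Ky; rewrite /= !in_itv/= => -> -> /(_ isT isT) dk.
  rewrite /mobius_jac -invfM -exprMn lef_pV2 ?posrE.
  - rewrite -[leLHS]real_normK ?num_real// -[leRHS]real_normK ?num_real//.
    by rewrite ler_sqr ?nnegrE// normrM (gtr0_norm k_gt0).
  - by rewrite exprn_even_gt0//= mulf_neq0// gt_eqF.
  - by rewrite exprn_even_gt0.
have step y : K' y -> (k ^+ 2)^-1 * mobius_jac N y * mass l E <= mass l (C `&` iter n T @^-1` E).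
  move=> Ky; rewrite -lee_fin (branch_pull bH KC mE EK) EFinM mass_lE//; last exact: subset_trans EK (@UJ _).
  rewrite -integral_cst//; apply: ge0_le_integral => //.
  - by move=> x _; rewrite lee_fin mulr_ge0 ?mobius_jac_ge0// invr_ge0 exprn_ge0// ltW.
  - by apply/measurable_EFinP/measurable_funTS; exact: measurable_mobius_jac.
  - by move=> x Ex; rewrite lee_fin jac//; exact: EK.
have mK' : mass l K' = v' - u'.
  apply: EFin_inj; rewrite mass_lE//; last exact: subset_trans K'U (@UJ _).
  by rewrite lebesgue_measure_itv/= lte_fin uv' EFinB.
have vu0 : 0 < v' - u' by rewrite subr_gt0.
rewrite [leLHS](_ : _ = ((k ^+ 2)^-1 * mass l (C `&` iter n T @^-1` K') * mass l E) / (v' - u')); last first.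
  by ring.
rewrite ler_pdivrMr// -lee_fin.
have -> : ((k ^+ 2)^-1 * mass l (C `&` iter n T @^-1` K') * mass l E)%:E =
    (((k ^+ 2)^-1 * mass l E)%:E * (mass l (C `&` iter n T @^-1` K'))%:E)%E.
  by rewrite -EFinM; congr EFin; ring.
rewrite (branch_pull bH KC _ K'U)// -mK' (EFinM _ (mass l K')) (mass_lE (A := K'))//; last first.
  exact: subset_trans K'U (@UJ _).
rewrite -integral_cst// -ge0_integralZl_EFin//; last 3 first.
- by move=> x _; rewrite lee_fin mobius_jac_ge0.
- by apply/measurable_EFinP/measurable_funTS; exact: measurable_mobius_jac.
- by rewrite mulr_ge0 ?mass_ge0// invr_ge0 exprn_ge0// ltW.
apply: ge0_le_integral => //.
- by move=> x _; rewrite -EFinM lee_fin mulr_ge0 ?mobius_jac_ge0// mulr_ge0 ?mass_ge0// invr_ge0 exprn_ge0// ltW.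
- apply: emeasurable_funM => //.
  by apply/measurable_EFinP/measurable_funTS; exact: measurable_mobius_jac.
- by move=> y Ky; rewrite -EFinM lee_fin mulrAC; exact: step.
Qed.

Lemma cyl_eq n x y : cyl n x y -> cyl n y = cyl n x.
Proof.
move=> [Jy h]; apply/seteqP; split => z [Jz hz]; split => // k kn.
  have [i [Uix Uiy]] := h k kn; have [j [Ujy Ujz]] := hz k kn.
  by exists i; split => //; rewrite (tU Uiy Ujy).
have [i [Uix Uiy]] := h k kn; have [j [Ujx Ujz]] := hz k kn.
by exists i; split => //; rewrite (tU Uix Ujx).
Qed.

(** The estimate for single branches summed over the cylinders of rank [k + n] inside [cyl k x], as
    an induction on [n] that refines the cylinder by one rank. A cylinder whose image misses [U k0]
    contributes 0 to both sides. *)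
Lemma preimage_distortion c : 0 < c -> (forall n C H (E : set R),
    branch n C H -> U k0 `<=` mobius H @` C -> measurable E -> E `<=` U k0 ->
    c * mass l E * mass l (C `&` iter n T @^-1` K') <= mass l (C `&` iter n T @^-1` E)) ->
  forall n k x (E : set R), defined k x -> measurable E -> E `<=` U k0 ->
  c * mass l E * mass l (cyl k x `&` iter (k + n) T @^-1` K') <=
  mass l (cyl k x `&` iter (k + n) T @^-1` E).
Proof.
move=> c0 cP; elim=> [|n IH] k x E xdef mE EK.
  rewrite addn0; have [H bH] := cyl_branch sys xdef.
  have [[z [Cz Uz]]|no] := pselect (exists z, cyl k x z /\ U k0 (iter k T z)).
    by apply: (cP _ _ _ _ bH) => //; exact: branch_cover bH Cz Uz.
  rewrite (_ : cyl k x `&` iter k T @^-1` K' = set0).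
    by rewrite {2}/mass measure0 mulr0 mass_ge0.
  by apply/seteqP; split => // z [Cz /K'U Uz]; apply: no; exists z.
have mC : measurable (cyl k x).
  by have [H [a [b [_ [-> _] _ _ _]]]] := cyl_branch sys xdef.
have mTA (A : set R) n' : measurable A -> measurable (cyl k x `&` iter n' T @^-1` A).
  by move=> mA; apply: measurableI => //; exact: mTn.
pose D j := cyl k x `&` iter k T @^-1` U j.
have mD j : measurable (D j) by exact: mTA.
have split_sum (A : set R) : measurable A ->
    (mass l (cyl k x `&` A))%:E = (\sum_(j <oo) (mass l (D j `&` A))%:E)%E.
  move=> mA.
  have mDA j : measurable (D j `&` A) by exact: measurableI.
  transitivity (l (\bigcup_j (D j `&` A))).
    have mB : measurable (\bigcup_j (D j `&` A)) by exact: bigcup_measurable.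
    have mCA : measurable (cyl k x `&` A) by exact: measurableI.
    have sub : \bigcup_j (D j `&` A) `<=` cyl k x `&` A.
      by move=> z [j _ [[Cz _] Az]].
    rewrite massE// -(setDUK sub) measureU0//; first exact: measurableD.
    apply: (@measure_sub0 _ _ _ l _ (iter k T @^-1` (~` \bigcup_j U j))).
    - exact: measurableD.
    - by apply: mTn; exact: measurableC.
    - move=> z [[Cz Az] nz] [j _ Uj]; apply: nz; exists j => //.
    - apply: lm0; first by apply: mTn; exact: measurableC.
      by apply: (etrans (inv_iter k _) cover_m); exact: measurableC.
  rewrite measure_bigcup//; last 2 first.
  - by move=> i _; exact: mDA.
  - apply/trivIsetP => i j _ _ ij; apply/seteqP; split => // z [[[_ Ui] _] [[_ Uj] _]].
    by rewrite (tU Ui Uj) eqxx in ij.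
  transitivity (\sum_(j <oo) l (D j `&` A))%E.
    by apply: eq_eseriesl => j; rewrite in_setT.
  by apply: eq_eseriesr => j _; rewrite massE; last exact: mDA.
rewrite -lee_fin EFinM !split_sum; try exact: mTn.
rewrite -nneseriesZl; last by move=> *; rewrite lee_fin mass_ge0.
apply: lee_nneseries => [j _|j _].
  by rewrite -EFinM lee_fin !mulr_ge0 ?mass_ge0// ltW.
rewrite -EFinM lee_fin.
have [[z [Cz Uz]]|no] := pselect (exists z, D j z); last first.
  have -> : D j = set0 by apply/seteqP; split => // z Dz; apply: no; exists z.
  by rewrite !set0I {2}/mass measure0 mulr0 mass_ge0.
have zdef : defined k.+1 z.
  split; first by case: Cz.
  move=> i; rewrite ltnS leq_eqVlt => /predU1P[->|ik]; first by exists j.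
  by have [i' [_ ?]] := Cz.2 i ik; exists i'.
have -> : D j = cyl k.+1 z.
  by rewrite (cylS sys Uz) (cyl_eq Cz).
by rewrite addnS -addSn; exact: IH.
Qed.

End distortion.

Lemma density_lower_bound (A : set R) : measurable A ->
  {ae lambda, forall x, A x -> forall e : R, 0 < e -> exists2 r0 : R, 0 < r0 &
    forall r, 0 < r < r0 -> (((1 - e) * (2 * r))%:E < lambda (A `&` ball x r))%E}.
Proof.
move=> mA; have [N [mN N0 sN]] := lebesgue_density mA.
exists N; split => // x nx; apply: sN => /= dx; apply: nx => Ax e e0.
move: dx; rewrite indicE mem_set//= => dx.
have : nbhs (1%:E : \bar R) [set y | ((1 - e)%:E < y)%E].
  by apply: open_nbhs_nbhs; split; [exact: open_ereal_gt_ereal|rewrite /= lte_fin gtrBl].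
move=> /dx /= [d /= d0 dP]; exists d => // r /andP[r0 rd].
have := dP r; rewrite /= sub0r normrN (gtr0_norm r0) => /(_ rd r0).
rewrite lebesgue_measure_ball ?(ltW r0)// inver mulrn_eq0/= gt_eqF//.
have r20 : 0 < r *+ 2 by rewrite pmulrn_lgt0.
by rewrite lte_pdivlMr// EFinM mulr_natl.
Qed.

(** A branch is monotone, so the preimage of an interval in [C] is convex; distances inside it are
    thus bounded by its measure. *)
Lemma pull_interval n C H (p q x z : R) : branch n C H -> C x -> C z ->
  p <= mobius H x <= q -> p <= mobius H z <= q -> x < z ->
  `]x, z[ `<=` C `&` iter n T @^-1` `[p, q].
Proof.
move=> [a [b [ab [CE CJ] [dH pf TH] _ _]]] Cx Cz hx hz xz y.
move: (Cx) (Cz); rewrite CE /= !in_itv/= => /andP[ax xb] /andP[az zb] yxz.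
have /andP[xy yz] := yxz.
have Cy : C y by rewrite CE /= in_itv/= (lt_trans ax xy) (lt_trans yz zb).
split; first by rewrite (lt_trans ax xy) (lt_trans yz zb).
have pf' : pole_free H `[x, z].
  by move=> t; rewrite /= in_itv/= => /andP[xt tz]; apply: pf; rewrite /= in_itv/=; lra.
have [_ im] := mobius_itv dH xz pf'.
have : (mobius H @` `]x, z[%classic) (mobius H y) by exists y.
rewrite im -(TH _ Cy) /= in_itv/= => /andP[]; rewrite (TH _ Cy).
rewrite gt_min lt_max => h1 h2; move: hx hz => /andP[? ?] /andP[? ?].
by apply/andP; split; [case/orP: h1|case/orP: h2] => ?; lra.
Qed.

Let symdiff_iter n (A : set R) : measurable A -> m (A `+` T @^-1` A) = 0%E ->
  m (A `+` iter n T @^-1` A) = 0%E.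
Proof.
move=> mA A0; elim: n => [|n IH].
  by rewrite (_ : iter 0 T @^-1` A = A)// setYK measure0.
have mS n' : measurable (A `+` iter n' T @^-1` A).
  by rewrite setY_def; apply: measurableU; apply: measurableD => //; exact: mTn.
apply: (@measure_sub0 _ _ _ m _ ((A `+` T @^-1` A) `|` T @^-1` (A `+` iter n T @^-1` A))).
- exact: mS.
- apply: measurableU; first exact: (mS 1%N).
  exact: mTpre.
- move=> x; rewrite !setY_def /= -!iterS !iterSr => -[[Ax nx]|[Tx nA]].
    by have [TAx|nTA] := pselect (A (T x)); [right; left|left; left].
  by have [TAx|nTA] := pselect (A (T x)); [left; right|right; right].
- have mS1 : measurable (A `+` T @^-1` A) := mS 1%N.
  apply: measureU_eq0 => //; first exact: mTpre.
  exact: etrans (inv (mS n)) IH.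
Qed.

Let l_of_m (A : set R) : measurable A -> m A = 0%E -> l A = 0%E.
Proof. exact: lm0. Qed.

Let m_of_l (A : set R) : measurable A -> l A = 0%E -> m A = 0%E.
Proof.
move=> mA A0; apply/eqP; rewrite -mass_eq0// eq_le mass_ge0 andbT.
by rewrite (le_trans (mlS mA))// /mass A0 mulr0.
Qed.

Let mass_symdiff (A B C : set R) : measurable A -> measurable B -> measurable C ->
  m (A `+` B) = 0%E -> mass m (C `&` A) = mass m (C `&` B).
Proof.
move=> mA mB mC AB.
have mAB : measurable (A `+` B) by rewrite setY_def; apply: measurableU; exact: measurableD.
have le_ (X Y : set R) : measurable X -> measurable Y -> X `<=` Y `|` (A `+` B) ->
    mass m X <= mass m Y.
  move=> mX mY XY; rewrite -lee_fin !massE//.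
  apply: (@le_trans _ _ (m (Y `|` (A `+` B)))).
    by apply: le_measure; rewrite ?inE//; exact: measurableU.
  by rewrite measureU0.
have mCA := measurableI _ _ mC mA; have mCB := measurableI _ _ mC mB.
apply/eqP; rewrite eq_le; apply/andP; split; apply: le_ => // x [Cx].
  by have [Bx|nB] := pselect (B x); [left|right; rewrite setY_def; left].
by have [Ax|nA] := pselect (A x); [left|right; rewrite setY_def; right].
Qed.

(** The branch on [U k0] covers [J], so the preimage of a non-null [A] has positive measure inside
    [U k0], and that preimage is [A] up to a null set. *)
Let mass_full_cylinder (A : set R) : measurable A -> m (A `+` T @^-1` A) = 0%E ->
  m A <> 0%E -> 0 < mass m (U k0 `&` A).
Proof.
move=> mA A0 Apos; have [c c0 cP] := gain_constant.
have mAJ : measurable (A `&` J) by exact: measurableI.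
have mUA : measurable (U k0 `&` A) by exact: measurableI.
have lA : 0 < mass l (A `&` J).
  rewrite lt_neqAle mass_ge0 andbT eq_sym; apply/negP => /eqP e; apply: Apos; apply: m_of_l => //.
  apply/eqP; rewrite -mass_eq0// -e /mass !lE//.
  by rewrite -setIA setIid.
have := cP k0 (or_introl erefl) _ mAJ (subset_trans (@subIsetr _ A J) full).
move=> /(lt_le_trans (mulr_gt0 c0 lA)) lT.
rewrite lt_neqAle mass_ge0 andbT eq_sym; apply/negP => /eqP e.
have e' : mass m (U k0 `&` T @^-1` A) = 0.
  by rewrite -e; apply/esym; apply: mass_symdiff => //; exact: mTpre.
have mUT : measurable (U k0 `&` T @^-1` A) by apply: measurableI => //; exact: mTpre.
have l0 : mass l (U k0 `&` T @^-1` A) = 0.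
  by rewrite /mass lm0//; apply/eqP; rewrite -mass_eq0// e'.
move: lT; rewrite ltNge -l0 => /negP; apply; apply: le_mass => //.
  by apply: measurableI => //; exact: mTpre.
by move=> x [Ux [Ax _]].
Qed.

(** Closed intervals exhausting [U k0]; the shift by 3 keeps the two margins together below the
    length. *)
Let K p : set R := `[u k0 + (v k0 - u k0) / p.+3%:R, v k0 - (v k0 - u k0) / p.+3%:R]%classic.

Let exhaust (A : set R) : measurable A -> 0 < mass m (U k0 `&` A) ->
  exists p, forall q, (p <= q)%N -> 0 < mass m (K q `&` A).
Proof.
have uv := uv0.
move=> mA UA; apply: contrapT => no.
have mKA p : measurable (K p `&` A) by apply: measurableI => //; exact: measurable_itv.
have ndK : nondecreasing_seq (fun p => K p `&` A).
  move=> p q pq; apply/subsetPset => x [Kx Ax]; split => //; move: Kx.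
  have : (v k0 - u k0) / q.+3%:R <= (v k0 - u k0) / p.+3%:R.
    by rewrite ler_wpM2l ?subr_ge0 ?(ltW uv)// lef_pV2 ?posrE ?ltr0n// ler_nat !ltnS.
  rewrite /K /= !in_itv/=; move: (_ / q.+3%:R) (_ / p.+3%:R) => a b ? /andP[? ?].
  by apply/andP; split; lra.
have K0 p : mass m (K p `&` A) <= 0.
  rewrite leNgt; apply/negP => Kp; apply: no; exists p => q pq.
  apply: lt_le_trans Kp (le_mass m (mKA p) (mKA q) _).
  exact/subsetPset/(ndK _ _ pq).
have := @mass_bigcup_ge _ _ _ m (fun p => K p `&` A) 0 mKA ndK K0; rewrite leNgt => /negP; apply.
apply: (lt_le_trans UA); apply: le_mass.
- exact: measurableI.
- by apply: bigcup_measurable => k _; exact: mKA.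
- move=> x [/= + Ax]; rewrite in_itv/= => /andP[ux xv].
  pose e := Num.min (x - u k0) (v k0 - x).
  have e0 : 0 < e by rewrite lt_min !subr_gt0 ux.
  have [e1 e2] : e <= x - u k0 /\ e <= v k0 - x by rewrite /e !ge_min !lexx orbT.
  exists (Num.truncn ((v k0 - u k0) / e)) => //; split => //.
  set p := Num.truncn _.
  have : (v k0 - u k0) / p.+3%:R <= e.
    rewrite ler_pdivrMr ?ltr0n// mulrC -ler_pdivrMr//.
    by apply: ltW; apply: (lt_le_trans (truncnS_gt _)); rewrite ler_nat ltnS ltnW.
  by rewrite /K /= in_itv/=; move: (_ / _) => a ?; apply/andP; split; lra.
Qed.

Let K_lt p : u k0 < u k0 + (v k0 - u k0) / p.+3%:R /\
  u k0 + (v k0 - u k0) / p.+3%:R < v k0 - (v k0 - u k0) / p.+3%:R /\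
  v k0 - (v k0 - u k0) / p.+3%:R < v k0.
Proof.
have uv := uv0.
have d0 : 0 < (v k0 - u k0) / p.+3%:R by rewrite divr_gt0 ?subr_gt0.
have : (v k0 - u k0) / p.+3%:R * 3 <= v k0 - u k0.
  by rewrite mulrAC ler_pdivrMr ?ltr0n// ler_wpM2l ?ler_nat// subr_ge0 ltW.
by move: (_ / _) d0 => a ? ?; split; [|split]; lra.
Qed.

(** If [A] and its complement are both non-null, some [K'] meets both. A density point of [A] that
    returns to [K'] infinitely often has arbitrarily small neighbourhoods in which, by distortion,
    the complement of [A] takes a fixed proportion. *)
Lemma ergodic_marginal (A : set R) : measurable A -> m (A `+` T @^-1` A) = 0%E ->
  m A = 0%E \/ m (~` A) = 0%E.
Proof.
move=> mA A0; apply: contrapT => /not_orP[hA hC].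
have mAC : measurable (~` A) by exact: measurableC.
have AC0 : m (~` A `+` T @^-1` (~` A)) = 0%E.
  by rewrite -[RHS]A0; congr (m _); rewrite !setY_def; apply/seteqP; split => x /=;
    have [?|?] := pselect (A x); have [?|?] := pselect (A (T x)); tauto.
have [p1 p1P] := exhaust mA (mass_full_cylinder mA A0 hA).
have [p2 p2P] := exhaust mAC (mass_full_cylinder mAC AC0 hC).
set p := maxn p1 p2.
have := p1P p (leq_maxl _ _); have := p2P p (leq_maxr _ _); have := K_lt p.
rewrite /K; set u' := u k0 + _; set v' := v k0 - _.
move: (u') (v') => {}u' {}v' [uu' [uv' vv']] KC KA {p1P p2P p}.
set K' := `[u', v']%classic in KC KA.
have mK' : measurable K' by exact: measurable_itv.
have K'U : K' `<=` U k0.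
  by move=> x; rewrite /K' /= !in_itv/= => /andP[? ?]; apply/andP; split; lra.
have [c c0 cP] := branch_distortion uu' uv' vv'.
(* Invariance gives every [L n] at least the mass of [A] in [K'], so the points of [A] that visit
   [K'] infinitely often have positive measure. *)
pose L n := A `&` iter n T @^-1` K'.
have mL n : measurable (L n) by apply: measurableI => //; exact: mTn.
have mLE n : mass m (K' `&` A) <= mass m (L n).
  rewrite /L [X in _ <= mass m X]setIC.
  rewrite (mass_symdiff mA (mTn n mA) (mTn n mK') (symdiff_iter n mA A0)).
  by rewrite {1}/mass -(inv_iter n (measurableI _ _ mK' mA)).
have mLS : measurable (lim_sup_set L).
  by apply: bigcapT_measurable => n; apply: bigcup_measurable => k _; exact: mL.
have Lpos := @mass_lim_sup_set _ _ _ m L _ mL mLE.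
have [[N1 [mN1 N10 sN1]] _] := ae_defined.
have [N2 [mN2 N20 sN2]] := density_lower_bound mA.
have N20' : m N2 = 0%E.
  apply: m_of_l => //; rewrite lE//.
  by apply: (subset_measure0 _ _ (@subIsetl _ _ _) N20) => //; exact: measurableI.
have [x [Lx N1x N2x]] : exists x, [/\ lim_sup_set L x, ~ N1 x & ~ N2 x].
  apply: contrapT => no.
  suff : mass m (lim_sup_set L) = 0 by move=> e; move: (lt_le_trans KA Lpos); rewrite e ltxx.
  have mN12 : measurable (N1 `|` N2) by exact: measurableU.
  have N120 : m (N1 `|` N2) = 0%E by exact: measureU_eq0.
  rewrite /mass (_ : m (lim_sup_set L) = 0%E)//.
  apply: (@measure_sub0 _ _ _ m _ (N1 `|` N2)) => //.
  move=> x Lx; apply: contrapT => /not_orP[? ?]; apply: no; by exists x.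
have xdef : forall n, defined n x by apply: contrapT => h; apply: N1x; exact: sN1.
have Ax : A x by have [k _ []] := Lx 0%N I.
have dens : forall e : R, 0 < e -> exists2 r0 : R, 0 < r0 &
    forall r, 0 < r < r0 -> (((1 - e) * (2 * r))%:E < lambda (A `&` ball x r))%E.
  by apply: contrapT => h; apply: N2x; apply: sN2 => /= h'; apply: h; exact: h'.
pose E := K' `\` A.
have mE : measurable E by exact: measurableD.
have EU : E `<=` U k0 by move=> y [/K'U].
have Epos : 0 < mass l E.
  rewrite lt_neqAle mass_ge0 andbT eq_sym; apply/negP => /eqP e.
  have : m E = 0%E by apply: m_of_l => //; apply/eqP; rewrite -mass_eq0// e.
  by move=> e'; move: KC; rewrite /mass -setDE -/E e' ltxx.
(* With the radius [r = 2 * mass l P] chosen below, the loss of density [e * (2 * r)] equals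
   [c * mass l E * mass l P], a lower bound for the mass of [F], which is disjoint from [A] up to a
   null set. *)
have e0 : 0 < c * mass l E / 4 by rewrite divr_gt0// mulr_gt0.
have [r0 r00 r0P] := dens _ e0.
(* The radius [r0 / 8] makes [mass l P] at most [r0 / 4], so that [2 * mass l P] stays below
   [r0]. *)
have [N NP] := cyl_shrink (divr_gt0 r00 (ltr0n _ 8)) xdef.
have [n /= Nn [_ Kx]] := Lx N I.
have [H bH] := cyl_branch sys (xdef n).
have [a [b [ab [CE CJ] [dH pf TH] _ _]]] := bH.
set C := cyl n x in bH CE CJ TH.
have Cx : C x by exact: cyl_refl.
have KC' := branch_cover bH Cx (K'U _ Kx).
pose P := C `&` iter n T @^-1` K'.
have mC : measurable C by rewrite CE.
have mP : measurable P by apply: measurableI => //; exact: mTn.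
have HK z : P z -> u' <= mobius H z <= v'.
  by move=> [Cz]; rewrite /= (TH _ Cz) /K' /= in_itv.
have Px : P x by [].
have PJ : P `<=` J by move=> z [/CJ].
have len z : P z -> `|x - z| <= mass l P.
  move=> Pz; have len2 y y' : P y -> P y' -> y < y' -> y' - y <= mass l P.
    move=> Py Py' yy'.
    have sub := pull_interval bH Py.1 Py'.1 (HK _ Py) (HK _ Py') yy'.
    rewrite -(@mass_itv y y' (ltW yy')); last exact: subset_trans sub PJ.
    exact: (le_mass l (measurable_itv _) mP sub).
  have [xz|zx|->] := ltgtP x z; last by rewrite subrr normr0 mass_ge0.
    by rewrite ltr0_norm ?subr_lt0// opprB; exact: len2.
  by rewrite gtr0_norm ?subr_gt0//; exact: len2.
have lpos : 0 < mass l P.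
  have [y Ky yx] : exists2 y, K' y & y <> mobius H x.
    have [e|ne] := pselect (u' = mobius H x).
      by exists v'; [rewrite /K' /= in_itv/= lexx ltW|rewrite -e; apply/eqP; rewrite gt_eqF].
    by exists u' => //; rewrite /K' /= in_itv/= lexx ltW.
  have [z Cz zy] := KC' _ (K'U _ Ky).
  have Pz : P z by split => //=; rewrite (TH _ Cz) zy.
  apply: lt_le_trans (len _ Pz); rewrite normr_gt0 subr_eq0; apply/eqP => xz.
  by apply: yx; rewrite -zy xz.
have lr0 : mass l P <= r0 / 4.
  rewrite -lee_fin mass_lE//.
  apply: (@le_trans _ _ (lambda (ball x (r0 / 8)))).
    apply: le_measure; rewrite ?inE//; first exact: measurable_ball.
    by move=> z [Cz _]; exact: (NP n Nn).
  by rewrite lebesgue_measure_ball ?divr_ge0 ?(ltW r00)// lee_fin -mulr_natr; lra.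
have r_lt : 0 < 2 * mass l P < r0 by apply/andP; split; lra.
have := r0P _ r_lt.
set r := 2 * mass l P; set B := ball x r => dB.
pose F := C `&` iter n T @^-1` E.
have mF : measurable F by apply: measurableI => //; exact: mTn.
have Fbig := cP _ _ _ _ bH KC' mE EU; rewrite -/P -/F in Fbig.
have FP : F `<=` P by move=> z [Cz []].
have mFA : measurable (F `\` A) by exact: measurableD.
have mFIA : measurable (F `&` A) by exact: measurableI.
have FA : mass l F = mass l (F `\` A).
  rewrite -{1}(setDUK (@subIsetl _ F A)) setUC massU//.
  - rewrite setDIr setDv set0U.
    suff -> : mass l (F `&` A) = 0 by rewrite addr0.
    rewrite /mass lm0//.
    apply: (@measure_sub0 _ _ _ m _ (A `+` iter n T @^-1` A)) => //.
    + by rewrite setY_def; apply: measurableU; apply: measurableD => //; exact: mTn.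
    + by move=> z [[_ [_ nA]] Az]; rewrite setY_def; left.
    + exact: symdiff_iter.
  - exact: measurableD.
  - by apply/seteqP; split => // z [[Fz nI] FAz]; apply: nI.
have FAB : (lambda (A `&` B) + lambda (F `\` A) <= lambda B)%E.
  have mB : measurable B by exact: measurable_ball.
  rewrite -measureU//; last 2 first.
  - exact: measurableI.
  - by apply/seteqP; split => // z [[Az _] [_]].
  apply: le_measure; rewrite ?inE//.
    by apply: measurableU => //; exact: measurableI.
  move=> z [[]//|[Fz _]]; rewrite /B /ball /=.
  by apply: le_lt_trans (len _ (FP _ Fz)) _; rewrite /r; lra.
move: FAB; rewrite -(mass_lE mFA); last by move=> z [/FP/PJ].
rewrite -FA lebesgue_measure_ball; last by rewrite /r mulr_ge0// mass_ge0.
move=> FAB; have : ((1 - c * mass l E / 4) * (2 * r) + mass l F < r *+ 2)%R.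
  rewrite -lte_fin EFinD; apply: lt_le_trans FAB.
  by rewrite lteD2rE.
by rewrite -mulr_natr /r; move: Fbig; lra.
Qed.

Let l_setJ (A : set R) : measurable A -> mass l (J `&` A) = mass l A.
Proof.
move=> mA; apply: EFin_inj; rewrite !massE//; last exact: measurableI.
rewrite !lE//; last exact: measurableI.
by congr (lambda _); rewrite setIC setIA setIid setIC.
Qed.

(** For [E] inside [U k0], distortion bounds the Lebesgue measure of every preimage of [E] below by
    a multiple of that of [E], because the preimages of [K'] keep their [m]-mass and [m] is at most
    [S * l]; the occupation bound converts this to [m]. A general [E] is first pulled into [U k0] by
    the full branch. *)
Lemma marginal_lower_bound : exists2 c : R, 0 < c &
  forall E : set R, measurable E -> c * mass l E <= mass m E.
Proof.
have i01 := ms_lt sys; have uv := uv0.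
have mU0 : 0 < mass m (U k0).
  rewrite lt_neqAle mass_ge0 andbT eq_sym; apply/negP => /eqP e.
  have : mass l (U k0) = 0 by rewrite /mass lm0//; apply/eqP; rewrite -mass_eq0// e.
  rewrite mass_itv ?(ltW uv)// => /eqP; rewrite subr_eq0 => /eqP vu.
  by rewrite vu ltxx in uv.
have [p pP] : exists p, forall q, (p <= q)%N -> 0 < mass m (K q `&` setT).
  by apply: exhaust => //; rewrite setIT.
have := pP p (leqnn p); have := K_lt p; rewrite setIT {pP}/K.
set u' := u k0 + _; set v' := v k0 - _; move: (u') (v') => {}u' {}v' [uu' [uv' vv']] mK.
have [c c0 cP] := branch_distortion uu' uv' vv'.
have [cg cg0 cgP] := gain_constant.
have lT : mass l setT = i1 - i0.
  by rewrite -(l_setJ measurableT) setIT mass_itv// ltW.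
have mT0 : 0 < mass m setT by apply: lt_le_trans mU0 (le_mass m _ _ (@subsetT _ _)).
pose c1 := c * (mass m `[u', v']%classic / S).
have c10 : 0 < c1 by rewrite mulr_gt0// divr_gt0.
have x0 : J ((i0 + i1) / 2) by rewrite /= in_itv/= !midf_lt.
have x0def : defined 0 ((i0 + i1) / 2) by split.
have cyl0 : cyl 0 ((i0 + i1) / 2) = J.
  by apply/seteqP; split => [z []//|z Jz]; split.
have lower (E : set R) : measurable E -> E `<=` U k0 ->
    c1 * mass m setT / (i1 - i0) * mass l E <= mass m E.
  move=> mE EU.
  have h n : c1 * mass l E <= mass l (iter n T @^-1` E).
    have := preimage_distortion uu' vv' c0 cP n x0def mE EU.
    rewrite cyl0 !l_setJ ?add0n; try exact: mTn.
    apply: le_trans; rewrite /c1 -mulrA [_ * mass l E]mulrC mulrA.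
    rewrite ler_wpM2l ?mulr_ge0 ?mass_ge0 ?(ltW c0)//.
    rewrite ler_pdivrMr// mulrC.
    apply: le_trans (mlS (mTn n (measurable_itv _))).
    by rewrite {1}/mass -(inv_iter n (measurable_itv _)).
  have := @occupation_bound _ _ _ l m T E _ mT inv ergodic_marginal lm0 mE h.
  rewrite lT => hh; rewrite mulrAC ler_pdivrMr ?subr_gt0// [leRHS]mulrC.
  by apply: le_trans hh; rewrite le_eqVlt; apply/orP; left; apply/eqP; ring.
set c2 := c1 * mass m setT / (i1 - i0) in lower.
have c20 : 0 < c2 by rewrite divr_gt0 ?subr_gt0// mulr_gt0.
exists (c2 * cg); first exact: mulr_gt0.
move=> E mE.
have mEJ : measurable (J `&` E) by exact: measurableI.
have mTE : measurable (U k0 `&` T @^-1` (J `&` E)) by apply: measurableI => //; exact: mTpre.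
have h1 := cgP k0 (or_introl erefl) _ mEJ (subset_trans (@subIsetl _ J E) full).
have h2 := lower _ mTE (@subIsetl _ _ _).
rewrite -(l_setJ mE) -mulrA; apply: le_trans (ler_wpM2l (ltW c20) h1) _.
apply: le_trans h2 _; rewrite [leRHS]/mass -(inv mE); apply: le_mass => //.
  exact: mTpre.
by move=> x [_ []].
Qed.

(** With [l] bounded by a multiple of [m], the piece gained in two steps has [m]-mass at least [t]
    times that of the current image, which explains the factor [1 + t] and the rank [n.*2]. Initial
    and final lengths of a short interval centred at [x] are then compared. *)
Lemma jacobian_growth : exists2 a : R, 0 < a & exists2 t : R, 0 < t &
  forall n x H, defined n.*2 x -> branch n.*2 (cyl n.*2 x) H ->
    a * (1 + t) ^+ n <= mobius_jac H x.
Proof.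
have [c c0 cP] := marginal_lower_bound.
have [cg cg0 cgP] := gain_constant.
exists (c / S); first exact: divr_gt0.
exists (c * (cg / S)); first by rewrite mulr_gt0 ?divr_gt0.
set t := c * (cg / S); have t0 : 0 < t by rewrite mulr_gt0 ?divr_gt0.
move=> n x H xdef bH.
have [a [b [ab [CE CJ] [dH pf TH] _ HJ]]] := bH.
have xab : a < x < b by have := cyl_refl xdef; rewrite CE /= in_itv.
set A := c / S * (1 + t) ^+ n; have A0 : 0 < A by rewrite mulr_gt0 ?divr_gt0// exprn_gt0// addr_gt0.
have small h : 0 < h -> a <= x - h -> x + h <= b ->
    A * `|denom H (x + h) * denom H (x - h)| <= 1.
  move=> h0 ah hb; have W : x - h < x + h by lra.
  have Wcyl : `]x - h, x + h[ `<=` cyl n.*2 x.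
    by rewrite CE => z; rewrite /= !in_itv/= => /andP[? ?]; apply/andP; split; lra.
  pose V k : set R := iter k T @` `]x - h, x + h[.
  have grow i : (i <= n)%N -> (1 + t) ^+ i * mass m (V 0%N) <= mass m (V i.*2).
    elim: i => [|i IH] ni; first by rewrite expr0 mul1r.
    have i2 : (i.*2.+1 < n.*2)%N by rewrite -doubleS; rewrite leq_double.
    have [E mE [EJ [E1 E2]]] := gain_two xdef W Wcyl cg0 cgP i2.
    have := cP E mE => h1; have := IH (ltnW ni) => h2.
    rewrite exprS -mulrA doubleS.
    apply: le_trans (ler_wpM2l _ h2) _; first by rewrite addr_ge0// ltW.
    apply: le_trans E1; rewrite mulrDl mul1r lerD2l.
    by apply: le_trans h1; rewrite /t -mulrA ler_wpM2l// ltW.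
  have V0 : V 0%N = `]x - h, x + h[%classic.
    by apply/seteqP; split => [y [z zab <-]//|y yab]; exists y.
  have pf' : pole_free H `[x - h, x + h].
    by move=> z; rewrite /= in_itv/= => /andP[? ?]; apply: pf; rewrite /= in_itv/=; lra.
  have [lt im] := mobius_itv dH W pf'.
  have VE : V n.*2 = mobius H @` `]x - h, x + h[.
    apply/seteqP; split => y /= [z zW <-]; exists z => //.
      by rewrite TH//; exact: Wcyl.
    by rewrite TH//; exact: Wcyl.
  have VJ : V n.*2 `<=` J.
    by rewrite VE => y [z zW <-]; apply: HJ; exists z => //; exact: Wcyl.
  have Vlen : mass l (V n.*2) = 2 * h / `|denom H (x + h) * denom H (x - h)|.
    rewrite VE im mass_itv ?(ltW lt)//; last by rewrite -im -VE.
    rewrite maxr_absE minr_absE.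
    have d1 : denom H (x + h) != 0 by apply: pf'; rewrite /= in_itv/= lexx ltW.
    have d2 : denom H (x - h) != 0 by apply: pf'; rewrite /= in_itv/= lexx ltW.
    have e : `|mobius H (x + h) - mobius H (x - h)| = 2 * h / `|denom H (x + h) * denom H (x - h)|.
      rewrite mobius_sub// normrM normfV normrM (det_pm1E dH).1 mul1r.
      rewrite (_ : x + h - (x - h) = 2 * h); last by ring.
      by rewrite gtr0_norm// mulr_gt0.
    by rewrite -e [`|mobius H (x - h) - _|]distrC; field.
  have mV : measurable (V n.*2) by rewrite VE im.
  have := grow n (leqnn _).
  rewrite V0 => /le_trans /(_ (mlS mV)).
  have := cP `]x - h, x + h[%classic (measurable_itv _).
  rewrite mass_itv ?(ltW W)//; last exact: subset_trans Wcyl CJ.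
  rewrite (_ : x + h - (x - h) = 2 * h); last by ring.
  rewrite Vlen => h1 h2.
  have d0 : 0 < `|denom H (x + h) * denom H (x - h)|.
    by rewrite normr_gt0 mulf_neq0// pf'// /= in_itv/= lexx ltW.
  have : (1 + t) ^+ n * (c * (2 * h)) <= S * (2 * h / `|denom H (x + h) * denom H (x - h)|).
    apply: (le_trans _ h2); rewrite ler_wpM2l// exprn_ge0// addr_ge0// ?ltW//.
  rewrite (mulrA S) ler_pdivlMr// => h3.
  have Sh : 0 < S * (2 * h) by rewrite mulr_gt0// mulr_gt0.
  rewrite -(ler_pM2l Sh) mulr1; apply: le_trans h3.
  rewrite le_eqVlt; apply/orP; left; apply/eqP; rewrite /A; field.
  by rewrite gt_eqF.
have dx : denom H x != 0 by apply: pf; rewrite /= in_itv/=; lra.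
rewrite /mobius_jac -(@ler_pM2r _ (denom H x ^+ 2)) ?mulVf ?sqrf_eq0//; last first.
  by rewrite exprn_even_gt0.
rewrite leNgt; apply/negP => big.
(* One explicit [h] replaces a limit: the product of the two denominators is
   [denom H x ^+ 2 - H 1 0 ^+ 2 * h ^+ 2], and [h <= d / k] keeps the correction below the assumed
   excess [d]. *)
pose d := A * denom H x ^+ 2 - 1.
have d0 : 0 < d by rewrite subr_gt0.
pose k := A * H 1 0 ^+ 2 + 1.
have k0' : 0 < k by rewrite ltr_wpDl// mulr_ge0 ?sqr_ge0// ltW.
pose h := Num.min (Num.min (x - a) (b - x)) (Num.min 1 (d / k)).
have h0 : 0 < h by rewrite !lt_min !subr_gt0 ltr01 divr_gt0//=; move: xab => /andP[-> ->].
have [h1 h2] : h <= x - a /\ h <= b - x by rewrite /h !ge_min !lexx !orbT.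
have [h3 h4] : h <= 1 /\ h <= d / k by rewrite /h !ge_min !lexx !orbT.
have := small h h0 ltac:(lra) ltac:(lra).
have -> : denom H (x + h) * denom H (x - h) = denom H x ^+ 2 - H 1 0 ^+ 2 * h ^+ 2.
  by rewrite /denom; ring.
have := ler_norm (denom H x ^+ 2 - H 1 0 ^+ 2 * h ^+ 2).
rewrite -(ler_pM2l A0) => n1 n2; have := le_trans n1 n2; rewrite mulrBr.
have : A * (H 1 0 ^+ 2 * h ^+ 2) < d.
  apply: (@le_lt_trans _ _ (A * H 1 0 ^+ 2 * h)).
    have Ac : 0 <= A * H 1 0 ^+ 2 by rewrite mulr_ge0 ?sqr_ge0// ltW.
    by rewrite mulrA ler_wpM2l// expr2 ger_pMl.
  apply: (@lt_le_trans _ _ (k * h)); first by rewrite ltr_pM2r// /k ltrDl.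
  by rewrite mulrC -ler_pdivlMr.
by rewrite /d; lra.
Qed.

End dynamics.

(** * Planar Moebius maps *)

Section plane.
Context (R : realType).
Implicit Types (M : 'M[R]_2) (p : R * R).
Local Notation lambda := (@lebesgue_measure R).
Local Notation lambda2 := (lambda \x lambda)%E.

(** Tonelli, with a one-dimensional substitution in each variable. *)
Lemma substitution2 (phi w1 psi w2 : R -> R) (f : R * R -> \bar R) :
  measurable_fun setT phi -> measurable_fun setT w1 -> (forall x, 0 <= w1 x) ->
  measurable_fun setT psi -> measurable_fun setT w2 -> (forall x, 0 <= w2 x) ->
  substitution phi w1 -> substitution psi w2 ->
  measurable_fun setT f -> (forall p, (0 <= f p)%E) ->
  (\int[lambda2]_p (f (phi p.1, psi p.2) * (w1 p.1 * w2 p.2)%:E) =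
   \int[lambda2]_p f p)%E.
Proof.
move=> mphi mw1 w10 mpsi mw2 w20 sphi spsi mf f0.
have m1 : measurable_fun setT (fun p : R * R => phi p.1) by exact: measurableT_comp.
have m2 : measurable_fun setT (fun p : R * R => psi p.2) by exact: measurableT_comp.
pose g p := (f (phi p.1, psi p.2) * (w1 p.1 * w2 p.2)%:E)%E.
have mg : measurable_fun setT g.
  apply: emeasurable_funM.
    by apply: (measurableT_comp mf); exact: measurable_fun_pair.
  apply/measurable_EFinP; apply: measurable_funM; exact: measurableT_comp.
have g0 p : (0 <= g p)%E by rewrite mule_ge0// lee_fin mulr_ge0.
apply: etrans (@fubini_tonelli1 _ _ _ _ R lambda lambda g mg g0) _.
apply: etrans (esym (@fubini_tonelli1 _ _ _ _ R lambda lambda f mf f0)); rewrite /fubini_F.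
rewrite -[RHS]sphi; last 2 first.
- exact: measurable_fun_fubini_tonelli_F.
- by move=> x; exact: integral_ge0.
apply: eq_integral => x _.
have mfx y : measurable_fun setT (fun z => f (y, z)) by exact: measurableT_comp.
rewrite -[in RHS]spsi//.
rewrite muleC -ge0_integralZl_EFin//; last first.
- apply: emeasurable_funM; first exact: (measurableT_comp (mfx _)).
  exact/measurable_EFinP.
- by move=> y _; rewrite mule_ge0// lee_fin.
by apply: eq_integral => y _; rewrite /g /= EFinM muleCA.
Qed.

Definition plane_density p := ((1 + p.1 * p.2) ^+ 2)^-1.

Lemma plane_density_ge0 p : 0 <= plane_density p.
Proof. by rewrite invr_ge0 sqr_ge0. Qed.

Lemma measurable_plane_density : measurable_fun setT plane_density.
Proof.
apply: (measurableT_comp (@measurable_inv R)); apply: measurable_funX.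
by apply: measurable_funD => //; exact: measurable_funM.
Qed.

Definition plane_measure : {measure set (measurableTypeR R * measurableTypeR R) -> \bar R} :=
  density_measure lambda2 measurable_plane_density plane_density_ge0.

Lemma mu_planeE A : mu_plane A = plane_measure A.
Proof. by []. Qed.

Lemma mulmx2E (A B : 'M[R]_2) i j : (A *m B) i j = A i 0 * B 0 j + A i 1 * B 1 j.
Proof.
rewrite !mxE !big_ord_recl big_ord0 addr0; congr (_ + A i _ * B _ j); exact/val_inj.
Qed.

Lemma mx2_ext (A B : 'M[R]_2) : A 0 0 = B 0 0 -> A 0 1 = B 0 1 ->
  A 1 0 = B 1 0 -> A 1 1 = B 1 1 -> A = B.
Proof.
move=> e1 e2 e3 e4.
have I2 (k : 'I_2) : k = 0 \/ k = 1.
  by case: k => -[|[|//]] h; [left|right]; exact/val_inj.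
by apply/matrixP => i j; case: (I2 i) => ->; case: (I2 j) => ->.
Qed.

Definition conj_rot M := Rrot R *m M *m invmx (Rrot R).

Lemma conj_rotE M : conj_rot M = mx2 (M 1 1) (- M 1 0) (- M 0 1) (M 0 0).
Proof.
have [n1 n2 n3 n4] := mx2E 0 1 (-1 : R) 0.
have [r1 r2 r3 r4] : [/\ Rrot R 0 0 = 0, Rrot R 0 1 = -1, Rrot R 1 0 = 1 & Rrot R 1 1 = 0].
  by split; rewrite mxE.
have RN : Rrot R *m mx2 0 1 (-1) 0 = 1%:M.
  by apply: mx2_ext; rewrite mulmx2E ?r1 ?r2 ?r3 ?r4 ?n1 ?n2 ?n3 ?n4 mxE /=; ring.
have -> : conj_rot M = Rrot R *m M *m mx2 0 1 (-1) 0.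
  rewrite /conj_rot; congr (_ *m _).
  have /mulmx1_unit[uR _] := RN.
  by rewrite -[LHS]mulmx1 -RN mulKmx.
have [e1 e2 e3 e4] := mx2E (M 1 1) (- M 1 0) (- M 0 1) (M 0 0).
by apply: mx2_ext; rewrite !mulmx2E ?r1 ?r2 ?r3 ?r4 ?n1 ?n2 ?n3 ?n4 ?e1 ?e2 ?e3 ?e4; ring.
Qed.

End plane.

Section planar_mobius_theory.
Context (R : realType).
Implicit Types (M : 'M[R]_2) (p : R * R).
Local Notation lambda := (@lebesgue_measure R).
Local Notation lambda2 := (lambda \x lambda)%E.
Local Notation plane := (@plane_measure R).

Lemma conj_rot_entries M : [/\ conj_rot M 0 0 = M 1 1, conj_rot M 0 1 = - M 1 0,
  conj_rot M 1 0 = - M 0 1 & conj_rot M 1 1 = M 0 0].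
Proof. by rewrite conj_rotE; exact: mx2E. Qed.

Lemma conj_rot_det M : det_pm1 M -> det_pm1 (conj_rot M).
Proof.
rewrite /det_pm1 !det_mx2; have [-> -> -> ->] := conj_rot_entries M.
by rewrite mulrNN [M 1 1 * _]mulrC [M 1 0 * _]mulrC.
Qed.

Lemma planar_mobiusE M p : planar_mobius M p = (mobius M p.1, mobius (conj_rot M) p.2).
Proof. by []. Qed.

Lemma measurable_planar_mobius M : measurable_fun setT (planar_mobius M).
Proof.
by apply: measurable_fun_pair; apply: measurableT_comp => //; exact: measurable_mobius.
Qed.

(** The source of the invariant density: the factor gained by [(1 + x y) ^ -2] is compensated by the
    Jacobians of the two coordinates. *)
Lemma planar_one_add M x y : denom M x != 0 -> denom (conj_rot M) y != 0 ->
  1 + mobius M x * mobius (conj_rot M) y =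
  \det M * (1 + x * y) / (denom M x * denom (conj_rot M) y).
Proof.
rewrite /mobius /denom det_mx2; have [-> -> -> ->] := conj_rot_entries M => x0 y0.
by field; rewrite x0 y0.
Qed.

Lemma det_sqr M : det_pm1 M -> \det M ^+ 2 = 1.
Proof. by case=> ->; rewrite ?sqrrN expr1n. Qed.

Lemma det_neq0 M : det_pm1 M -> \det M != 0.
Proof. by case=> ->; rewrite ?oppr_eq0 oner_eq0. Qed.

Lemma plane_density_mobius M x y : det_pm1 M ->
  denom M x != 0 -> denom (conj_rot M) y != 0 ->
  plane_density (planar_mobius M (x, y)) * (mobius_jac M x * mobius_jac (conj_rot M) y) =
  plane_density (x, y).
Proof.
move=> dM x0 y0; rewrite /plane_density planar_mobiusE /= planar_one_add//.
rewrite /mobius_jac -!invfM; congr (_^-1).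
rewrite expr_div_n exprMn det_sqr// mul1r exprMn; field.
by rewrite x0 y0.
Qed.

(* In the fibre coordinate [y / (1 + x y)] the maps act affinely. *)
Definition fibre_coord p := p.2 / (1 + p.1 * p.2).

(** The slope is, up to sign, the inverse of the derivative of the first coordinate, so expansion on
    the interval is contraction on the fibres. The determinant is its own inverse and can be written
    as a factor. *)
Lemma fibre_coord_mobius M x y : det_pm1 M ->
  denom M x != 0 -> denom (conj_rot M) y != 0 -> 1 + x * y != 0 ->
  fibre_coord (planar_mobius M (x, y)) =
  \det M * (denom M x ^+ 2 * fibre_coord (x, y) - M 1 0 * denom M x).
Proof.
move=> dM x0 y0 xy0; rewrite /fibre_coord planar_mobiusE /= planar_one_add//.
have D0 := det_neq0 dM; have D2 := det_sqr dM.
have -> : mobius (conj_rot M) y = (M 1 1 * y - M 1 0) / denom (conj_rot M) y.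
  by rewrite /mobius -/(denom _ _); have [-> -> _ _] := conj_rot_entries M.
transitivity ((M 1 1 * y - M 1 0) * denom M x / (\det M * (1 + x * y))).
  by field; rewrite xy0 D0 x0 y0.
have -> : (\det M * (1 + x * y))^-1 = \det M / (1 + x * y).
  apply: (@mulfI _ (\det M * (1 + x * y))); first by rewrite mulf_neq0.
  rewrite divff ?mulf_neq0//.
  by rewrite -{1}D2; field.
by rewrite /denom; field.
Qed.

Lemma denom_zero M : det_pm1 M -> exists z, forall x, denom M x = 0 -> x = z.
Proof.
move=> dM; have [c0|c0] := eqVneq (M 1 0) 0.
  exists 0 => x; rewrite /denom c0 mul0r add0r => d0.
  by have [_] := det_pm1E dM; rewrite c0 d0 !mulr0 subr0 eqxx.
exists (- M 1 1 / M 1 0) => x; rewrite /denom => d0.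
by apply: (mulfI c0); rewrite mulrCA divff// mulr1; lra.
Qed.

Lemma lambda2_vertical (E : set R) : measurable E -> lambda E = 0%E ->
  lambda2 (E `*` setT) = 0%E.
Proof. by move=> mE E0; rewrite product_measure1E// [X in (X * _)%E]E0 mul0e. Qed.

Lemma lambda2_horizontal (E : set R) : measurable E -> lambda E = 0%E ->
  lambda2 (setT `*` E) = 0%E.
Proof. by move=> mE E0; rewrite product_measure1E// [X in (_ * X)%E]E0 mule0. Qed.

Lemma plane_measure_null (A : set (R * R)) : measurable A -> lambda2 A = 0%E ->
  plane A = 0%E.
Proof.
move=> mA A0; apply: null_set_integral => //.
by apply/measurable_EFinP/measurable_funTS; exact: measurable_plane_density.
Qed.

(** The density is positive off the locus [1 + x y = 0] but takes the default value 0 on it. *)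
Lemma plane_measure_null_inv (A : set (R * R)) : measurable A ->
  (forall p, A p -> 1 + p.1 * p.2 != 0) -> plane A = 0%E -> lambda2 A = 0%E.
Proof.
move=> mA A1 A0.
have mk : measurable_fun A (EFin \o @plane_density R).
  by apply/measurable_EFinP/measurable_funTS; exact: measurable_plane_density.
have I0 : (\int[lambda2]_(p in A) `|(EFin \o @plane_density R) p| = 0)%E.
  by rewrite -[RHS]A0; apply: eq_integral => p _ /=; rewrite ger0_norm ?plane_density_ge0.
have [N [mN N0 sN]] := (ae_eq_integral_abs lambda2 mA mk).1 I0.
apply: (negligibleP lambda2 mA).1; exists N; split => // p Ap; apply: sN => /= /(_ Ap) [] /eqP.
by rewrite /plane_density invr_eq0 sqrf_eq0 (negbTE (A1 _ Ap)).
Qed.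

(** The density identity holds off one vertical and one horizontal line, through the poles of the
    two coordinate maps, and these lines are null. *)
Lemma plane_measure_preimage M (A : set (R * R)) : det_pm1 M -> measurable A ->
  plane (planar_mobius M @^-1` A) = plane A.
Proof.
move=> dM mA; have dN := conj_rot_det dM.
have mk := @measurable_plane_density R.
have mPA : measurable (planar_mobius M @^-1` A).
  by rewrite -[X in measurable X]setTI; exact: measurable_planar_mobius.
pose f p := ((\1_A p)%:E * (plane_density p)%:E)%E.
have f0 p : (0 <= f p)%E by rewrite mule_ge0// lee_fin ?plane_density_ge0.
have mf : measurable_fun setT f.
  apply: emeasurable_funM; apply/measurable_EFinP => //; exact: measurable_indic.
have indE (B : set (R * R)) : measurable B ->
    plane B = (\int[lambda2]_p ((\1_B p)%:E * (plane_density p)%:E))%E.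
  move=> mB; rewrite [LHS]integral_mkcond; apply: eq_integral => p _.
  by rewrite patchE indicE; case: ifPn => _; rewrite ?mul1e ?mul0e.
rewrite (indE _ mA) (indE _ mPA) -/f.
rewrite -(@substitution2 _ (mobius M) (mobius_jac M) (mobius (conj_rot M)) (mobius_jac (conj_rot M)) f)//;
  try exact: measurable_mobius; try exact: measurable_mobius_jac;
  try exact: mobius_jac_ge0; try exact: substitution_mobius.
have [zM zMP] := denom_zero dM; have [zN zNP] := denom_zero dN.
apply: ge0_ae_eq_integral => //.
- apply: emeasurable_funM; apply/measurable_EFinP => //; exact: measurable_indic.
- apply: emeasurable_funM.
    exact: (measurableT_comp mf (measurable_planar_mobius M)).
  apply/measurable_EFinP; apply: measurable_funM; apply: measurableT_comp => //;
    exact: measurable_mobius_jac.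
- by move=> p _; rewrite mule_ge0// lee_fin ?plane_density_ge0.
- by move=> p _; rewrite mule_ge0// lee_fin mulr_ge0 ?mobius_jac_ge0.
- exists (([set zM] `*` setT) `|` (setT `*` [set zN])); split.
  + by apply: measurableU; exact: measurableX.
  + rewrite measureU0//; try exact: measurableX.
    * by apply: lambda2_vertical => //; exact: lebesgue_measure_set1.
    * by apply: lambda2_horizontal => //; exact: lebesgue_measure_set1.
  + move=> [x y] /= /not_implyP[_ ne].
    have [/zMP ->|x0] := eqVneq (denom M x) 0; first by left.
    have [/zNP ->|y0] := eqVneq (denom (conj_rot M) y) 0; first by right.
    by case: ne; rewrite /f /= -(plane_density_mobius dM x0 y0) -muleA -EFinM.
Qed.

End planar_mobius_theory.

(** * Piecewise Moebius maps as interval systems *)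

Section intervals.
Context (R : realType).
Implicit Types X : set R.
Local Notation lambda := (@lebesgue_measure R).

Lemma interval_measurable X : is_interval X -> measurable X.
Proof. by move=> iX; rewrite -(RhullK (mem_set iX)); exact: measurable_itv. Qed.

(** An interval unbounded on one side contains intervals of every integer length. *)
Lemma finite_interval_bounded X : is_interval X -> (lambda X < +oo)%E -> X !=set0 ->
  has_lbound X /\ has_ubound X.
Proof.
move=> iX fX [x0 Xx0].
have mX := interval_measurable iX.
have big (f : nat -> R) : (forall n : nat, exists a b, `]a, b[ `<=` X /\ b - a = n%:R) -> False.
  move=> h; have fin : lambda X \is a fin_num by rewrite ge0_fin_numE.
  have [a [b [abX ab]]] := h (Num.truncn (fine (lambda X))).+1.
  have : (lambda `]a, b[%classic <= lambda X)%E by apply: le_measure; rewrite ?inE.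
  rewrite lebesgue_measure_itv/= lte_fin -subr_gt0 ab ltr0n/= -EFinB ab.
  by rewrite -(fineK fin) lee_fin leNgt truncnS_gt.
split; apply: contrapT => nb; apply: (big (fun=> 0)) => n.
- exists (x0 - n%:R), x0; split; last by rewrite opprB addrC subrK.
  move=> z; rewrite /= in_itv/= => /andP[z1 z2].
  have [y Xy yz] : exists2 y, X y & y <= z.
    apply: contrapT => no; apply: nb; exists z => y Xy.
    by rewrite leNgt; apply/negP => yz; apply: no; exists y => //; exact: ltW.
  by apply: (iX y x0) => //; rewrite yz ltW.
- exists x0, (x0 + n%:R); split; last by rewrite addrAC subrr add0r.
  move=> z; rewrite /= in_itv/= => /andP[z1 z2].
  have [y Xy yz] : exists2 y, X y & z <= y.
    apply: contrapT => no; apply: nb; exists z => y Xy.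
    by rewrite leNgt; apply/negP => yz; apply: no; exists y => //; exact: ltW.
  by apply: (iX x0 y) => //; rewrite yz ltW.
Qed.

Lemma interior_itvE X : is_interval X -> has_lbound X -> has_ubound X ->
  X° = `]inf X, sup X[%classic.
Proof.
by move=> iX lX uX; rewrite interval_bounded_interior//; apply/seteqP; split => x /=; rewrite in_itv.
Qed.

Lemma interval_sub_closed X x : has_lbound X -> has_ubound X -> X x -> inf X <= x <= sup X.
Proof. by move=> lX uX Xx; rewrite ge_inf//= ub_le_sup. Qed.

Lemma interval_boundary X x : is_interval X -> has_lbound X -> has_ubound X ->
  X x -> ~ X° x -> x = inf X \/ x = sup X.
Proof.
move=> iX lX uX Xx; rewrite interior_itvE//= in_itv/=.
have /andP[] := interval_sub_closed lX uX Xx.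
by rewrite le_eqVlt => /predU1P[<-|->]; [left|rewrite le_eqVlt => /predU1P[->|->]; [right|]].
Qed.

End intervals.

Section reindexing.
Context (R : realType).
Variables (I : set R) (T : R -> R) (B : Type) (K : B -> set R) (M : B -> 'M[R]_2).
Hypothesis hT : piecewise_mobius I T K M.
Hypothesis lbI : has_lbound I.
Hypothesis ubI : has_ubound I.

Let lbK b : has_lbound (K b).
Proof. by case: lbI => y yP; exists y => x /(pm_sub hT)/yP. Qed.

Let ubK b : has_ubound (K b).
Proof. by case: ubI => y yP; exists y => x /(pm_sub hT)/yP. Qed.

Lemma interior_cylinder b : (K b)° = `]inf (K b), sup (K b)[%classic.
Proof. by apply: interior_itvE => //; exact: (pm_interval hT). Qed.

Lemma cylinder_inj b b' x : K b x -> K b' x -> b = b'.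
Proof.
move=> bx b'x; have := pm_disjoint hT; rewrite /trivIset => h.
by apply: h => //; exists x.
Qed.

(** Each cylinder has a rational point in its interior, and cylinders are disjoint. *)
Lemma cylinder_code : exists code : B -> nat, injective code.
Proof.
have q b : {q : rat | (K b)° (ratr q)}.
  apply/cid; have [x] := pm_nondegenerate hT b; rewrite interior_cylinder /= in_itv/=.
  move=> /andP[h1 h2]; have [q] := rat_in_itvoo (lt_trans h1 h2).
  move=> qI; exists q; have : `]inf (K b), sup (K b)[%classic (ratr q) by [].
  by rewrite -interior_cylinder.
exists (fun b => pickle (sval (q b))) => b b' /(pcan_inj pickleK) e.
have := svalP (q b); rewrite e => /interior_subset h1.
by have /interior_subset h2 := svalP (q b'); exact: cylinder_inj h1 h2.
Qed.

Let code : B -> nat := sval (cid cylinder_code).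

Let code_inj : injective code.
Proof. exact: svalP (cid cylinder_code). Qed.

(* Cylinders are numbered through [code]; the unused numbers get empty sets. *)
Definition cyl_set n : set R :=
  if pselect (exists b, code b = n) is left h then K (projT1 (cid h)) else set0.

Definition cyl_left n : R :=
  if pselect (exists b, code b = n) is left h then inf (K (projT1 (cid h))) else 0.

Definition cyl_right n : R :=
  if pselect (exists b, code b = n) is left h then sup (K (projT1 (cid h))) else 0.

Definition cyl_mx n : 'M[R]_2 :=
  if pselect (exists b, code b = n) is left h then M (projT1 (cid h)) else 1%:M.

Lemma cyl_codeE b : [/\ cyl_set (code b) = K b, cyl_left (code b) = inf (K b),
  cyl_right (code b) = sup (K b) & cyl_mx (code b) = M b].
Proof.
rewrite /cyl_set /cyl_left /cyl_right /cyl_mx; case: pselect => [h|]; last by case; exists b.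
by have /code_inj -> := projT2 (cid h).
Qed.

Lemma cyl_cases n : (exists b, [/\ n = code b, cyl_set n = K b, cyl_left n = inf (K b),
    cyl_right n = sup (K b) & cyl_mx n = M b]) \/
  [/\ cyl_set n = set0, cyl_left n = 0, cyl_right n = 0 & cyl_mx n = 1%:M].
Proof.
have [[b <-]|no] := pselect (exists b, code b = n).
  by left; exists b; have [-> -> -> ->] := cyl_codeE b.
by right; rewrite /cyl_set /cyl_left /cyl_right /cyl_mx; case: pselect.
Qed.

Lemma cyl_index b : exists n, [/\ cyl_set n = K b, cyl_left n = inf (K b),
  cyl_right n = sup (K b) & cyl_mx n = M b].
Proof. by exists (code b); exact: cyl_codeE. Qed.

Local Notation u := cyl_left.
Local Notation v := cyl_right.
Local Notation G := cyl_mx.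

Lemma cyl_interior n x : u n < x < v n -> cyl_set n x.
Proof.
have [[b [_ -> -> -> _]]|[_ -> -> _]] := cyl_cases n.
  by move=> h; apply: interior_subset; rewrite interior_cylinder /= in_itv.
by move=> /andP[h1 h2]; have := lt_trans h1 h2; rewrite ltxx.
Qed.

Lemma cyl_set_disjoint n n' x : cyl_set n x -> cyl_set n' x -> n = n'.
Proof.
have [[b [-> -> _ _ _]]|[-> //]] := cyl_cases n.
have [[b' [-> -> _ _ _]]|[-> //]] := cyl_cases n'.
by move=> h1 h2; rewrite (cylinder_inj h1 h2).
Qed.

Lemma cyl_mx_det n : det_pm1 (G n).
Proof.
have [[b [_ _ _ _ ->]]|[_ _ _ ->]] := cyl_cases n; first exact: (pm_det hT).
by rewrite /det_pm1 det1; left.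
Qed.

Lemma cyl_set_sub n : cyl_set n `<=` I.
Proof.
have [[b [_ e _ _ _]]|[e _ _ _]] := cyl_cases n; rewrite e//.
by move=> x; exact: (pm_sub hT).
Qed.

Lemma cyl_set_mobius n x : cyl_set n x -> denom (G n) x != 0 /\ T x = mobius (G n) x.
Proof.
have [[b [_ -> _ _ ->]]|[-> //]] := cyl_cases n.
by move=> Kx; have := pm_mobius hT Kx.
Qed.

Lemma measurable_cyl_set n : measurable (cyl_set n).
Proof.
have [[b [_ e _ _ _]]|[e _ _ _]] := cyl_cases n; rewrite e; last exact: measurable0.
exact: interval_measurable (pm_interval hT (b := b)).
Qed.

Lemma cyl_set_boundary n x : cyl_set n x -> u n < x < v n \/ x = u n \/ x = v n.
Proof.
have [[b [_ -> -> -> _]]|[-> //]] := cyl_cases n => Kx.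
have [h|h] := pselect ((K b)° x); first by left; move: h; rewrite interior_cylinder /= in_itv.
by right; apply: interval_boundary => //; exact: (pm_interval hT).
Qed.

Lemma planar_map_cyl n p : cyl_set n p.1 -> planar_map T K M p = planar_mobius (G n) p.
Proof.
have [[b [_ -> _ _ ->]]|[-> //]] := cyl_cases n => Kp.
rewrite /planar_map; case: pselect => [h|]; last by case; exists b.
by congr (planar_mobius (M _) _); apply: cylinder_inj Kp; exact: (projT2 (cid h)).
Qed.

Lemma planar_map_fst p : (planar_map T K M p).1 = T p.1.
Proof.
rewrite /planar_map; case: pselect => //= h.
by have [_ ->] := pm_mobius hT (projT2 (cid h)).
Qed.

Lemma planar_map_out p : (forall n, ~ cyl_set n p.1) -> planar_map T K M p = (T p.1, p.2).
Proof.
move=> no; rewrite /planar_map; case: pselect => // -[b Kb].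
by have [n [e _ _ _]] := cyl_index b; case: (no n); rewrite e.
Qed.

(** Passing to open cylinders loses at most countably many endpoints. *)
Lemma cyl_cover : (@lebesgue_measure R).-negligible (I `\` \bigcup_n `]u n, v n[%classic).
Proof.
have [N [mN N0 sN]] := pm_cover hT.
exists (N `|` \bigcup_n ([set u n] `|` [set v n])); split.
- by apply: measurableU => //; apply: bigcup_measurable => n _; exact: measurableU.
- apply: (negligibleP lebesgue_measure _).1.
    by apply: measurableU => //; apply: bigcup_measurable => n _; exact: measurableU.
  apply: negligibleU; first by exists N; split.
  apply: negligible_bigcup => n; apply: negligibleU.
    by exists [set u n]; split => //; exact: lebesgue_measure_set1.
  by exists [set v n]; split => //; exact: lebesgue_measure_set1.
- move=> x [Ix nx]; have [[b _ Kx]|no] := pselect ((\bigcup_b K b) x); last by left; apply: sN.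
  right; have [n [e _ _ _]] := cyl_index b; exists n => //.
  have : cyl_set n x by rewrite e.
  move=> /cyl_set_boundary[h|[->|->]]; [|by left|by right].
  by case: nx; exists n => //; rewrite /= in_itv.
Qed.

End reindexing.

Lemma mobius_continuous (R : realType) (M : 'M[R]_2) (x : R) : denom M x != 0 ->
  mobius M y @[y --> x] --> mobius M x.
Proof.
move=> x0; apply: (@cvgM _ _ _ _ (fun x => M 0 0 * x + M 0 1) (fun x => (denom M x)^-1)).
  by apply: cvgD; [apply: cvgM; [exact: cvg_cst|exact: cvg_id]|exact: cvg_cst].
apply: cvgV => //.
by apply: cvgD; [apply: cvgM; [exact: cvg_cst|exact: cvg_id]|exact: cvg_cst].
Qed.

(** * From the piecewise Moebius map to an interval system *)

Section extraction.
Context (R : realType).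
Variables (I : set R) (T : R -> R) (B : Type) (K : B -> set R) (M : B -> 'M[R]_2).
Hypothesis hT : piecewise_mobius I T K M.
Hypothesis lbI : has_lbound I.
Hypothesis ubI : has_ubound I.
Hypothesis I0 : I° !=set0.
Hypothesis hd : bounded_nonfull_range I T K.
Local Notation lambda := (@lebesgue_measure R).
Local Notation u := (cyl_left hT lbI ubI).
Local Notation v := (cyl_right hT lbI ubI).
Local Notation G := (cyl_mx hT lbI ubI).
Local Notation X := (cyl_set hT lbI ubI).
Local Notation U n := (`]u n, v n[%classic).
Local Notation J := (`]inf I, sup I[%classic).

Lemma interior_domain : I° = J.
Proof. by apply: interior_itvE => //; exact: (pm_dom hT). Qed.

Lemma domain_lt : inf I < sup I.
Proof.
have [x] := I0; rewrite interior_domain /= in_itv/= => /andP[]; exact: lt_trans.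
Qed.

Let UX n : U n `<=` X n.
Proof. by move=> x; rewrite /= in_itv/=; exact: cyl_interior. Qed.

Lemma cylinder_sub_domain n : U n `<=` J.
Proof.
have UI : U n `<=` I by move=> x /UX; exact: cyl_set_sub.
rewrite -interior_domain => x Ux; rewrite /interior /=.
apply: filterS UI _; apply: open_nbhs_nbhs; split => //; exact: interval_open.
Qed.

(** A total measurable map preserving both [I] and its complement, so that preimages can be taken on
    the whole line. *)
Definition extension x := if x \in I then T x else x.

Lemma extensionE x : I x -> extension x = T x.
Proof. by move=> Ix; rewrite /extension mem_set. Qed.

Lemma extension_dom x : I x -> I (extension x).
Proof. by move=> Ix; rewrite extensionE//; exact: (pm_self hT). Qed.

Lemma iter_extension n x : I x -> iter n extension x = iter n T x /\ I (iter n T x).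
Proof.
move=> Ix; elim: n => [//|n [IH In]] /=; rewrite IH extensionE//; split => //.
exact: (pm_self hT).
Qed.

Lemma measurable_domain : measurable I.
Proof. exact: interval_measurable (pm_dom hT). Qed.

Lemma measurable_extension : measurable_fun setT extension.
Proof.
have mI := measurable_domain.
rewrite -(setUv I); apply/measurable_funU => //; first exact: measurableC.
split.
  apply: (eq_measurable_fun T); last exact: (pm_borel hT).
  by move=> x; rewrite inE => Ix; rewrite extensionE.
apply: (eq_measurable_fun id); last exact: measurable_id.
by move=> x; rewrite inE /extension => nI; rewrite memNset.
Qed.

(** The set [Q] of the interval system. Images of full cylinders end at the ends of [I]; all other
    ends come from orbits that condition (d) keeps out of its full cylinder. *)
Definition image_ends : set R := [set e | e = inf I \/ e = sup I \/
  exists b, ~ full_cylinder I T (K b) /\ endpoint_orbit T (K b) e].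

Lemma pole_free_cyl n : u n < v n -> pole_free (G n) `[u n, v n].
Proof.
move=> uv; apply: (@pole_free_closed_itv _ _ _ _ (Num.max `|inf I| `|sup I|)) => //.
- exact: cyl_mx_det.
- by move=> x /UX Xx; have [] := cyl_set_mobius Xx.
- move=> x xuv; have Ux : U n x by rewrite /= in_itv.
  have Xx := UX Ux; rewrite -(cyl_set_mobius Xx).2.
  have /andP[t1 t2] := interval_sub_closed lbI ubI (pm_self hT (cyl_set_sub Xx)).
  rewrite ler_norml le_max; have := ler_norm (- inf I); have := ler_norm (sup I); rewrite normrN.
  move=> n1 n0; apply/andP; split; last by rewrite (le_trans t2 n1) orbT.
  by rewrite lerNl le_max; apply/orP; left; apply: le_trans n0; rewrite lerN2.
Qed.

(** Fullness holds up to a null set only, but the image is an interval between the two end values.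
    If these were not the ends of [I], the image would miss an interval of positive length or leave
    the closure of [I]. *)
Lemma full_image b n : cyl_set hT lbI ubI n = K b -> u n < v n -> full_cylinder I T (K b) ->
  Num.min (mobius (G n) (u n)) (mobius (G n) (v n)) = inf I /\
  Num.max (mobius (G n) (u n)) (mobius (G n) (v n)) = sup I.
Proof.
move=> Kn uv fb.
have [lt im] := mobius_itv (cyl_mx_det hT lbI ubI n) uv (pole_free_cyl uv).
have ends : Num.min (mobius (G n) (u n)) (mobius (G n) (v n)) <= mobius (G n) (u n) <=
      Num.max (mobius (G n) (u n)) (mobius (G n) (v n)) /\
    Num.min (mobius (G n) (u n)) (mobius (G n) (v n)) <= mobius (G n) (v n) <=
      Num.max (mobius (G n) (u n)) (mobius (G n) (v n)).
  by rewrite !ge_min !le_max !lexx !orbT.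
move: ends; set al := Num.min _ _ in lt im *; set be := Num.max _ _ in lt im * => -[e1 e2].
have imI y : al < y < be -> inf I <= y <= sup I.
  move=> yab; have : (mobius (G n) @` U n) y by rewrite im /= in_itv.
  move=> [x Ux <-]; have Xx := UX Ux; rewrite -(cyl_set_mobius Xx).2.
  exact: interval_sub_closed (pm_self hT (cyl_set_sub Xx)).
have imK y : (T @` K b) y -> al <= y <= be.
  rewrite -Kn => -[x Xx <-]; rewrite (cyl_set_mobius Xx).2.
  have [xuv|[->|->]//] := cyl_set_boundary Xx.
  have : (mobius (G n) @` U n) (mobius (G n) x) by exists x; rewrite //= in_itv.
  by rewrite im /= in_itv/= => /andP[? ?]; rewrite !ltW.
have null p q : p < q -> inf I <= p -> q <= sup I -> (forall y, p < y < q -> ~ (al <= y <= be)) -> False.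
  move=> pq ip qs no; have : lambda.-negligible `]p, q[%classic.
    apply: negligibleS fb => y; rewrite /= in_itv/= => pyq; split.
      apply: interior_subset; rewrite interior_domain /= in_itv/=.
      by move: pyq => /andP[? ?]; apply/andP; split; lra.
    by move=> /imK; exact: no.
  move=> /(negligibleP lambda (measurable_itv _)) l0.
  have : lambda `]p, q[%classic = 0%E by exact: l0.
  rewrite lebesgue_measure_itv/= lte_fin pq => -[].
  by apply/eqP; rewrite subr_eq0 gt_eqF.
split; apply/eqP; rewrite eq_le; apply/andP; split; rewrite leNgt; apply/negP => h.
- apply: (null (inf I) (Num.min al (sup I))); rewrite ?lexx ?ge_min ?lexx ?orbT//.
    by rewrite lt_min h domain_lt.
  by move=> y /andP[_]; rewrite lt_min => /andP[ya _] /andP[]; rewrite leNgt ya.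
- have [w [aw wb wi]] : exists w, [/\ al < w, w <= be & w <= inf I].
    by exists (Num.min be (inf I)); rewrite lt_min lt h !ge_min !lexx orbT.
  have /imI : al < (al + w) / 2 < be by rewrite !midf_lt//= (lt_le_trans _ wb)// midf_lt.
  by move=> /andP[iw _]; have := le_lt_trans iw (lt_le_trans (midf_lt aw).2 wi); rewrite ltxx.
- have [w [aw wb wi]] : exists w, [/\ w < be, al <= w & sup I <= w].
    by exists (Num.max al (sup I)); rewrite gt_max lt h !le_max !lexx orbT.
  have /imI : al < (w + be) / 2 < be by rewrite !midf_lt//= (le_lt_trans wb)// midf_lt.
  by move=> /andP[_ iw]; have := lt_le_trans (le_lt_trans wi (midf_lt aw).1) iw; rewrite ltxx.
- apply: (null (Num.max be (inf I)) (sup I)); rewrite ?lexx ?le_max ?lexx ?orbT//.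
    by rewrite gt_max h domain_lt.
  by move=> y /andP[+ _]; rewrite gt_max => /andP[ya _] /andP[_]; rewrite leNgt ya.
Qed.

Lemma endpoint_orbit_step b n e e' : (e = inf (K b) \/ e = sup (K b)) ->
  iter n T x @[x --> within (K b)° (nbhs e)] --> e' ->
  forall H, denom H e' != 0 ->
  (\forall x \near within (K b)° (nbhs e), T (iter n T x) = mobius H (iter n T x)) ->
  endpoint_orbit T (K b) (mobius H e').
Proof.
move=> eK lim H H0 nr; exists e, n.+1; split => //.
have h : mobius H (iter n T x) @[x --> within (K b)° (nbhs e)] --> mobius H e'.
  exact: cvg_comp lim (mobius_continuous H0).
apply: cvg_trans h; apply: near_eq_cvg.
by apply: filterS nr => x /= ->.
Qed.

Lemma extraction : mobius_system (inf I) (sup I) extension u v G image_ends.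
Proof.
split.
- exact: domain_lt.
- exact: cylinder_sub_domain.
- by move=> i j x /UX Xi /UX Xj; exact: cyl_set_disjoint Xi Xj.
- exact: cyl_mx_det.
- move=> n x /UX Xx; rewrite extensionE; first exact: cyl_set_mobius.
  exact: cyl_set_sub Xx.
- move=> n x /UX Xx; apply: interval_sub_closed => //; apply: extension_dom.
  exact: cyl_set_sub Xx.
- by split; [left|right; left].
- move=> n uv.
  have [[b [_ Kn un vn Gn]]|[_ un vn _]] := cyl_cases hT lbI ubI n; last first.
    by move: uv; rewrite un vn ltxx.
  have [fb|nfb] := pselect (full_cylinder I T (K b)).
    have [e1 e2] := full_image Kn uv fb; move: e1 e2.
    by case: leP => _ e1 e2; split; rewrite ?e1 ?e2; try (by left); right; left.
  have pf := pole_free_cyl uv.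
  have near (e : R) : \forall x \near within (K b)° (nbhs e), T (iter 0 T x) = mobius (G n) (iter 0 T x).
    suff : nbhs e [set x | (K b)° x -> T (iter 0 T x) = mobius (G n) (iter 0 T x)] by [].
    apply: filterE => x /interior_subset; rewrite -Kn => Xx /=.
    exact: (cyl_set_mobius Xx).2.
  split; right; right; exists b; split => //.
    apply: (@endpoint_orbit_step b 0 (u n)) => //; first by left.
    - by apply: cvg_within_filter; exact: cvg_id.
    - by apply: pf; rewrite /= in_itv/= lexx ltW.
  apply: (@endpoint_orbit_step b 0 (v n)) => //; first by right.
  - by apply: cvg_within_filter; exact: cvg_id.
  - by apply: pf; rewrite /= in_itv/= lexx ltW.
- move=> n e Qe Ue; have := cylinder_sub_domain Ue; rewrite /= in_itv/= => /andP[ie es].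
  have [e1|[e1|[b [nfb [e0 [k [e0K lim]]]]]]] := Qe.
  - by rewrite e1 ltxx in ie.
  - by rewrite e1 ltxx in es.
  right; right; exists b; split => //.
  apply: (endpoint_orbit_step e0K lim); first by have [] := cyl_set_mobius (UX Ue).
  (* A limit inside the open [U n] is approached through [U n], where [T] is the map of [G n], so
     the orbit can be continued by one step. *)
  have hU : nbhs e (U n) by apply: open_nbhs_nbhs; split => //; exact: interval_open.
  have nU : nbhs (e0 : R) [set x | (K b)° x -> U n (iter k T x)] := lim _ hU.
  have : nbhs (e0 : R) [set x | (K b)° x -> T (iter k T x) = mobius (G n) (iter k T x)].
    by apply: filterS nU => x h /h /UX Xx; exact: (cyl_set_mobius Xx).2.
  by [].
Qed.

End extraction.

(** * Planar extensions *)

Section finite_pushforward.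
Context d d' (X : measurableType d) (Y : measurableType d') (R : realType).
Variables (m : {finite_measure set X -> \bar R}) (f : X -> Y).

Definition finite_pushforward of measurable_fun setT f := fun A : set Y => m (f @^-1` A).

Hypothesis mf : measurable_fun setT f.
Local Notation nu := (finite_pushforward mf).

Let mpre (A : set Y) : measurable A -> measurable (f @^-1` A).
Proof. by move=> mA; rewrite -[X in measurable X]setTI; exact: mf. Qed.

Let nu0 : nu set0 = 0%E.
Proof. by rewrite /finite_pushforward preimage_set0 measure0. Qed.

Let nu_ge0 A : (0 <= nu A)%E.
Proof. exact: measure_ge0. Qed.

Let nu_sigma_additive : semi_sigma_additive nu.
Proof.
move=> F mF tF mUF; rewrite /finite_pushforward preimage_bigcup.
apply: measure_semi_sigma_additive.
- by move=> n; exact: mpre.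
- by apply/trivIsetP => i j _ _ ij; rewrite -preimage_setI (trivIsetP.1 tF).
- by rewrite -preimage_bigcup; exact: mpre.
Qed.

HB.instance Definition _ := isMeasure.Build _ _ _ nu nu0 nu_ge0 nu_sigma_additive.

Let nu_fin : fin_num_fun nu.
Proof. by move=> A mA; apply: fin_num_measure; exact: mpre. Qed.

HB.instance Definition _ := Measure_isFinite.Build _ _ _ nu nu_fin.

End finite_pushforward.

(** * Fibres, distance to the locus, and measures of vertical strips *)

Section planar_domain.
Context (R : realType).
Variables (I : set R) (Omega : set (R * R)).
Local Notation lambda := (@lebesgue_measure R).
Local Notation lambda2 := (lambda \x lambda)%E.
Local Notation plane := (@plane_measure R).
Hypothesis mI : measurable I.
Hypothesis mO : measurable Omega.
Hypothesis proj : fst @` Omega = I.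
Hypothesis ha : fibers_bounded_measure I Omega.
Hypothesis hb : away_from_locus Omega.

(** Comparison with the points of the locus of the same abscissa or the same ordinate bounds
    [|1 + x y|] below by [e * |x|] and by [e * |y|]. Were it below both 1/2 and [e / 2], both
    coordinates would be below 1/2 in absolute value and [|x y|] could not exceed 1/2. *)
Lemma away_bound : exists2 d : R, 0 < d & forall p, Omega p ->
  d <= `|1 + p.1 * p.2| /\ `|fibre_coord p| <= d^-1.
Proof.
have [e e0 eP] := hb.
have key p : Omega p -> e * `|p.1| <= `|1 + p.1 * p.2| /\ e * `|p.2| <= `|1 + p.1 * p.2|.
  move: p => [x y] /= Oxy; split.
    have [->|x0] := eqVneq x 0; first by rewrite normr0 mulr0.
    have := eP _ Oxy _ x0; rewrite prod_normE /= subrr normr0 max_r// opprK => h.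
    have -> : 1 + x * y = (y + x^-1) * x by rewrite mulrDl mulVf// addrC mulrC.
    by rewrite normrM ler_wpM2r.
  have [->|y0] := eqVneq y 0; first by rewrite normr0 mulr0.
  have y1 : - y^-1 != 0 by rewrite oppr_eq0 invr_eq0.
  have := eP _ Oxy _ y1; rewrite prod_normE /= invrN invrK !opprK subrr normr0 max_l// => h.
  have -> : 1 + x * y = (x + y^-1) * y by rewrite mulrDl mulVf// addrC.
  by rewrite normrM ler_wpM2r.
have d0 : 0 < Num.min 2^-1 (e / 2) by rewrite lt_min invr_gt0 ltr0n divr_gt0.
exists (Num.min 2^-1 (e / 2)) => // p Op; have [h1 h2] := key p Op.
have lb : Num.min 2^-1 (e / 2) <= `|1 + p.1 * p.2|.
  rewrite leNgt lt_min; apply/negP => /andP[z1 z2].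
  have xy : 2^-1 < `|p.1| * `|p.2|.
    have : `|1 + p.1 * p.2 - p.1 * p.2| <= `|1 + p.1 * p.2| + `|p.1 * p.2| by exact: ler_normB.
    by rewrite addrK normr1 normrM => h; lra.
  have a1 : `|p.1| < 2^-1 by rewrite -(ltr_pM2l e0); lra.
  have a2 : `|p.2| < 2^-1 by rewrite -(ltr_pM2l e0); lra.
  have : `|p.1| * `|p.2| <= 2^-1 * 2^-1 by apply: ler_pM => //; exact: ltW.
  lra.
split => //; have z0 : 0 < `|1 + p.1 * p.2| by exact: lt_le_trans lb.
rewrite /fibre_coord normrM normfV ler_pdivrMr//.
have : e * `|p.2| <= e * (e^-1 * `|1 + p.1 * p.2|) by rewrite mulrA divff ?gt_eqF// mul1r.
rewrite ler_pM2l// => h; apply: le_trans h _; rewrite ler_wpM2r// lef_pV2//.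
by rewrite ge_min (_ : e / 2 <= e) ?orbT//; lra.
Qed.

Lemma one_add_neq0 p : Omega p -> 1 + p.1 * p.2 != 0.
Proof.
have [d d0 dP] := away_bound; move=> /dP[h _]; rewrite -normr_gt0; exact: lt_le_trans h.
Qed.

Lemma strip_xsection (E : set R) x :
  xsection (Omega `&` E `*` setT) x = if x \in E `&` I then xsection Omega x else set0.
Proof.
apply/seteqP; split => y.
  rewrite /xsection /= => /set_mem[Oxy [Ex _]].
  by rewrite mem_set/=; [exact: mem_set|split => //; rewrite -proj; exists (x, y)].
by case: ifPn => // /set_mem[Ex Ix] /set_mem Oxy; apply: mem_set.
Qed.

Lemma measurable_strip (E : set R) : measurable E -> measurable (Omega `&` E `*` setT).
Proof. by move=> mE; apply: measurableI => //; exact: measurableX. Qed.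

Lemma lambda2_strip : exists c : R, exists C : R, [/\ 0 < c, 0 < C & forall E : set R, measurable E ->
  (c%:E * lambda (E `&` I) <= lambda2 (Omega `&` E `*` setT))%E /\
  (lambda2 (Omega `&` E `*` setT) <= C%:E * lambda (E `&` I))%E].
Proof.
have [c [C [c0 cC]]] := ha.
(* [C] is only an upper bound for the fibres, and the maximum with 1 makes it positive. *)
exists c, (Num.max C 1); split => // [|E mE]; first by rewrite lt_max ltr01 orbT.
have mEI : measurable (E `&` I) by exact: measurableI.
have cst r : 0 <= r -> (r%:E * lambda (E `&` I) = \int[lambda]_x (r * \1_(E `&` I) x)%:E)%E.
  move=> r0; rewrite -[in LHS](setIT (E `&` I)) -integral_indic//.
  under [RHS]eq_integral do rewrite EFinM.
  rewrite ge0_integralZl_EFin//.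
  by apply/measurable_EFinP; exact: measurable_indic.
have xE : lambda2 (Omega `&` E `*` setT) =
  (\int[lambda]_x lambda (xsection (Omega `&` E `*` setT) x))%E by [].
rewrite xE; have C1 : 0 <= Num.max C 1 by rewrite le_max ler01 orbT.
split.
  rewrite (cst _ (ltW c0)); apply: ge0_le_integral => //.
  - by move=> x _; rewrite lee_fin; apply: mulr_ge0 => //; exact: ltW.
  - by apply/measurable_EFinP; apply: measurable_funM => //; exact: measurable_indic.
  - by apply: measurable_fun_xsection; exact: measurable_strip.
  - move=> x _ /=; rewrite strip_xsection indicE; case: ifPn => [/set_mem[_ Ix]|_].
      by rewrite mulr1; have /andP[] := cC _ Ix.
    by rewrite mulr0 measure0.
rewrite cst//; apply: ge0_le_integral => //.
- by apply: measurable_fun_xsection; exact: measurable_strip.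
- by apply/measurable_EFinP; apply: measurable_funM => //; exact: measurable_indic.
- move=> x _ /=; rewrite strip_xsection indicE; case: ifPn => [/set_mem[_ Ix]|_].
    have /andP[_ h] := cC _ Ix; apply: le_trans h _.
    by rewrite mulr1 lee_fin le_max lexx.
  by rewrite mulr0 measure0.
Qed.

Lemma plane_strip_le : exists2 S : R, 0 < S & forall E : set R, measurable E ->
  (plane (Omega `&` E `*` setT) <= S%:E * lambda (E `&` I))%E.
Proof.
have [c [C [_ C0 cC]]] := lambda2_strip; have [d d0 dP] := away_bound.
exists ((d ^+ 2)^-1 * C); first by rewrite mulr_gt0 ?invr_gt0 ?exprn_gt0.
move=> E mE; have mS := measurable_strip mE.
apply: (@le_trans _ _ (\int[lambda2]_(p in Omega `&` E `*` setT) ((d ^+ 2)^-1)%:E)%E).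
  apply: ge0_le_integral => //.
  - by move=> p _; rewrite lee_fin plane_density_ge0.
  - apply/measurable_EFinP/measurable_funTS; exact: measurable_plane_density.
  - move=> p [/dP[h _] _]; rewrite lee_fin.
    have z0 : 0 < `|1 + p.1 * p.2| by exact: lt_le_trans h.
    rewrite -[X in (X ^+ 2)^-1 <= _]/(1 + p.1 * p.2) -[X in X^-1 <= _]real_normK ?num_real//.
    by rewrite lef_pV2 ?posrE ?exprn_gt0// ler_sqr ?nnegrE// ltW.
rewrite integral_cst// EFinM -muleA lee_pmul2l//; last by rewrite lte_fin invr_gt0 exprn_gt0.
exact: (cC _ mE).2.
Qed.

Lemma plane_strip_eq0 (E : set R) : measurable E ->
  plane (Omega `&` E `*` setT) = 0%E -> lambda (E `&` I) = 0%E.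
Proof.
move=> mE E0; have [c [C [c0 _ cC]]] := lambda2_strip.
have E2 := plane_measure_null_inv (measurable_strip mE) (fun p h => one_add_neq0 h.1) E0.
have := (cC _ mE).1; rewrite E2 pmule_rle0 ?lte_fin// => h.
by apply/eqP; rewrite eq_le h measure_ge0.
Qed.

End planar_domain.

Section planar_inverse.
Context (R : realType).
Implicit Types (M : 'M[R]_2) (p : R * R).
Local Notation plane := (@plane_measure R).

Lemma plane_null_sub (A C : set (R * R)) : measurable A -> measurable C -> A `<=` C ->
  plane C = 0%E -> plane A = 0%E.
Proof. exact: (@subset_measure0 _ _ _ plane). Qed.

Lemma plane_null_union (A C : set (R * R)) : measurable A -> measurable C ->
  plane A = 0%E -> plane C = 0%E -> plane (A `|` C) = 0%E.
Proof. by move=> mA mC A0 C0; apply: etrans (@measureU0 _ _ _ plane _ _ mA mC C0) A0. Qed.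

Lemma plane_split (A C : set (R * R)) : measurable A -> measurable C ->
  plane A = (plane (A `\` C) + plane (A `&` C))%E.
Proof. exact: (@measureDI _ _ _ plane). Qed.

Lemma plane_null_diff (A C : set (R * R)) : measurable A -> measurable C ->
  plane C = 0%E -> plane (A `\` C) = plane A.
Proof.
move=> mA mC C0; rewrite (plane_split mA mC) [X in (_ + X)%E](_ : _ = 0%E) ?adde0//.
by apply: (plane_null_sub _ mC _ C0) => //; exact: measurableI.
Qed.

Lemma plane_null_bigcup (F : nat -> set (R * R)) : (forall n, measurable (F n)) ->
  (forall n, plane (F n) = 0%E) -> plane (\bigcup_n F n) = 0%E.
Proof.
move=> mF F0; have mU : measurable (\bigcup_n F n) by exact: bigcup_measurable.
apply: (@negligibleP _ _ _ plane _ mU).1; apply: (@negligible_bigcup _ _ _ plane F) => n.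
exact: (@negligibleP _ _ _ plane _ (mF n)).2 (F0 n).
Qed.

Definition pole_lines M : set (R * R) :=
  [set p | denom M p.1 = 0 \/ denom (conj_rot M) p.2 = 0].

Lemma pole_linesP M p : ~ pole_lines M p ->
  denom M p.1 != 0 /\ denom (conj_rot M) p.2 != 0.
Proof. by move=> h; split; apply/eqP => e; apply: h; [left|right]. Qed.

Lemma measurable_pole_lines M : measurable (pole_lines M).
Proof.
have m1 : measurable ((fun p => denom M p.1) @^-1` [set 0]).
  rewrite -[X in measurable X]setTI.
  exact: (measurableT_comp (@measurable_denom R M) (@measurable_fst _ _ _ _)).
have m2 : measurable ((fun p => denom (conj_rot M) p.2) @^-1` [set 0]).
  rewrite -[X in measurable X]setTI.
  exact: (measurableT_comp (@measurable_denom R (conj_rot M)) (@measurable_snd _ _ _ _)).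
exact: measurableU m1 m2.
Qed.

Lemma plane_pole_lines M : det_pm1 M -> plane (pole_lines M) = 0%E.
Proof.
move=> dM; have [zM zMP] := denom_zero dM; have [zN zNP] := denom_zero (conj_rot_det dM).
have mV : measurable ([set zM] `*` [set: R]) by exact: measurableX.
have mH : measurable ([set: R] `*` [set zN]) by exact: measurableX.
apply: (plane_null_sub (C := ([set zM] `*` setT) `|` (setT `*` [set zN]))) => //.
- exact: measurable_pole_lines.
- exact: measurableU.
- by move=> [x y] [/= /zMP ->|/= /zNP ->]; [left|right].
- apply: plane_null_union => //; apply: plane_measure_null => //.
    by apply: lambda2_vertical => //; exact: lebesgue_measure_set1.
  by apply: lambda2_horizontal => //; exact: lebesgue_measure_set1.
Qed.

Lemma mobius_inv_inv M : mobius_inv (mobius_inv M) = M.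
Proof.
rewrite /mobius_inv; have [-> -> -> ->] := mx2E (M 1 1) (- M 0 1) (- M 1 0) (M 0 0).
have [e1 e2 e3 e4] := mx2E (M 0 0) (- - M 0 1) (- - M 1 0) (M 1 1).
by apply: mx2_ext; rewrite ?e1 ?e2 ?e3 ?e4 ?opprK.
Qed.

Lemma conj_rot_inv M : conj_rot (mobius_inv M) = mobius_inv (conj_rot M).
Proof.
rewrite /mobius_inv; have [-> -> -> ->] := conj_rot_entries M; rewrite conj_rotE.
have [-> -> -> ->] := mx2E (M 1 1) (- M 0 1) (- M 1 0) (M 0 0).
by rewrite opprK.
Qed.

Lemma planar_mobiusK M p : det_pm1 M -> ~ pole_lines M p ->
  ~ pole_lines (mobius_inv M) (planar_mobius M p) /\
  planar_mobius (mobius_inv M) (planar_mobius M p) = p.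
Proof.
move=> dM /pole_linesP[x0 y0].
have [x1 ex] := mobius_invK dM x0; have [y1 ey] := mobius_invK (conj_rot_det dM) y0.
split; first by rewrite /pole_lines conj_rot_inv /= => -[]; apply/eqP.
by rewrite [LHS]planar_mobiusE conj_rot_inv planar_mobiusE /= ex ey; case: p {x0 y0 x1 ex y1 ey}.
Qed.

Lemma planar_mobius_invK M q : det_pm1 M -> ~ pole_lines (mobius_inv M) q ->
  ~ pole_lines M (planar_mobius (mobius_inv M) q) /\
  planar_mobius M (planar_mobius (mobius_inv M) q) = q.
Proof.
move=> dM qp; have := planar_mobiusK (mobius_inv_det dM) qp.
by rewrite mobius_inv_inv.
Qed.

End planar_inverse.

(** * A measurable inverse of the planar map *)

Section planar_dynamics.
Context (R : realType).
Variables (I : set R) (T : R -> R) (B : Type) (K : B -> set R) (M : B -> 'M[R]_2).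
Variable Omega : set (R * R).
Hypothesis hT : piecewise_mobius I T K M.
Hypothesis lbI : has_lbound I.
Hypothesis ubI : has_ubound I.
Hypothesis hO : planar_extension I T K M Omega.
Local Notation lambda := (@lebesgue_measure R).
Local Notation plane := (@plane_measure R).
Local Notation G := (cyl_mx hT lbI ubI).
Local Notation X := (cyl_set hT lbI ubI).
Local Notation P := (planar_map T K M).
Hypothesis finO : (plane Omega < +oo)%E.

Let mO := pe_borel hO.

Lemma measurable_planar_map : measurable_fun Omega P.
Proof.
have mI := measurable_domain hT.
pose C := \bigcup_n X n.
have mC : measurable C by apply: bigcup_measurable => n _; exact: measurable_cyl_set.
have mV (A : set R) : measurable A -> measurable (A `*` [set: R]) by move=> mA; exact: measurableX.
have mCO : measurable_fun (C `*` [set: R]) P.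
  have -> : C `*` [set: R] = \bigcup_n (X n `*` setT).
    apply/seteqP; split => [[x y] [[n _ Xx] _]|[x y] [n _ [Xx _]]]; first by exists n.
    by split => //; exists n.
  apply/measurable_fun_bigcup; first by move=> n; apply: mV; exact: measurable_cyl_set.
  move=> n; apply: (eq_measurable_fun (planar_mobius (G n))).
    by move=> p /set_mem[Xp _]; rewrite (planar_map_cyl Xp).
  exact: measurable_funTS (measurable_planar_mobius (G n)).
have mID : measurable ((I `\` C) `*` [set: R]) by apply: mV; exact: measurableD.
have mDO : measurable_fun ((I `\` C) `*` [set: R]) P.
  apply: (eq_measurable_fun (fun p => (extension I T p.1, p.2))).
    move=> p /set_mem[[Ip nC] _]; rewrite (@planar_map_out _ _ _ _ _ _ hT lbI ubI) ?extensionE//.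
    by move=> n Xn; apply: nC; exists n.
  apply: measurable_funTS; apply: measurable_fun_pair => //.
  exact: measurableT_comp (measurable_extension hT) (@measurable_fst _ _ _ _).
apply: (measurable_funS (E := (C `*` setT) `|` ((I `\` C) `*` [set: R]))).
- by apply: measurableU => //; exact: mV.
- move=> [x y] Oxy; have Ix : I x by rewrite -(pe_proj hO); exists (x, y).
  by have [h|h] := pselect (C x); [left|right].
- by apply/measurable_funU => //; exact: mV.
Qed.

Lemma measurable_planar_preimage (A : set (R * R)) : measurable A ->
  measurable (Omega `&` P @^-1` A).
Proof. by move=> mA; exact: measurable_planar_map. Qed.

(** On each cylinder, off the pole lines, the map is a planar Moebius map with the map of the
    adjugate as inverse, so images are preimages and hence measurable. Injectivity makes the pieces
    [W n] disjoint. The image is conull because it has the same finite measure as the conull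
    domain. *)
Lemma planar_inverse : exists (D W : set (R * R)) (g : R * R -> R * R),
  [/\ [/\ measurable D, D `<=` Omega & plane (Omega `\` D) = 0%E],
      [/\ measurable W, W `<=` Omega & plane (Omega `\` W) = 0%E],
      measurable_fun setT g,
      (forall p, D p -> W (P p) /\ g (P p) = p) /\ (forall q, W q -> D (g q) /\ P (g q) = q) &
      (forall p, D p -> exists2 n, X n p.1 & ~ pole_lines (G n) p) /\
      forall A, measurable A -> plane (D `&` P @^-1` A) = plane (W `&` A)].
Proof.
have [N [N' [[N1 [mN N10 NN1]] _ [funP injP surP]]]] := pe_bij hO.
have mX n : measurable (X n `*` [set: R]) by apply: measurableX => //; exact: measurable_cyl_set.
have mZ n := measurable_pole_lines (G n).
have mZ' n := measurable_pole_lines (mobius_inv (G n)).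
have dG n : det_pm1 (G n) by exact: cyl_mx_det.
have dG' n : det_pm1 (mobius_inv (G n)) by exact: mobius_inv_det.
pose D n := Omega `&` (X n `*` setT) `\` (N1 `|` pole_lines (G n)).
have mD n : measurable (D n).
  by apply: measurableD; [exact: measurableI|exact: measurableU].
pose W n := planar_mobius (mobius_inv (G n)) @^-1` D n `\` pole_lines (mobius_inv (G n)).
have mpre n (A : set (R * R)) : measurable A -> measurable (planar_mobius (G n) @^-1` A).
  by move=> mA; rewrite -[X in measurable X]setTI; exact: measurable_planar_mobius.
have mpre' n (A : set (R * R)) : measurable A ->
    measurable (planar_mobius (mobius_inv (G n)) @^-1` A).
  by move=> mA; rewrite -[X in measurable X]setTI; exact: measurable_planar_mobius.
have mW n : measurable (W n) by apply: measurableD => //; exact: mpre'.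
have DE n p : D n p -> P p = planar_mobius (G n) p.
  by move=> [[_ [Xp _]] _]; exact: planar_map_cyl Xp.
have DW n p : D n p -> W n (P p) /\ planar_mobius (mobius_inv (G n)) (P p) = p.
  move=> Dp; rewrite (DE _ _ Dp).
  have [e1 e2] := planar_mobiusK (dG n) (fun h => Dp.2 (or_intror h)).
  by split => //; split => //; rewrite /= e2.
have WD n q : W n q -> P (planar_mobius (mobius_inv (G n)) q) = q.
  by move=> [Dq Zq]; rewrite (DE _ _ Dq); exact: (planar_mobius_invK (dG n) Zq).2.
have DN n p : D n p -> (Omega `\` N) p.
  by move=> [[Op _] nN]; split => // Np; apply: nN; left; exact: NN1.
have WO n : W n `<=` Omega.
  by move=> q Wq; rewrite -(WD _ _ Wq); have [] := funP _ (DN _ _ Wq.1).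
have Ddisj i j p : D i p -> D j p -> i = j.
  by move=> [[_ [Xi _]] _] [[_ [Xj _]] _]; exact: cyl_set_disjoint Xi Xj.
have Wdisj i j q : W i q -> W j q -> i = j.
  move=> Wi Wj; have e : planar_mobius (mobius_inv (G i)) q = planar_mobius (mobius_inv (G j)) q.
    apply: (injP _ _ (mem_set (DN _ _ Wi.1)) (mem_set (DN _ _ Wj.1))).
    by rewrite (WD _ _ Wi) (WD _ _ Wj).
  by apply: (@Ddisj _ _ (planar_mobius (mobius_inv (G i)) q)); [exact: Wi.1|rewrite e; exact: Wj.1].
pose DD := \bigcup_n D n; pose WW := \bigcup_n W n.
have mDD : measurable DD by apply: bigcup_measurable => n _; exact: mD.
have mWW : measurable WW by apply: bigcup_measurable => n _; exact: mW.
have DDO : DD `<=` Omega by move=> p [n _ [[Op _] _]].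
have WWO : WW `<=` Omega by move=> q [n _]; exact: WO.
have eqn n A : measurable A -> plane (D n `&` P @^-1` A) = plane (W n `&` A).
  move=> mA.
  have -> : D n `&` P @^-1` A = D n `&` planar_mobius (G n) @^-1` A.
    by apply/seteqP; split => p /= [Dp]; rewrite (DE _ _ Dp).
  have mS : measurable (D n `&` planar_mobius (G n) @^-1` A) by apply: measurableI => //; exact: mpre.
  rewrite -(plane_measure_preimage (dG' n) mS).
  rewrite -(plane_null_diff (mpre' n _ mS) (mZ' n) (plane_pole_lines (dG' n))).
  congr (plane _); apply/seteqP; split => q.
    by move=> [[Dq /=]]; move=> + Zq; rewrite (planar_mobius_invK (dG n) Zq).2.
  by move=> [Wq Aq]; split; [split; [exact: Wq.1|rewrite /= (planar_mobius_invK (dG n) Wq.2).2]|exact: Wq.2].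
have mPA n A : measurable A -> measurable (D n `&` P @^-1` A).
  move=> mA; have -> : D n `&` P @^-1` A = D n `&` (Omega `&` P @^-1` A).
    by apply/seteqP; split => p /= [Dp]; [move=> h; split => //; split => //; exact: (DN _ _ Dp).1|case].
  by apply: measurableI => //; exact: measurable_planar_preimage.
have eqA A : measurable A -> plane (DD `&` P @^-1` A) = plane (WW `&` A).
  move=> mA; rewrite !setI_bigcupl.
  have tD : trivIset setT (fun n => D n `&` P @^-1` A).
    apply/trivIsetP => i j _ _ ij; apply/seteqP; split => // q [[Wi _] [Wj _]].
    by case/eqP: ij; exact: Ddisj Wi Wj.
  have tW : trivIset setT (fun n => W n `&` A).
    apply/trivIsetP => i j _ _ ij; apply/seteqP; split => // q [[Wi _] [Wj _]].
    by case/eqP: ij; exact: Wdisj Wi Wj.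
  apply: etrans (@measure_bigcup _ _ _ plane setT _ (fun n _ => mPA n A mA) tD) _.
  apply: etrans (esym (@measure_bigcup _ _ _ plane setT _ (fun n _ => measurableI _ _ (mW n) mA) tW)).
  by apply: eq_eseriesr => n _; exact: eqn.
have OD : plane (Omega `\` DD) = 0%E.
  have [Y [mY Y0 sY]] := cyl_cover hT lbI ubI.
  have mYV : measurable (Y `*` [set: R]) by exact: measurableX.
  have mU : measurable (\bigcup_n pole_lines (G n)) by exact: bigcup_measurable.
  apply: (plane_null_sub (C := (Y `*` setT) `|` (N1 `|` \bigcup_n pole_lines (G n)))).
  - exact: measurableD.
  - by apply: measurableU => //; exact: measurableU.
  - move=> [x y] [Oxy nD]; have Ix : I x by rewrite -(pe_proj hO); exists (x, y).
    have [Yx|nY] := pselect (Y x); [by left|right].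
    have [n _ Ux] : (\bigcup_n `]cyl_left hT lbI ubI n, cyl_right hT lbI ubI n[%classic) x.
      by apply: contrapT => h; apply: nY; exact: sY.
    apply: contrapT => h; apply: nD; exists n => //; split; last first.
      by move=> [h1|h1]; apply: h; [left|right; exists n].
    by split => //; split => //; apply: cyl_interior; move: Ux; rewrite /= in_itv.
  - apply: plane_null_union => //; first exact: measurableU.
      by apply: plane_measure_null => //; exact: lambda2_vertical.
    apply: plane_null_union => //.
    by apply: plane_null_bigcup => // n; exact: (plane_pole_lines (dG n)).
have fin : plane Omega \is a fin_num by rewrite ge0_fin_numE ?measure_ge0.
have OW : plane (Omega `\` WW) = 0%E.
  have e : plane WW = plane Omega.
    rewrite -[WW]setIT -(eqA _ measurableT) preimage_setT setIT.
    by rewrite (plane_split mO mDD) [X in (X + _)%E]OD add0e setIidr.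
  have := plane_split mO mWW; rewrite setIidr// e => h.
  have : (plane (Omega `\` WW) + plane Omega - plane Omega = plane Omega - plane Omega)%E by rewrite -h.
  by rewrite addeK// subee.
pose g q := if pselect (exists n, W n q) is left h then
  planar_mobius (mobius_inv (G (projT1 (cid h)))) q else q.
have gE n q : W n q -> g q = planar_mobius (mobius_inv (G n)) q.
  move=> Wq; rewrite /g; case: pselect => [h|]; last by case; exists n.
  by rewrite (Wdisj _ _ _ (projT2 (cid h)) Wq).
exists DD, WW, g; split; [by split|by split| | |split; last exact: eqA].
- rewrite -(setUv WW); apply/measurable_funU => //; first exact: measurableC.
  split.
    apply/measurable_fun_bigcup => // n; apply: (eq_measurable_fun (planar_mobius (mobius_inv (G n)))).
      by move=> q /set_mem Wq; rewrite (gE _ _ Wq).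
    exact: measurable_funTS (measurable_planar_mobius _).
  apply: (eq_measurable_fun id); last exact: measurable_id.
  move=> q /set_mem nW; rewrite /g; case: pselect => // -[n Wn].
  by case: nW; exists n.
- split => [p [n _ Dp]|q [n _ Wq]].
    have [Wp e] := DW _ _ Dp; split; first by exists n.
    by rewrite (gE _ _ Wp).
  rewrite (gE _ _ Wq); split; last exact: WD.
  by exists n => //; exact: Wq.1.
- move=> p [n _ [[_ [Xp _]] nZ]]; exists n => //.
  by move=> h; apply: nZ; right.
Qed.

Lemma planar_map_invariant (A : set (R * R)) : measurable A ->
  plane (Omega `&` P @^-1` A) = plane (Omega `&` A).
Proof.
have [D [W [g [[mD DO D0] [mW WO W0] mg _ [_ DW]]]]] := planar_inverse.
have shrink (C E : set (R * R)) : measurable C -> C `<=` Omega -> plane (Omega `\` C) = 0%E ->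
    measurable (Omega `&` E) -> plane (Omega `&` E) = plane (C `&` E).
  move=> mC CO C0 mE.
  have h0 : plane ((Omega `&` E) `\` C) = 0%E.
    apply: (plane_null_sub _ _ _ C0); [exact: measurableD|exact: measurableD|].
    by move=> p [[? ?] ?]; split.
  rewrite (plane_split mE mC) h0 add0e.
  congr (plane _); apply/seteqP; split => p; first by move=> [[? ?] ?].
  by move=> [Cp Ep]; split => //; split => //; exact: CO.
move=> mA; have mOA : measurable (Omega `&` A) by exact: measurableI.
apply: etrans (shrink D _ mD DO D0 (measurable_planar_preimage mA)) _.
by apply: etrans (DW _ mA) _; exact: esym (shrink W _ mW WO W0 mOA).
Qed.

End planar_dynamics.

(** * A second branch over the full cylinder *)

Section second_branch.
Context (R : realType).
Variables (I : set R) (T : R -> R) (B : Type) (K : B -> set R) (M : B -> 'M[R]_2).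
Variable Omega : set (R * R).
Hypothesis hT : piecewise_mobius I T K M.
Hypothesis lbI : has_lbound I.
Hypothesis ubI : has_ubound I.
Hypothesis I0 : I° !=set0.
Hypothesis hO : planar_extension I T K M Omega.
Hypothesis ha : fibers_bounded_measure I Omega.
Hypothesis hb : away_from_locus Omega.
Local Notation lambda := (@lebesgue_measure R).
Local Notation plane := (@plane_measure R).
Local Notation u := (cyl_left hT lbI ubI).
Local Notation v := (cyl_right hT lbI ubI).
Local Notation G := (cyl_mx hT lbI ubI).
Local Notation X := (cyl_set hT lbI ubI).
Local Notation U n := (`]u n, v n[%classic).
Local Notation P := (planar_map T K M).
Hypothesis finO : (plane Omega < +oo)%E.

Let mO := pe_borel hO.

(** [Omega] avoids the locus, so [Q] is null for plane Lebesgue measure and Tonelli applies to its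
    vertical sections. *)
Lemma null_sections (Q : set (R * R)) : measurable Q -> Q `<=` Omega -> plane Q = 0%E ->
  exists E : set R, [/\ measurable E, lambda E = 0%E &
    forall x, ~ E x -> lambda (xsection Q x) = 0%E].
Proof.
move=> mQ QO Q0; have mI := measurable_domain hT.
have Q2 : (\int[lambda]_x lambda (xsection Q x) = 0)%E.
  exact: plane_measure_null_inv mQ (fun p h => one_add_neq0 hb (QO _ h)) Q0.
have ms : measurable_fun (setT : set (measurableTypeR R)) (fun x => lambda (xsection Q x)).
  by apply: measurable_fun_xsection.
have abs0 : (\int[lambda]_x `|lambda (xsection Q x)| = 0)%E.
  by rewrite -[RHS]Q2; apply: eq_integral => x _; rewrite gee0_abs.
have [E [mE E0 sE]] := (ae_eq_integral_abs lambda measurableT ms).1 abs0.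
exists E; split => // x nE; apply: contrapT => h; apply: nE; apply: sE => /= h'.
exact/h/h'.
Qed.

Lemma mobius_image_null (N : 'M[R]_2) (E : set R) : det_pm1 N -> measurable E -> lambda E = 0%E ->
  exists E' : set R, [/\ measurable E', lambda E' = 0%E & mobius N @` E `<=` E'].
Proof.
move=> dN mE E0; have [z zP] := denom_zero dN; have dN' := mobius_inv_det dN.
have mpre : measurable (mobius (mobius_inv N) @^-1` E) by exact: measurable_mobius_preimage.
have n0 := lebesgue_mobius_preimage0 dN' mE E0.
exists (mobius (mobius_inv N) @^-1` E `|` [set mobius N z]); split.
- exact: measurableU.
- by apply: etrans (@measureU0 _ _ _ lambda _ _ mpre (measurable_set1 _) (lebesgue_measure_set1 _)) n0.
- move=> _ [y Ey <-]; have [/zP ->|y0] := eqVneq (denom N y) 0; first by right.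
  by left; rewrite /= (mobius_invK dN y0).2.
Qed.

(** Away from poles the image is a preimage under the inverse map; at most the value at one point is
    left over. *)
Lemma measurable_mobius_image (N : 'M[R]_2) (E : set R) : det_pm1 N -> measurable E ->
  measurable (mobius N @` E).
Proof.
move=> dN mE; have [z zP] := denom_zero dN; have dN' := mobius_inv_det dN.
have md (L : 'M[R]_2) : measurable (denom L @^-1` [set 0]).
  by rewrite -[X in measurable X]setTI; exact: measurable_denom.
have -> : mobius N @` E = (mobius (mobius_inv N) @^-1` (E `\` denom N @^-1` [set 0]) `\`
    denom (mobius_inv N) @^-1` [set 0]) `|` mobius N @` (E `&` denom N @^-1` [set 0]).
  apply/seteqP; split => [_ [y Ey <-]|y].
    have [y0|y0] := eqVneq (denom N y) 0; first by right; exists y.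
    have [y1 y2] := mobius_invK dN y0; left; split; last by apply/eqP.
    by split; rewrite /= y2//; apply/eqP.
  move=> [[[Ey _] y0]|[w [Ew _] <-]]; last by exists w.
  exists (mobius (mobius_inv N) y) => //.
  have := mobius_invK dN' (introN eqP y0); rewrite mobius_inv_inv; exact: proj2.
apply: measurableU.
  by apply: measurableD => //; apply: measurable_mobius_preimage => //; exact: measurableD.
have [h|h] := pselect ((E `&` denom N @^-1` [set 0]) z).
  rewrite (_ : mobius N @` _ = [set mobius N z])//.
  by apply/seteqP; split => [_ [w [_ /zP e] <-]|_ ->]; [rewrite e|exists z].
rewrite (_ : mobius N @` _ = set0)//.
by apply/seteqP; split => // y [w [Ew w0] _]; apply: h; have e := zP _ w0; rewrite -e.
Qed.

Lemma measure_eq_mod0 (A C E E' : set R) : measurable A -> measurable C ->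
  measurable E -> measurable E' -> lambda E = 0%E -> lambda E' = 0%E ->
  A `<=` C `|` E -> C `<=` A `|` E' -> lambda A = lambda C.
Proof.
have half (A' C' F : set R) : measurable A' -> measurable C' -> measurable F -> lambda F = 0%E ->
    A' `<=` C' `|` F -> (lambda A' <= lambda C')%E.
  move=> mA mC mF F0 AC.
  have e : lambda (C' `|` F) = lambda C' by exact: (@measureU0 _ _ _ lambda).
  by rewrite -e; apply: le_measure => //; rewrite inE//; exact: measurableU.
move=> mA mC mE mE' E0 E'0 AC CA; apply/eqP; rewrite eq_le; apply/andP; split.
  exact: half mA mC mE E0 AC.
exact: half mC mA mE' E'0 CA.
Qed.

Variables (b0 : B) (k0 : nat).
Hypothesis Kk0 : X k0 = K b0.
Hypothesis uv0 : u k0 < v k0.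
Hypothesis full0 : full_cylinder I T (K b0).

(* If only the points of [U k0] were mapped to [U k0], then almost every fibre above
   [U k0] would be carried onto its receiving fibre, with ratio 1. *)
Lemma lone_branch_ratio :
  (forall j x, j <> k0 -> U j x -> ~ U k0 (T x)) ->
  exists2 x, X k0 x & fiber_ratio T K M Omega x = 1%E.
Proof.
move=> alone.
have mI := measurable_domain hT.
have dG : det_pm1 (G k0) by exact: cyl_mx_det.
have mU n : measurable (U n) by exact: measurable_itv.
have mV (A : set R) : measurable A -> measurable (A `*` [set: R]) by move=> mA; exact: measurableX.
have [D [W [g [[mD DO D0] [mW WO W0] mg [DW WD] [_ eqP']]]]] := planar_inverse hT lbI ubI hO finO.
have [Y [mY Y0 sY]] := cyl_cover hT lbI ubI.
have mgp (A : set (R * R)) : measurable A -> measurable (g @^-1` A).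
  by move=> mA; rewrite -[X in measurable X]setTI; exact: mg.
(* Points without a good preimage: they lie outside the image [W], or their preimage has its
   abscissa in the null set [Y] outside which open cylinders cover [I]. *)
pose Q := (Omega `\` W) `|` (W `&` g @^-1` (Y `*` setT)).
have mQ : measurable Q.
  by apply: measurableU; [exact: measurableD|apply: measurableI => //; apply: mgp; exact: mV].
have Q0 : plane Q = 0%E.
  apply: plane_null_union => //.
  - exact: measurableD.
  - by apply: measurableI => //; apply: mgp; exact: mV.
  - rewrite -eqP'; last by apply: mgp; exact: mV.
    apply: (@plane_null_sub _ _ (Y `*` setT)).
    + have -> : D `&` P @^-1` (g @^-1` (Y `*` setT)) = D `&` (Y `*` setT).
        by apply/seteqP; split => p [Dp]; rewrite /= (DW _ Dp).2.
      by apply: measurableI => //; exact: mV.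
    + exact: mV.
    + by move=> p [Dp]; rewrite /= (DW _ Dp).2.
    + by apply: plane_measure_null; [exact: mV|exact: lambda2_vertical].
have QO : Q `<=` Omega by move=> q [[]//|[/WO]].
have [E1 [mE1 E10 E1P]] := null_sections mQ QO Q0.
have mQ' : measurable (Omega `\` D) by exact: measurableD.
have [E2 [mE2 E20 E2P]] := null_sections mQ' (@subDsetl _ _ _) D0.
have [e1 e2] := full_image I0 Kk0 uv0 full0.
have inUX n x : U n x -> X n x by rewrite /= in_itv/=; exact: cyl_interior.
have UI n x : U n x -> inf I < x < sup I.
  by move=> /cylinder_sub_domain; rewrite /= in_itv.
(* Points of [U k0] whose image is again in [U k0]: there the receiving fibre too lies above [U k0],
   and [alone] controls what can reach it. They form an interval, so almost all of them avoid the
   exceptional sets. *)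
have [a' [b' [ab' _ _ VE _]]] : exists a' b', [/\ a' < b', u k0 <= a', b' <= v k0,
    [set z | u k0 < z < v k0 /\ u k0 < mobius (G k0) z < v k0] = `]a', b'[%classic &
    (mobius (G k0) a' = u k0 /\ mobius (G k0) b' = v k0) \/
    (mobius (G k0) a' = v k0 /\ mobius (G k0) b' = u k0)].
  apply: mobius_preimage_itv => //; first exact: pole_free_cyl.
    rewrite e1; apply/ler_addgt0Pl => e ep; rewrite leNgt; apply/negP => h.
    have [z zu] : exists z, U k0 z /\ z < e + u k0.
      have h2 : u k0 < Num.min (v k0) (e + u k0) by rewrite lt_min uv0 ltrDr.
      exists ((u k0 + Num.min (v k0) (e + u k0)) / 2); have [m1 m2] := midf_lt h2.
      move: m2; rewrite lt_min => /andP[m2 m3]; split => //.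
      by rewrite /= in_itv/= m1.
    by have /andP[i1 _] := UI _ _ zu.1; have := lt_trans i1 (lt_trans zu.2 h); rewrite ltxx.
  rewrite e2; apply/ler_addgt0Pl => e ep; rewrite leNgt; apply/negP => h.
  have [z zu] : exists z, U k0 z /\ v k0 - e < z.
    have h2 : Num.max (u k0) (v k0 - e) < v k0 by rewrite gt_max uv0 gtrBl.
    exists ((Num.max (u k0) (v k0 - e) + v k0) / 2); have [m1 m2] := midf_lt h2.
    move: m1; rewrite gt_max => /andP[m1 m3]; split => //.
    by rewrite /= in_itv/= m1.
  have /andP[_ i1] := UI _ _ zu.1.
  by have := lt_trans zu.2 i1; rewrite ltrBlDl ltNge (ltW h).
have [x [Vx nE2 nE1]] : exists x, [/\ `]a', b'[%classic x, ~ E2 x & ~ E1 (mobius (G k0) x)].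
  apply: contrapT => no.
  have mpre : measurable (mobius (G k0) @^-1` E1) by exact: measurable_mobius_preimage.
  have n0 := lebesgue_mobius_preimage0 dG mE1 E10.
  have nU : lambda (E2 `|` mobius (G k0) @^-1` E1) = 0%E.
    by apply: etrans (@measureU0 _ _ _ lambda _ _ mE2 mpre n0) E20.
  have : lambda `]a', b'[%classic = 0%E.
    apply: (@subset_measure0 _ _ _ lambda _ _ (measurable_itv _) (measurableU _ _ mE2 mpre) _ nU).
    move=> x Vx; have [h|h] := pselect (E2 x); [by left|right].
    by apply: contrapT => h'; apply: no; exists x.
  rewrite lebesgue_measure_itv/= lte_fin ab' -EFinB => -[] /eqP.
  by rewrite subr_eq0 gt_eqF.
move: Vx; rewrite -VE => -[ux uTx].
have Ux : U k0 x by rewrite /= in_itv.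
have Xx := inUX _ _ Ux; have [x0 Tx] := cyl_set_mobius Xx.
exists x => //; rewrite /fiber_ratio Tx; set t := mobius (G k0) x.
have Ut : U k0 t by rewrite /= in_itv.
have It : I t by exact: cyl_set_sub (inUX _ _ Ut).
pose N := conj_rot (G k0); have dN : det_pm1 N by exact: conj_rot_det.
have -> : [set (P (x, y)).2 | y in xsection Omega x] = mobius N @` xsection Omega x.
  by apply/seteqP; split => _ [y Fy <-]; exists y => //; rewrite (@planar_map_cyl _ _ _ _ _ _ hT lbI ubI k0).
have mF z : measurable (xsection Omega z) by exact: measurable_xsection.
have [E' [mE' E'0 sE']] := mobius_image_null dN (measurable_xsection x mQ') (E2P _ nE2).
have -> : lambda (mobius N @` xsection Omega x) = lambda (xsection Omega t).
  apply: (measure_eq_mod0 _ (mF t) mE' (measurable_xsection t mQ) E'0 (E1P _ nE1)).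
  - exact: measurable_mobius_image.
  - move=> _ [y /set_mem Oxy <-]; have [Dxy|nD] := pselect (D (x, y)).
      left; apply/mem_set; have [Wp _] := DW _ Dxy; have := WO _ Wp.
      by rewrite (@planar_map_cyl _ _ _ _ _ _ hT lbI ubI k0)// planar_mobiusE.
    by right; apply: sE'; exists y => //; apply/mem_set.
  - move=> y /set_mem Oty; have [Qty|nQ] := pselect (Q (t, y)).
      by right; apply/mem_set.
    (* A good point of the receiving fibre has its preimage above [U k0] by [alone], and injectivity
       of the branch places it above [x]. *)
    left; have Wty : W (t, y) by apply: contrapT => h; apply: nQ; left.
    have [Dg Pg] := WD _ Wty; set p := g (t, y) in Dg Pg.
    have Op := DO _ Dg; have Ip : I p.1 by rewrite -(pe_proj hO); exists p.
    have Tp : T p.1 = t by rewrite -(@planar_map_fst _ _ _ _ _ _ hT p) Pg.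
    have nY : ~ Y p.1 by move=> Yp; apply: nQ; right; split.
    have [j _ Uj] : (\bigcup_n U n) p.1 by apply: contrapT => h; apply: nY; exact: sY.
    have ej : j = k0 by apply: contrapT => ne; apply: (alone _ _ ne Uj); rewrite Tp.
    rewrite ej in Uj; have Xp := inUX _ _ Uj; have [p0 Tp'] := cyl_set_mobius Xp.
    have ex : p.1 = x by apply: (mobius_inj dG p0 x0); rewrite -Tp' Tp.
    have := Pg; rewrite (@planar_map_cyl _ _ _ _ _ _ hT lbI ubI k0)// planar_mobiusE => -[_ ey].
    exists p.2; last exact: ey.
    by apply/mem_set; rewrite -ex; case: (p) Op.
(* Condition (a) makes the measure of the receiving fibre finite and nonzero, so the extended
   quotient is a true one. *)
have [c [C [c0 cC]]] := ha; have /andP[f1 f2] := cC _ It.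
have fF : lambda (xsection Omega t) \is a fin_num.
  by rewrite ge0_fin_numE//; apply: le_lt_trans f2 _; exact: ltry.
have F0 : fine (lambda (xsection Omega t)) != 0.
  by rewrite gt_eqF// -lte_fin fineK//; apply: lt_le_trans f1; rewrite lte_fin.
by rewrite -(fineK fF) inver (negbTE F0) -EFinM divff.
Qed.

End second_branch.

(** * The interval system of the theorem and its measures *)

Section interval_system.
Context (R : realType).
Variables (I : set R) (T : R -> R) (B : Type) (K : B -> set R) (M : B -> 'M[R]_2).
Variable Omega : set (R * R).
Hypothesis hT : piecewise_mobius I T K M.
Hypothesis lbI : has_lbound I.
Hypothesis ubI : has_ubound I.
Hypothesis I0 : I° !=set0.
Hypothesis hO : planar_extension I T K M Omega.
Hypothesis ha : fibers_bounded_measure I Omega.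
Hypothesis hb : away_from_locus Omega.
Hypothesis hc : full_cylinder_with_bounded_ratios I T K M Omega.
Hypothesis hd : bounded_nonfull_range I T K.
Local Notation lambda := (@lebesgue_measure R).
Local Notation plane := (@plane_measure R).
Local Notation u := (cyl_left hT lbI ubI).
Local Notation v := (cyl_right hT lbI ubI).
Local Notation G := (cyl_mx hT lbI ubI).
Local Notation X := (cyl_set hT lbI ubI).
Local Notation U n := (`]u n, v n[%classic).
Local Notation J := (`]inf I, sup I[%classic).
Local Notation P := (planar_map T K M).
Local Notation T' := (extension I T).
Local Notation cyl := (cyl (inf I) (sup I) T' u v).
Local Notation branch := (branch (inf I) (sup I) T' (image_ends I T K)).
Local Notation defined := (defined (inf I) (sup I) T' u v).
Hypothesis finO : (plane Omega < +oo)%E.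

Let mO := pe_borel hO.
Let sys : mobius_system (inf I) (sup I) T' u v G (image_ends I T K).
Proof. exact: extraction. Qed.

Lemma full_branch b n : X n = K b -> u n < v n -> full_cylinder I T (K b) ->
  J `<=` mobius (G n) @` U n.
Proof.
move=> Xn uv fb; have [e1 e2] := full_image I0 Xn uv fb.
have [_ ->] := mobius_itv (cyl_mx_det hT lbI ubI n) uv (pole_free_cyl uv).
by rewrite e1 e2.
Qed.

Lemma cyl_index_lt b : exists n, X n = K b /\ u n < v n.
Proof.
have [n [e1 e2 e3 _]] := cyl_index hT lbI ubI b; exists n; split => //.
have [x] := pm_nondegenerate hT b.
by rewrite (interior_cylinder hT lbI ubI) e2 e3 /= in_itv/= => /andP[]; exact: lt_trans.
Qed.

(** [k0] is the full cylinder of condition (d). If that of (c) is another one, it is the second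
    branch. If they coincide, the absence of a second branch would give the ratio 1, which (c)
    excludes. *)
Lemma covering_branches : exists k0 j1, [/\ u k0 < v k0,
  forall e, image_ends I T K e -> ~ U k0 e,
  J `<=` mobius (G k0) @` U k0, j1 <> k0 & U k0 `<=` mobius (G j1) @` U j1].
Proof.
have [b0 full0 avoid] := hd; have [k0 [Xk0 uv0]] := cyl_index_lt b0.
have Uint : (K b0)° = U k0.
  rewrite (interior_cylinder hT lbI ubI).
  have [n [e1 e2 e3 _]] := cyl_index hT lbI ubI b0.
  have [x /interior_subset Kx] := pm_nondegenerate hT b0.
  have -> : k0 = n by apply: (@cyl_set_disjoint _ _ _ _ _ _ hT lbI ubI _ _ x); rewrite ?Xk0 ?e1.
  by rewrite e2 e3.
have UJ : U k0 `<=` J by exact: cylinder_sub_domain.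
have QK e : image_ends I T K e -> ~ U k0 e.
  move=> [->|[->|[b [nfb orb]]]].
  - by move=> /UJ; rewrite /= in_itv/= ltxx.
  - by move=> /UJ; rewrite /= in_itv/= ltxx andbF.
  - by rewrite -Uint; exact: avoid orb.
have full := full_branch Xk0 uv0 full0.
have [j1 [j1k0 sec]] : exists j1, j1 <> k0 /\ U k0 `<=` mobius (G j1) @` U j1.
  apply: contrapT => no.
  have alone j x : j <> k0 -> U j x -> ~ U k0 (T x).
    move=> jk Ujx UTx; apply: no; exists j; split => //.
    have Ix : I x by apply: (@cyl_set_sub _ _ _ _ _ _ hT lbI ubI j); apply: cyl_interior; move: Ujx; rewrite /= in_itv.
    have Jx : J x by exact: (cylinder_sub_domain Ujx).
    have d0 : defined 0 x by split.
    have br := branchS sys d0 (Ujx : U j (iter 0 T' x)) (branch0 sys x).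
    have cE : cyl 1 x = U j.
      rewrite (cylS sys (Ujx : U j (iter 0 T' x))); apply/seteqP; split => z; first by case.
      by move=> Ujz; split => //; split => //; exact: (cylinder_sub_domain Ujz).
    have := branch_cover QK br; rewrite cE mulmx1 => h.
    by apply: (h x) => //=; rewrite extensionE.
  have [bc [fullc [eps eps0 epsP]]] := hc; have [kc [Xkc uvc]] := cyl_index_lt bc.
  have [kk|kk] := pselect (kc = k0); last first.
    by apply: no; exists kc; split => // x /UJ; exact: (full_branch Xkc).
  have [x Xx rx] := lone_branch_ratio I0 hO ha hb finO Xk0 uv0 full0 alone.
  have Kx : K bc x by rewrite -Xkc kk.
  have [_] := epsP _ Kx; rewrite rx subee// abse0 lee_fin.
  by rewrite leNgt eps0.
by exists k0, j1.
Qed.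

Let mJ : measurable J.
Proof. exact: measurable_itv. Qed.

Let JI : J `<=` I.
Proof. by rewrite -(interior_domain hT lbI ubI); exact: interior_subset. Qed.

Let finJ : ((lambda : set (measurableTypeR R) -> \bar R) J < +oo)%E.
Proof. by rewrite lebesgue_measure_itv/=; case: ifP => _; rewrite -?EFinB ltry. Qed.

Definition domain_measure : {finite_measure set (measurableTypeR R) -> \bar R} :=
  @mfrestr _ [the measurableType _ of measurableTypeR R] R J lambda mJ finJ.

Definition omega_measure : {finite_measure set (measurableTypeR R * measurableTypeR R)%type -> \bar R} :=
  @mfrestr _ [the measurableType _ of (measurableTypeR R * measurableTypeR R)%type] R Omega plane mO finO.

(** The marginal before normalization, as a finite measure on the whole line. *)
Definition strip_measure : {finite_measure set (measurableTypeR R) -> \bar R} :=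
  finite_pushforward omega_measure (@measurable_fst _ _ (measurableTypeR R) (measurableTypeR R)).

Lemma domain_measureE A : domain_measure A = lambda (A `&` J).
Proof. by []. Qed.

Lemma omega_measureE A : omega_measure A = plane (A `&` Omega).
Proof. by []. Qed.

Lemma strip_measureE A : strip_measure A = plane (Omega `&` A `*` setT).
Proof.
rewrite setIC; congr (plane (_ `&` _)).
by apply/seteqP; split => p //=; case.
Qed.

Lemma lambda_domain (A : set R) : measurable A -> lambda (A `&` I) = domain_measure A.
Proof.
move=> mA; have mI := measurable_domain hT.
have n2 : lambda ([set inf I] `|` [set sup I]) = 0%E.
  by apply: etrans (@measureU0 _ _ _ lambda _ _ (measurable_set1 _) (measurable_set1 _) _) _; exact: lebesgue_measure_set1.
apply: (measure_eq_mod0 _ _ _ _ n2 n2); rewrite ?domain_measureE//.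
- exact: measurableI.
- exact: measurableI.
- exact: measurableU.
- exact: measurableU.
- move=> x [Ax Ix]; have [Jx|nJ] := pselect (J x); [by left|right].
  by have [] := interval_boundary (pm_dom hT) lbI ubI Ix; rewrite ?(interior_domain hT lbI ubI)//; [left|right].
- by move=> x [Ax Jx]; left; split => //; exact: JI.
Qed.

Lemma strip_invariant (A : set R) : measurable A -> strip_measure (T' @^-1` A) = strip_measure A.
Proof.
move=> mA; rewrite !strip_measureE.
have mV : measurable (A `*` [set: R]) by exact: measurableX.
rewrite -(planar_map_invariant hT lbI ubI hO finO mV); congr (plane _).
have eT p : Omega p -> (P p).1 = T' p.1.
  move=> Op; rewrite (planar_map_fst hT) extensionE//.
  by rewrite -(pe_proj hO); exists p.
apply/seteqP; split => p [Op] /=; rewrite (eT _ Op); first by case.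
by case.
Qed.

Lemma domain_cover : domain_measure (~` \bigcup_n U n) = 0%E.
Proof.
have [Y [mY Y0 sY]] := cyl_cover hT lbI ubI.
have mU : measurable (\bigcup_n U n) by apply: bigcup_measurable => n _; exact: measurable_itv.
apply: (@subset_measure0 _ _ _ lambda _ Y) => //.
  by apply: measurableI => //; exact: measurableC.
by move=> x [nU Jx]; apply: sY; split => //; exact: JI.
Qed.

Lemma strip_domination : exists2 S : R, 0 < S &
  forall A : set R, measurable A -> mass strip_measure A <= S * mass domain_measure A.
Proof.
have [S S0 SP] := plane_strip_le (measurable_domain hT) mO (pe_proj hO) ha hb.
exists S => // A mA; rewrite -lee_fin EFinM !massE// strip_measureE.
by rewrite -lambda_domain//; exact: SP.
Qed.

Lemma strip_null (A : set R) : measurable A -> strip_measure A = 0%E -> domain_measure A = 0%E.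
Proof.
rewrite strip_measureE => mA A0; apply: etrans (esym (lambda_domain mA)) _.
by have := plane_strip_eq0 (measurable_domain hT) mO (pe_proj hO) ha hb mA A0.
Qed.

Let mT' : measurable_fun setT (T' : measurableTypeR R -> measurableTypeR R).
Proof. exact: (measurable_extension hT). Qed.

Lemma interval_expansion : exists2 a : R, 0 < a & exists2 t : R, 0 < t &
  forall n x H, defined n.*2 x -> branch n.*2 (cyl n.*2 x) H ->
    a * (1 + t) ^+ n <= mobius_jac H x.
Proof.
have [S S0 SP] := strip_domination; have [k0 [j1 [uv QK full jk sec]]] := covering_branches.
exact: (jacobian_growth sys mT' (fun A _ => domain_measureE A) domain_cover strip_invariant
  S0 SP strip_null uv QK full jk sec).
Qed.

Lemma interval_ergodic (A : set R) : measurable A -> strip_measure (A `+` T' @^-1` A) = 0%E ->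
  strip_measure A = 0%E \/ strip_measure (~` A) = 0%E.
Proof.
have [S S0 SP] := strip_domination; have [k0 [j1 [uv QK full jk sec]]] := covering_branches.
exact: (ergodic_marginal sys mT' (fun A _ => domain_measureE A) domain_cover strip_invariant
  S0 SP strip_null uv QK full jk sec).
Qed.

End interval_system.

(** * Expansion and ergodicity of the interval map *)

Lemma is_derive_mobius (R : realType) (H : 'M[R]_2) (x : R) : denom H x != 0 ->
  is_derive x 1 (mobius H) (\det H / denom H x ^+ 2).
Proof.
move=> x0.
have aff (p q : R) : is_derive x 1 (fun z : R => p * z + q) p.
  have -> : (fun z : R => p * z + q) = p *: (id : R -> R) + cst q by apply/funext.
  apply: is_derive_eq.
  by rewrite addr0 /GRing.scale /= mulr1.
have dV := @is_deriveV R (denom H) x (H 1 0) 1 x0 (aff (H 1 0) (H 1 1)).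
apply: (is_derive_eq (is_deriveM (aff (H 0 0) (H 0 1)) dV)).
by rewrite det_mx2 /GRing.scale /= /denom; move: x0; rewrite /denom => x0; field.
Qed.

Section conclusions.
Context (R : realType).
Variables (I : set R) (T : R -> R) (B : Type) (K : B -> set R) (M : B -> 'M[R]_2).
Variable Omega : set (R * R).
Hypothesis hT : piecewise_mobius I T K M.
Hypothesis lbI : has_lbound I.
Hypothesis ubI : has_ubound I.
Hypothesis I0 : I° !=set0.
Hypothesis hO : planar_extension I T K M Omega.
Hypothesis ha : fibers_bounded_measure I Omega.
Hypothesis hb : away_from_locus Omega.
Hypothesis hc : full_cylinder_with_bounded_ratios I T K M Omega.
Hypothesis hd : bounded_nonfull_range I T K.
Local Notation lambda := (@lebesgue_measure R).
Local Notation plane := (@plane_measure R).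
Local Notation u := (cyl_left hT lbI ubI).
Local Notation v := (cyl_right hT lbI ubI).
Local Notation G := (cyl_mx hT lbI ubI).
Local Notation X := (cyl_set hT lbI ubI).
Local Notation U n := (`]u n, v n[%classic).
Local Notation J := (`]inf I, sup I[%classic).
Local Notation P := (planar_map T K M).
Local Notation T' := (extension I T).
Local Notation cyl := (cyl (inf I) (sup I) T' u v).
Local Notation branch := (branch (inf I) (sup I) T' (image_ends I T K)).
Local Notation defined := (defined (inf I) (sup I) T' u v).
Hypothesis finO : (plane Omega < +oo)%E.
Hypothesis posO : (0 < plane Omega)%E.

Let mO := pe_borel hO.
Let mI := measurable_domain hT.
Let sys : mobius_system (inf I) (sup I) T' u v G (image_ends I T K).
Proof. exact: extraction. Qed.
Local Notation nu := (strip_measure hO finO).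

(** Bernoulli's inequality makes the geometric growth at least linear. *)
Lemma growth_exceeds (a t c : R) : 0 < a -> 0 < t -> exists n, c <= a * (1 + t) ^+ n.+1.
Proof.
move=> a0 t0; pose n := Num.truncn (`|c| / (a * t)).
have at0 : 0 < a * t by rewrite mulr_gt0.
exists n; apply: (@le_trans _ _ (a * (n.+1%:R * t))).
  rewrite mulrCA; apply: (@le_trans _ _ `|c|); first exact: ler_norm.
  by rewrite -ler_pdivrMr// ltW// truncnS_gt.
rewrite ler_pM2l//; have : 1 + n.+1%:R * t <= (1 + t) ^+ n.+1.
  elim: n.+1 => [|k IH]; first by rewrite mul0r addr0 expr0.
  rewrite exprS; apply: (@le_trans _ _ ((1 + t) * (1 + k%:R * t))); last first.
    by rewrite ler_wpM2l//; lra.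
  rewrite -natr1; have : 0 <= k%:R * t * t by rewrite !mulr_ge0// ltW.
  move: (k%:R) => z; lra.
lra.
Qed.

(** The successor guarantees that [x] itself is interior to a cylinder, hence lies in [I]. *)
Lemma iter_domain_defined n x : iter_domain T K n.+1 x -> I x /\ defined n.+1 x.
Proof.
have KU b z : (K b)° z -> exists j, U j z.
  have [j [_ e1 e2 _]] := cyl_index hT lbI ubI b.
  by rewrite (interior_cylinder hT lbI ubI) => h; exists j; rewrite e1 e2.
move=> dx; have [b /KU[j Uj]] := dx 0 isT.
have Jx := cylinder_sub_domain Uj.
have Ix : I x by apply: interior_subset; rewrite (interior_domain hT lbI ubI).
split => //; split => // k kn; rewrite (iter_extension hT k Ix).1.
by have [b' /KU] := dx k kn.
Qed.

Lemma expansive : eventually_expansive T K.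
Proof.
have [a a0 [t t0 jac]] := interval_expansion hT lbI ubI I0 hO ha hb hc hd finO.
have [n n2] := growth_exceeds 2 a0 t0.
exists n.+1.*2, 2; split; first by rewrite ltr1n.
rewrite doubleS => x /iter_domain_defined[Ix dx].
have [H br] := cyl_branch sys dx; have := jac n.+1 x H; rewrite doubleS => /(_ dx br) ge.
have Cx : cyl n.*2.+2 x x by exact: (cyl_refl dx).
have [p [q [pq [CE CJ] [dH pf TH] _ _]]] := br.
have xpq : `]p, q[%classic x by rewrite -CE.
have x0 : denom H x != 0.
  by apply: pf; move: xpq; rewrite /= !in_itv/= => /andP[? ?]; rewrite !ltW.
(* The cylinder is open, so near [x] the iterate is a single Moebius map, and the absolute value of
   its derivative is the Jacobian. *)
have nr : {near x, iter n.*2.+2 T =1 mobius H}.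
  have : nbhs x `]p, q[%classic by apply: open_nbhs_nbhs; split => //; exact: interval_open.
  apply: filterS => z; rewrite -CE => Cz; rewrite -(TH _ Cz).
  have Iz : I z by apply: interior_subset; rewrite (interior_domain hT lbI ubI); exact: CJ.
  by rewrite (iter_extension hT _ Iz).1.
rewrite derive1E (near_eq_derive _ nr) ?oner_eq0//.
have dm := is_derive_mobius x0; rewrite (@derive_val _ _ _ _ _ _ _ dm).
apply: le_trans n2 (le_trans ge _).
rewrite /mobius_jac normrM normfV [`|_ ^+ 2|]ger0_norm ?sqr_ge0//.
by case: dH => ->; rewrite ?normrN normr1 mul1r.
Qed.

Let k := (fine (plane Omega))^-1.
Let k0 : 0 < k.
Proof. by rewrite invr_gt0 fine_gt0// posO. Qed.

Lemma mu_normalizedE A : mu_normalized Omega A = (plane (Omega `&` A) * k%:E)%E.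
Proof.
have fO : plane Omega \is a fin_num by rewrite ge0_fin_numE ?measure_ge0.
rewrite /mu_normalized !mu_planeE -(fineK fO) inver ifF//.
by apply/negbTE; rewrite gt_eqF// fine_gt0// posO.
Qed.

Lemma marginalE E : marginal Omega E = (nu E * k%:E)%E.
Proof.
rewrite /marginal mu_normalizedE; congr (_ * _)%E; rewrite strip_measureE.
by congr (plane _); rewrite setIA setIid.
Qed.

Lemma normalized_eq0 (x : \bar R) : (x * k%:E = 0)%E <-> x = 0%E.
Proof.
split => [/eqP|->]; last by rewrite mul0e.
by rewrite mule_eq0 eqe [k == 0]gt_eqF// orbF => /eqP.
Qed.

Lemma extension_preimage A : A `<=` I -> I `&` T @^-1` A = T' @^-1` A.
Proof.
move=> AI; apply/seteqP; split => x /=; first by move=> [Ix]; rewrite extensionE.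
rewrite /extension; case: ifPn => [/set_mem Ix //|]; rewrite notin_setE => nIx /AI Ix.
exact: False_ind (nIx Ix).
Qed.

Lemma marginal_preserving : measure_preserving T I (marginal Omega).
Proof.
split; [exact: mI|exact: (pm_borel hT)|move=> A [mA AI]].
by rewrite !marginalE extension_preimage// (strip_invariant hT lbI ubI hO finO mA).
Qed.

Lemma marginal_ergodic : ergodic T I (marginal Omega).
Proof.
split; first exact: marginal_preserving.
move=> A [mA AI]; rewrite /eq_mod0 extension_preimage// !marginalE => /normalized_eq0 e.
have [A0|A0] := interval_ergodic hT lbI ubI I0 ha hb hc hd mA e; [left|right].
  by apply/normalized_eq0.
apply/normalized_eq0; have mIA : measurable (I `\` A) by exact: measurableD.
have sIA : I `\` A `<=` ~` A by move=> x [].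
exact: (@subset_measure0 _ _ _ nu _ _ mIA (measurableC mA) sIA A0).
Qed.

End conclusions.

(** * Natural extension *)

Section complete_algebras.
Context d (Y : measurableType d) (R : realType).
Variable m : {finite_measure set Y -> \bar R}.
Implicit Types (A C : set Y) (S : set (set Y)).

(** With closure under null modifications, agreement up to a null set with a member becomes
    membership. *)
Record complete_algebra S : Prop := CompleteAlgebra {
  ca_measurable : S `<=` measurable ;
  ca_setT : S setT ;
  ca_setC : forall A, S A -> S (~` A) ;
  ca_bigcup : forall F : nat -> set Y, (forall n, S (F n)) -> S (\bigcup_n F n) ;
  ca_mod0 : forall A C, S A -> measurable C -> m (A `+` C) = 0%E -> S C }.

Lemma measurable_setY A C : measurable A -> measurable C -> measurable (A `+` C).
Proof. by move=> mA mC; apply: measurableU; exact: measurableD. Qed.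

Lemma setY_sub_trans (A C E : set Y) : A `+` E `<=` (A `+` C) `|` (C `+` E).
Proof.
move=> p; have [Cp|nC] := pselect (C p).
  by move=> [[Ap nE]|[Ep nA]]; [right; left|left; right].
by move=> [[Ap nE]|[Ep nA]]; [left; left|right; right].
Qed.

Lemma null_setY_trans A C (E : set Y) : measurable A -> measurable C -> measurable E ->
  m (A `+` C) = 0%E -> m (C `+` E) = 0%E -> m (A `+` E) = 0%E.
Proof.
move=> mA mC mE AC CE; have m1 := measurable_setY mA mC; have m2 := measurable_setY mC mE.
apply: (measure_sub0 (measurable_setY mA mE) (measurableU _ _ m1 m2) (@setY_sub_trans A C E)).
exact: measureU_eq0.
Qed.

Variable F : Y -> Y.
Hypothesis mF : measurable_fun setT F.
Hypothesis inv : forall A, measurable A -> m (F @^-1` A) = m A.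

Let mpre n A : measurable A -> measurable (iter n F @^-1` A).
Proof. by move=> mA; exact: (measurable_preimage_iter mF). Qed.

Lemma measure_preimage_iter n A : measurable A -> m (iter n F @^-1` A) = m A.
Proof.
move=> mA; elim: n => [//|n IH]; rewrite -IH -(inv (mpre n mA)).
by congr (m _); apply/seteqP; split => x /=; rewrite -iterS iterSr.
Qed.

Lemma complete_pull_iter S n A : complete_algebra S ->
  (forall A, S A -> exists2 C, S C & m (A `+` F @^-1` C) = 0%E) ->
  S A -> exists2 C, S C & m (A `+` iter n F @^-1` C) = 0%E.
Proof.
move=> cS back; elim: n A => [|n IH] A SA.
  exists A => //; rewrite (_ : _ `+` _ = set0) ?measure0//.
  by apply/seteqP; split => // p [] [].
have [C SC AC] := back _ SA; have [E SE CE] := IH _ SC; exists E => //.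
have mA := ca_measurable cS SA; have mC := ca_measurable cS SC; have mE := ca_measurable cS SE.
apply: (null_setY_trans mA (mpre 1 mC) (mpre n.+1 mE) AC).
rewrite -[RHS]CE -[RHS]inv; last by apply: measurable_setY => //; exact: mpre.
by congr (m _); apply/seteqP; split => x /=; rewrite /setY /= -!iterS !iterSr.
Qed.

(** A level set of [psi] is, up to a null set, the preimage under [iter n F] of some [A] in [S].
    Closeness of [psi] to [phi] along [iter n F], together with invariance, places [A] between
    [t + 2 * e < phi] and [t < phi]; the union over [e] tending to 0 is the level set of [phi]. *)
Lemma level_sets S (phi : Y -> R) : complete_algebra S ->
  (forall A, S A -> exists2 C, S C & m (A `+` F @^-1` C) = 0%E) ->
  measurable_fun setT phi ->
  (forall e, 0 < e -> exists (n : nat) (psi : Y -> R) (N : set Y),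
    [/\ forall s, S [set p | s < psi p], measurable N, m N = 0%E &
        forall p, ~ N p -> `|phi (iter n F p) - psi p| <= e]) ->
  forall t, S [set p | t < phi p].
Proof.
move=> cS back mphi approx t.
have mlev s : measurable [set p | s < phi p].
  rewrite (_ : [set p | s < phi p] = phi @^-1` `]s, +oo[%classic).
    by rewrite -[X in measurable X]setTI; exact: mphi.
  by apply/seteqP; split => p /=; rewrite in_itv/= andbT.
have sandwich j : exists A, [/\ S A, m (A `\` [set p | t < phi p]) = 0%E &
    m ([set p | t + 2 * j.+1%:R^-1 < phi p] `\` A) = 0%E].
  have e0 : 0 < j.+1%:R^-1 :> R by rewrite invr_gt0.
  have [n [psi [N [Spsi mN N0 near]]]] := approx _ e0; set e := j.+1%:R^-1 in e0 near *.
  have [A SA BA] := complete_pull_iter n cS back (Spsi (t + e)).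
  have mA := ca_measurable cS SA; have mB := ca_measurable cS (Spsi (t + e)).
  have mBA := measurable_setY mB (mpre n mA).
  have mU : measurable (N `|` ([set p | t + e < psi p] `+` iter n F @^-1` A)) by exact: measurableU.
  have U0 : m (N `|` ([set p | t + e < psi p] `+` iter n F @^-1` A)) = 0%E by exact: measureU_eq0.
  exists A; split => //.
  - have mD : measurable (A `\` [set p | t < phi p]) by exact: measurableD.
    rewrite -(measure_preimage_iter n mD); apply: (measure_sub0 (mpre n mD) mU _ U0).
    move=> p [/= Ap nphi]; apply: contrapT => /not_orP[nN nBA].
    have Bp : t + e < psi p by apply: contrapT => nB; apply: nBA; right.
    by apply: nphi; have := near _ nN; rewrite ler_norml => /andP[h1 h2]; lra.
  - have mD : measurable ([set p | t + 2 * e < phi p] `\` A) by exact: measurableD.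
    rewrite -(measure_preimage_iter n mD); apply: (measure_sub0 (mpre n mD) mU _ U0).
    move=> p [/= phip nA]; apply: contrapT => /not_orP[nN nBA]; apply: nBA; left; split => //=.
    by have := near _ nN; rewrite ler_norml => /andP[h1 h2]; lra.
pose A j := sval (cid (sandwich j)).
have AP j : [/\ S (A j), m (A j `\` [set p | t < phi p]) = 0%E &
    m ([set p | t + 2 * j.+1%:R^-1 < phi p] `\` A j) = 0%E] := svalP (cid (sandwich j)).
have SA j : S (A j) by have [] := AP j.
have mA j := ca_measurable cS (SA j).
apply: (ca_mod0 cS (ca_bigcup cS SA)) => //.
pose N1 j := A j `\` [set p | t < phi p].
pose N2 j := [set p | t + 2 * j.+1%:R^-1 < phi p] `\` A j.
have mN1 j : measurable (N1 j) by exact: measurableD.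
have mN2 j : measurable (N2 j) by exact: measurableD.
have mN : measurable (\bigcup_j (N1 j `|` N2 j)).
  by apply: bigcup_measurable => j _; exact: measurableU.
apply: (measure_sub0 _ mN).
- by apply: measurable_setY => //; exact: bigcup_measurable.
- move=> p [[[j _ Aj] np]|[/= tp nA]]; first by exists j => //; left.
  have h : 0 < (phi p - t) / 2 by rewrite divr_gt0// subr_gt0.
  pose j := Num.truncn ((phi p - t) / 2)^-1.
  exists j => //; right; split => /=; last by move=> Aj; apply: nA; exists j.
  have : j.+1%:R^-1 < (phi p - t) / 2 by rewrite invf_plt ?posrE// truncnS_gt.
  move: (_%:R^-1) => z; lra.
- apply: (negligibleP m mN).1; apply: negligible_bigcup => j.
  apply: (negligibleP m _).2; first exact: measurableU.
  by have [_ h1 h2] := AP j; exact: measureU_eq0.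
Qed.

End complete_algebras.

Section plane_generation.
Context (R : realType).
Variable m : {finite_measure set (measurableTypeR R * measurableTypeR R)%type -> \bar R}.

(* The first coordinate and the fibre coordinate determine the point. *)
Lemma plane_generation (S : set (set (R * R))) (Omega : set (R * R)) :
  complete_algebra m S ->
  measurable Omega -> m (~` Omega) = 0%E -> (forall p, Omega p -> 1 + p.1 * p.2 != 0) ->
  (forall E : set R, measurable E -> S (E `*` setT)) ->
  (forall t, S [set p | t < fibre_coord p]) ->
  forall A, measurable A -> S A.
Proof.
move=> cS mO O0 nz Sfst Su A mA.
have sS : sigma_algebra setT S.
  split; first by rewrite -setCT; exact: ca_setC cS _ (ca_setT cS).
    by move=> C SC; rewrite setTD; exact: (ca_setC cS SC).
  by move=> C SC; exact: (ca_bigcup cS SC).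
(* Taking [S] as the sigma-algebra of the source turns membership in [S] into measurability. *)
pose Z := g_sigma_algebraType S.
have mZ (C : set Z) : measurable C = S C.
  by rewrite -[RHS](congr1 (fun f => f C) (sigma_algebra_id sS)).
have mx : measurable_fun setT (fst : Z -> R).
  move=> _ C mC; rewrite setTI mZ (_ : _ @^-1` _ = C `*` setT); first exact: Sfst.
  by apply/seteqP; split => p //= [].
have mu : measurable_fun setT (@fibre_coord R : Z -> R).
  apply: (measurability _ (RGenOInfty.measurableE R)) => _ [_ [t ->] <-].
  rewrite setTI mZ (_ : _ @^-1` _ = [set p | t < fibre_coord p]); first exact: Su.
  by apply/seteqP; split => p /=; rewrite in_itv/= andbT.
(* The equation [w = y / (1 + x y)] solved for [y], using that [1 - x w] is the inverse of
   [1 + x y]. *)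
pose y' (p : Z) : R := fibre_coord p / (1 - p.1 * fibre_coord p).
have my : measurable_fun setT y'.
  apply: measurable_funM => //; apply: (measurableT_comp (@measurable_inv R)).
  by apply: measurable_funB => //; exact: measurable_funM.
have mphi : measurable_fun setT (fun p : Z => (p.1, y' p)) by exact: measurable_fun_pair.
have SB : S ((fun p : Z => (p.1, y' p)) @^-1` A).
  by rewrite -mZ -[X in measurable X]setTI; exact: mphi.
have mB := ca_measurable cS SB.
apply: (ca_mod0 cS SB mA).
apply: (measure_sub0 _ _ _ O0); [exact: measurable_setY|exact: measurableC|].
have idO p : Omega p -> (p.1, y' p) = p.
  case: p => x y Op; rewrite /y' /fibre_coord /=; congr (_, _).
  have /= h := nz _ Op.
  have -> : 1 - x * (y / (1 + x * y)) = (1 + x * y)^-1 by field.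
  by rewrite invrK divfK.
by move=> p + Op; rewrite /setY /= (idO _ Op) => -[] [].
Qed.

End plane_generation.

Section glue.
Context (R : realType).
Variables (E : nat -> set R) (f : nat -> R -> R).

Definition glue (x : R) : R :=
  if pselect (exists n, E n x) is left h then f (projT1 (cid h)) x else 0.

Hypothesis tE : forall i j x, E i x -> E j x -> i = j.

Lemma glueE n x : E n x -> glue x = f n x.
Proof.
move=> Ex; rewrite /glue; case: pselect => [h|]; last by case; exists n.
by rewrite (tE (projT2 (cid h)) Ex).
Qed.

Hypothesis mE : forall n, measurable (E n).
Hypothesis mf : forall n, measurable_fun setT (f n).

Lemma measurable_glue : measurable_fun setT glue.
Proof.
have mU : measurable (\bigcup_n E n) by exact: bigcup_measurable.
rewrite -(setUv (\bigcup_n E n)); apply/measurable_funU => //; first exact: measurableC.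
split.
  apply/measurable_fun_bigcup => // n; apply: (eq_measurable_fun (f n)).
    by move=> x /set_mem Ex; rewrite (glueE Ex).
  exact: measurable_funTS (mf n).
apply: (eq_measurable_fun (fun=> 0 : R)); last exact: measurable_cst.
move=> x /set_mem nE; rewrite /glue; case: pselect => // -[n En].
by case: nE; exists n.
Qed.

End glue.

(** * Contraction of the fibres and generation of the Borel sets *)

Section planar_generation.
Context (R : realType).
Variables (I : set R) (T : R -> R) (B : Type) (K : B -> set R) (M : B -> 'M[R]_2).
Variable Omega : set (R * R).
Hypothesis hT : piecewise_mobius I T K M.
Hypothesis lbI : has_lbound I.
Hypothesis ubI : has_ubound I.
Hypothesis I0 : I° !=set0.
Hypothesis hO : planar_extension I T K M Omega.
Hypothesis ha : fibers_bounded_measure I Omega.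
Hypothesis hb : away_from_locus Omega.
Hypothesis hc : full_cylinder_with_bounded_ratios I T K M Omega.
Hypothesis hd : bounded_nonfull_range I T K.
Local Notation lambda := (@lebesgue_measure R).
Local Notation plane := (@plane_measure R).
Local Notation u := (cyl_left hT lbI ubI).
Local Notation v := (cyl_right hT lbI ubI).
Local Notation G := (cyl_mx hT lbI ubI).
Local Notation X := (cyl_set hT lbI ubI).
Local Notation U n := (`]u n, v n[%classic).
Local Notation J := (`]inf I, sup I[%classic).
Local Notation P := (planar_map T K M).
Local Notation T' := (extension I T).
Local Notation cyl := (cyl (inf I) (sup I) T' u v).
Local Notation branch := (branch (inf I) (sup I) T' (image_ends I T K)).
Local Notation defined := (defined (inf I) (sup I) T' u v).
Hypothesis finO : (plane Omega < +oo)%E.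
Local Notation m := (omega_measure hO finO).

Let mO := pe_borel hO.
Let mI := measurable_domain hT.
Let sys : mobius_system (inf I) (sup I) T' u v G (image_ends I T K).
Proof. exact: extraction. Qed.
Let tU := ms_disjoint sys.
Let mU n : measurable (U n).
Proof. exact: measurable_itv. Qed.

(** Completed outside [Omega] so that the first coordinate is moved by [T'] everywhere. *)
Definition planar_total (p : R * R) : R * R := 
  if p \in Omega then P p else (T' p.1, p.2).
Local Notation F := planar_total.

Lemma planar_totalE p : Omega p -> F p = P p.
Proof. by move=> Op; rewrite /planar_total mem_set. Qed.

Lemma measurable_planar_total : measurable_fun setT F.
Proof.
rewrite -(setUv Omega); apply/measurable_funU => //; first exact: measurableC.
split.
  apply: (eq_measurable_fun P); last exact: (measurable_planar_map hT lbI ubI hO).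
  by move=> p /set_mem Op; rewrite planar_totalE.
apply: (eq_measurable_fun (fun p => (T' p.1, p.2))).
  by move=> p /set_mem nO; rewrite /planar_total memNset.
apply: measurable_funTS; apply: measurable_fun_pair => //.
exact: measurableT_comp (measurable_extension hT) (@measurable_fst _ _ _ _).
Qed.

Lemma planar_total_fst p : (F p).1 = T' p.1.
Proof.
rewrite /planar_total; case: ifPn => // /set_mem Op.
by rewrite (planar_map_fst hT) extensionE// -(pe_proj hO); exists p.
Qed.

Lemma planar_total_preimage (A : set (R * R)) :
  F @^-1` A `&` Omega = Omega `&` P @^-1` A.
Proof.
by rewrite setIC; apply/seteqP; split => p [Op] /=; rewrite planar_totalE.
Qed.

Lemma planar_total_invariant (A : set (R * R)) : measurable A -> m (F @^-1` A) = m A.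
Proof.
move=> mA; rewrite !omega_measureE planar_total_preimage [A `&` _]setIC.
exact: (planar_map_invariant hT lbI ubI hO finO mA).
Qed.

Lemma omega_measure_compl : m (~` Omega) = 0%E.
Proof. by rewrite omega_measureE setICl measure0. Qed.

(** The exceptional set collects the preimages of one null set under all iterates, so whole forward
    orbits avoid cylinder ends and poles. *)
Lemma generic_points : exists N : set (R * R), [/\ measurable N, m N = 0%E &
  forall p, ~ N p -> forall n, let q := iter n F p in
    [/\ Omega q, F q = P q & exists2 j, U j q.1 & ~ pole_lines (G j) q]].
Proof.
have [D [W [g [[mD DO D0] _ _ _ [DX _]]]]] := planar_inverse hT lbI ubI hO finO.
have [Z [mZ Z0 sZ]] := cyl_cover hT lbI ubI.
have mZV : measurable (Z `*` [set: R]) by exact: measurableX.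
pose Gd := D `\` (Z `*` [set: R]).
have mG : measurable (~` Gd) by apply: measurableC; exact: measurableD.
have G0 : m (~` Gd) = 0%E.
  rewrite omega_measureE; apply: (plane_null_sub (C := (Omega `\` D) `|` (Z `*` setT))).
  - exact: measurableI.
  - by apply: measurableU => //; exact: measurableD.
  - move=> p [nG Op]; have [Dp|nD] := pselect (D p); last by left.
    by right; apply: contrapT => nZ; apply: nG.
  - apply: plane_null_union => //; first exact: measurableD.
    by apply: plane_measure_null => //; exact: lambda2_vertical.
have mn n : measurable (iter n F @^-1` (~` Gd)).
  exact: (measurable_preimage_iter measurable_planar_total).
have mN : measurable (\bigcup_n (iter n F @^-1` (~` Gd))) by exact: bigcup_measurable.
exists (\bigcup_n (iter n F @^-1` (~` Gd))); split => //.
  apply: (negligibleP m mN).1; apply: negligible_bigcup => n.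
  apply: (negligibleP m (mn n)).2; rewrite -[RHS]G0.
  exact: (@measure_preimage_iter _ _ _ m F measurable_planar_total planar_total_invariant n _ mG).
move=> p nN n q; have [Dq nZ] : Gd q by apply: contrapT => h; apply: nN; exists n.
have Oq := DO _ Dq; split => //; first exact: planar_totalE.
have [j Xj nP] := DX _ Dq; exists j => //.
have Iq : I q.1 by rewrite -(pe_proj hO); exists q.
have [i _ Ui] : (\bigcup_n U n) q.1.
  by apply: contrapT => h; apply: nZ; split => //; apply: sZ.
have Xi : X i q.1 by apply: cyl_interior; move: Ui; rewrite /= in_itv.
by rewrite (cyl_set_disjoint Xj Xi).
Qed.

Definition fibre_slope : R -> R := glue (fun n => U n) (fun n x => \det (G n) * denom (G n) x ^+ 2).

Definition fibre_shift : R -> R :=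
  glue (fun n => U n) (fun n x => - (\det (G n) * (G n 1 0 * denom (G n) x))).

(** The fibre coordinate that the affine action gives after [n] steps from the value 0 above [x]; it
    is a function of [x] alone. *)
Fixpoint fibre_origin n (x : R) : R := if n is k.+1 then
  fibre_slope (iter k T' x) * fibre_origin k x + fibre_shift (iter k T' x) else 0.

Lemma measurable_fibre_origin n : measurable_fun setT (fibre_origin n).
Proof.
have ma : measurable_fun setT fibre_slope.
  apply: measurable_glue => // k; apply: measurable_funM => //; apply: measurable_funX.
  exact: measurable_denom.
have mb : measurable_fun setT fibre_shift.
  apply: measurable_glue => // k; apply: measurableT_comp => //; apply: measurable_funM => //.
  by apply: measurable_funM => //; exact: measurable_denom.
have mT k : measurable_fun setT (iter k T').
  by elim: k => [|k IH]; [exact: measurable_id|exact: measurableT_comp (measurable_extension hT) IH].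
elim: n => [|n IH] /=; first exact: measurable_cst.
by apply: measurable_funD; [apply: measurable_funM => //|]; exact: measurableT_comp.
Qed.

(** Denominators multiply along compositions, so the accumulated slope is the inverse Jacobian of
    the branch. *)
Lemma fibre_slope_prod n x : defined n x -> exists2 H, branch n (cyl n x) H &
  `|\prod_(k < n) fibre_slope (iter k T' x)| = denom H x ^+ 2.
Proof.
elim: n => [|n IH] dx.
  exists 1%:M; first exact: (branch0 sys).
  by rewrite big_ord0 normr1 /denom !mxE /= mul0r add0r expr1n.
have dn : defined n x by case: dx => Jx h; split => // k kn; apply: h; exact: ltnW.
have [H bH HE] := IH dn; have [j Uj] := dx.2 n (ltnSn n).
exists (G j *m H); first exact: (branchS sys dn Uj bH).
have Cx : cyl n x x by exact: (cyl_refl dn).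
have [p [q [pq [CE CJ] [dH pf TH] _ _]]] := bH.
have xpq : `]p, q[%classic x by rewrite -CE.
have x0 : denom H x != 0.
  by apply: pf; move: xpq; rewrite /= !in_itv/= => /andP[? ?]; rewrite !ltW.
rewrite big_ord_recr /= normrM HE {1}/fibre_slope (glueE _ tU Uj).
rewrite denom_mulmx// -(TH _ Cx) normrM [`|_ ^+ 2|]ger0_norm ?sqr_ge0//.
have -> : `|\det (G j)| = 1 by case: (cyl_mx_det hT lbI ubI j) => ->; rewrite ?normrN normr1.
by rewrite mul1r exprMn mulrC.
Qed.

Lemma fibre_contraction (e : R) : 0 < e -> exists n, exists N : set (R * R),
  [/\ measurable N, m N = 0%E & forall p, ~ N p ->
      `|fibre_coord (iter n F p) - fibre_origin n p.1| <= e].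
Proof.
move=> e0; have [N [mN N0 NP]] := generic_points.
have [d d0 dP] := away_bound hb.
have [a a0 [t t0 jac]] := interval_expansion hT lbI ubI I0 hO ha hb hc hd finO.
have [n nP] := growth_exceeds (d^-1 / e) a0 t0.
exists n.+1.*2, N; split => // p nN; have gp := NP p nN.
have fstE k : (iter k F p).1 = iter k T' p.1.
  by elim: k => [//|k IH]; rewrite !iterS planar_total_fst IH.
have dx k : defined k p.1.
  split => [|i _]; last by have [_ _ [j Uj _]] := gp i; exists j; rewrite -fstE.
  by have [_ _ [j Uj _]] := gp 0; exact: (cylinder_sub_domain Uj).
have step k : fibre_coord (iter k F p) - fibre_origin k p.1 =
    (\prod_(i < k) fibre_slope (iter i T' p.1)) * fibre_coord p.
  elim: k => [|k IH]; first by rewrite big_ord0 mul1r subr0.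
  rewrite big_ord_recr /= [_ * fibre_slope _]mulrC -mulrA -IH.
  have [Oq Fq [j Uj nP']] := gp k; rewrite Fq; rewrite -fstE; set q := iter k F p in Oq Fq Uj nP' *.
  have Xj : X j q.1 by apply: cyl_interior; move: Uj; rewrite /= in_itv.
  rewrite (planar_map_cyl Xj) /fibre_slope /fibre_shift !(glueE _ tU Uj).
  have [x0 y0] := pole_linesP nP'.
  rewrite [q]surjective_pairing fibre_coord_mobius//=; last 2 first.
  - exact: cyl_mx_det.
  - exact: (one_add_neq0 hb Oq).
  by rewrite -surjective_pairing; ring.
have [H bH HE] := fibre_slope_prod (dx n.+1.*2).
rewrite step normrM HE; have := jac _ _ _ (dx n.+1.*2) bH; rewrite /mobius_jac => ge.
have [_ up] := dP _ (let: And3 h _ _ := gp 0 in h).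
have h1 : d^-1 / e <= (denom H p.1 ^+ 2)^-1 by exact: le_trans ge.
have h0 : 0 < (denom H p.1 ^+ 2)^-1 by apply: lt_le_trans h1; rewrite divr_gt0 ?invr_gt0.
rewrite invr_gt0 in h0; apply: (@le_trans _ _ (denom H p.1 ^+ 2 * d^-1)).
  by rewrite ler_wpM2l// ltW.
rewrite ler_pdivrMr// in h1; apply: le_trans (ler_wpM2l (ltW h0) h1) _.
by rewrite mulrA divff ?gt_eqF// mul1r.
Qed.

Lemma planar_generation (S : set (set (R * R))) : complete_algebra m S ->
  (forall A, S A -> exists2 C, S C & m (A `+` F @^-1` C) = 0%E) ->
  (forall E : set R, measurable E -> S (E `*` setT)) ->
  forall A, measurable A -> S A.
Proof.
move=> cS back Sfst.
apply: (plane_generation cS mO omega_measure_compl (@one_add_neq0 _ _ hb) Sfst).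
apply: (@level_sets _ _ _ m F measurable_planar_total planar_total_invariant S
  (@fibre_coord R) cS back).
  apply: measurable_funM => //; apply: (measurableT_comp (@measurable_inv R)).
  by apply: measurable_funD => //; exact: measurable_funM.
move=> e e0; have [n [N [mN N0 NP]]] := fibre_contraction e0.
exists n, (fun p => fibre_origin n p.1), N; split => // s.
rewrite (_ : [set p : R * R | _] = [set x | s < fibre_origin n x] `*` setT); last first.
  by apply/seteqP; split => p //= [].
apply: Sfst; rewrite (_ : [set x | _] = fibre_origin n @^-1` `]s, +oo[%classic).
  by rewrite -[X in measurable X]setTI; apply: measurable_fibre_origin.
by apply/seteqP; split => x /=; rewrite in_itv/= andbT.
Qed.

End planar_generation.

(** * Sets approximable by a base under iterated preimages *)

Section approximation.
Context d (Y : measurableType d) (R : realType).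
Variable m : {finite_measure set Y -> \bar R}.
Implicit Types (A C : set Y).

Lemma mass_le_add A C (E : set Y) : measurable A -> measurable C -> measurable E ->
  A `<=` C `|` E -> mass m A <= mass m C + mass m E.
Proof.
move=> mA mC mE ACE; have mD : measurable (E `\` C) by exact: measurableD.
apply: (@le_trans _ _ (mass m (C `|` (E `\` C)))).
  apply: le_mass => //; first exact: measurableU.
  by move=> p /ACE[Cp|Ep]; [left|have [Cp|nC] := pselect (C p); [left|right]].
rewrite massU//; last by apply/seteqP; split => // p [Cp []].
by rewrite lerD2l; apply: le_mass => // p [].
Qed.

Lemma mass_setY_trans A C (E : set Y) : measurable A -> measurable C -> measurable E ->
  mass m (A `+` E) <= mass m (A `+` C) + mass m (C `+` E).
Proof.
by move=> mA mC mE; apply: mass_le_add; try exact: measurable_setY; exact: setY_sub_trans.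
Qed.

Variable F : Y -> Y.
Hypothesis mF : measurable_fun setT F.
Hypothesis inv : forall A, measurable A -> m (F @^-1` A) = m A.

Let mpre n A : measurable A -> measurable (iter n F @^-1` A).
Proof. by move=> mA; exact: (measurable_preimage_iter mF). Qed.

Let mass_pre n A : measurable A -> mass m (iter n F @^-1` A) = mass m A.
Proof. by move=> mA; rewrite /mass (measure_preimage_iter mF inv n mA). Qed.

Variable base : set (set Y).
Hypothesis base_measurable : base `<=` measurable.
Hypothesis baseT : base setT.
Hypothesis baseC : forall A, base A -> base (~` A).
Hypothesis base_bigcup : forall E : nat -> set Y, (forall n, base (E n)) -> base (\bigcup_n E n).
Hypothesis base_pre : forall A, base A -> base (F @^-1` A).

Let base_iter n A : base A -> base (iter n F @^-1` A).
Proof.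
move=> bA; elim: n => [//|n IH]; rewrite (_ : _ @^-1` _ = F @^-1` (iter n F @^-1` A)).
  exact: base_pre.
by apply/seteqP; split => x /=; rewrite -iterS iterSr.
Qed.

Let baseU A C : base A -> base C -> base (A `|` C).
Proof.
move=> bA bC; rewrite -bigcup2E; apply: base_bigcup => -[|[|n]] //=.
by rewrite -setCT; exact: baseC.
Qed.

(* The sets that some iterate pulls back arbitrarily close to sets of [base]. *)
Definition approximable : set (set Y) := [set A | measurable A /\
  forall e, 0 < e -> exists n, exists2 E, base E & mass m ((iter n F @^-1` A) `+` E) < e].

(** Two different iterates are brought to the common [n1 + n2] by pulling each approximation back
    further, which by invariance preserves its error. *)
Let approxU A C : approximable A -> approximable C -> approximable (A `|` C).
Proof.
move=> [mA aA] [mC aC]; split => [|e e0]; first exact: measurableU.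
have e2 : 0 < e / 2 by rewrite divr_gt0.
have [n1 [E1 b1 A1]] := aA _ e2; have [n2 [E2 b2 A2]] := aC _ e2.
have mE1 := base_measurable b1; have mE2 := base_measurable b2.
have m1 := measurable_setY (mpre n1 mA) mE1; have m2 := measurable_setY (mpre n2 mC) mE2.
exists (n1 + n2)%N, (iter n2 F @^-1` E1 `|` iter n1 F @^-1` E2).
  by apply: baseU; exact: base_iter.
apply: (@le_lt_trans _ _ (mass m (iter n2 F @^-1` ((iter n1 F @^-1` A) `+` E1)) +
                          mass m (iter n1 F @^-1` ((iter n2 F @^-1` C) `+` E2)))).
  apply: mass_le_add; try exact: mpre.
    by apply: measurable_setY; [apply: mpre; exact: measurableU|apply: measurableU; exact: mpre].
  have e1 p : iter (n1 + n2) F p = iter n1 F (iter n2 F p) by rewrite iterD.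
  have e3 p : iter (n1 + n2) F p = iter n2 F (iter n1 F p) by rewrite addnC iterD.
  move=> p [[[Ap|Cp] nE]|[[Ep|Ep] nAC]].
  - by left; left; split; [rewrite /= -e1|move=> h; apply: nE; left].
  - by right; left; split; [rewrite /= -e3|move=> h; apply: nE; right].
  - by left; right; split => // h; apply: nAC; left; rewrite /= e1.
  - by right; right; split => // h; apply: nAC; right; rewrite /= e3.
rewrite !mass_pre//; lra.
Qed.

Lemma approximable_complete : complete_algebra m approximable.
Proof.
split.
- by move=> A [].
- split => // e e0; exists 0%N, setT => //.
  by rewrite (_ : _ `+` _ = set0) ?/mass ?measure0//; apply/seteqP; split => // p [] [].
- move=> A [mA aA]; split => [|e /aA[n [E bE AE]]]; first exact: measurableC.
  exists n, (~` E); first exact: baseC.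
  rewrite (_ : _ `+` _ = (iter n F @^-1` A) `+` E)//.
  apply/seteqP; split => p.
    by move=> [[nA /contrapT Ep]|[nE /contrapT Ap]]; [right|left].
  by move=> [[Ap nE]|[Ep nA]]; [right|left]; split => //; exact.
- move=> G aG; have mG n : measurable (G n) by have [] := aG n.
  have mU : measurable (\bigcup_n G n) by exact: bigcup_measurable.
  split => // e e0; have e2 : 0 < e / 2 by rewrite divr_gt0.
  (* Finite unions are already approximable, and by finiteness of [m] one of them exhausts the
     countable union up to [e / 2]. *)
  pose H N := \bigcup_(i in `I_N.+1) G i.
  have HS N : H N.+1 = H N `|` G N.+1 by rewrite /H [in LHS]IIS bigcup_setU bigcup_set1.
  have aH N : approximable (H N).
    elim: N => [|N IH]; last by rewrite HS; exact: approxU.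
    by rewrite /H II1 bigcup_set1; exact: aG.
  have mH N : measurable (H N) by have [] := aH N.
  have HU N : H N `<=` \bigcup_n G n by move=> p [i _ Gp]; exists i.
  have [N HN] : exists N, mass m ((\bigcup_n G n) `\` H N) < e / 2.
    apply: contrapT => no.
    have bound N : mass m (H N) <= mass m (\bigcup_n G n) - e / 2.
      have : mass m (\bigcup_n G n) = mass m (H N) + mass m ((\bigcup_n G n) `\` H N).
        rewrite -massU//; [by rewrite setDUK//; exact: HU|exact: measurableD|].
        by apply/seteqP; split => // p [Hp []].
      have : e / 2 <= mass m ((\bigcup_n G n) `\` H N).
        by rewrite leNgt; apply/negP => h; apply: no; exists N.
      lra.
    have ndH : nondecreasing_seq H.
      by move=> i j ij; apply/subsetPset => p [k ki Gp]; exists k => //=; exact: leq_trans ki _.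
    have := mass_bigcup_ge mH ndH bound.
    rewrite (_ : \bigcup_n H n = \bigcup_n G n); first lra.
    by apply/seteqP; split => p [n _ Hp]; [exact: HU Hp|exists n => //; exists n => //=].
  have [n [E bE AE]] := (aH N).2 _ e2; exists n, E => //.
  have mE := base_measurable bE.
  have mD : measurable ((\bigcup_n G n) `\` H N) by exact: measurableD.
  apply: (@le_lt_trans _ _ (mass m (iter n F @^-1` ((\bigcup_n G n) `\` H N)) +
                            mass m ((iter n F @^-1` H N) `+` E))); last by rewrite mass_pre//; lra.
  apply: mass_le_add; [by apply: measurable_setY => //; exact: mpre|exact: mpre| |].
    by apply: measurable_setY => //; exact: mpre.
  move=> p [[Up nE]|[Ep nU]].
    by have [Hp|nH] := pselect (H N (iter n F p)); [right; left|left].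
  by right; right; split => // Hp; apply: nU; exact: HU Hp.
- move=> A C [mA aA] mC AC; split => // e /aA[n [E bE AE]]; exists n, E => //.
  apply: le_lt_trans (mass_setY_trans (mpre n mC) (mpre n mA) (base_measurable bE)) _.
  rewrite (_ : mass m _ = 0) ?add0r//.
  rewrite (_ : _ `+` _ = iter n F @^-1` (A `+` C)); last by rewrite setYC.
  by rewrite mass_pre ?/mass ?AC//; exact: measurable_setY.
Qed.

(** Pulling [C] back once gives [A] up to a null set, so the approximations of [A] serve for [C]
    with one more iterate. *)
Lemma approximable_back :
  (forall A, measurable A -> exists2 C, measurable C & m (A `+` F @^-1` C) = 0%E) ->
  forall A, approximable A -> exists2 C, approximable C & m (A `+` F @^-1` C) = 0%E.
Proof.
move=> back A [mA aA]; have [C mC AC] := back _ mA; exists C => //; split => // e /aA[n [E bE AE]].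
exists n.+1, E => //; have mFC := mpre 1 mC.
have eC : iter n.+1 F @^-1` C = iter n F @^-1` (F @^-1` C).
  by apply/seteqP; split => p /=; rewrite -iterS.
apply: le_lt_trans (mass_setY_trans (mpre n.+1 mC) (mpre n mA) (base_measurable bE)) _.
rewrite (_ : mass m _ = 0) ?add0r// eC.
rewrite (_ : _ `+` _ = iter n F @^-1` (A `+` F @^-1` C)); last by rewrite setYC.
by rewrite mass_pre ?/mass ?AC//; exact: measurable_setY.
Qed.

(** For an invariant set the iterate disappears, so members of [base] come within [2 ^ -(k + 1)] of
    [A]; by Borel-Cantelli their upper limit is [A] up to a null set. *)
Lemma approximable_invariant A : approximable A -> m (A `+` F @^-1` A) = 0%E ->
  exists2 E, base E & m (A `+` E) = 0%E.
Proof.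
move=> [mA aA] inA.
have inAn n : m (A `+` iter n F @^-1` A) = 0%E.
  elim: n => [|n IH].
    by rewrite (_ : _ `+` _ = set0) ?measure0//; apply/seteqP; split => // p [] [].
  apply: (null_setY_trans mA (mpre 1 mA) (mpre n.+1 mA) inA).
  rewrite -[RHS]IH -[RHS]inv; last by apply: measurable_setY => //; exact: mpre.
  by congr (m _); apply/seteqP; split => x /=; rewrite /setY /= -!iterS !iterSr.
have close k : exists2 E, base E & mass m (A `+` E) < 1 / (2 ^ k.+1)%:R.
  have e0 : 0 < 1 / (2 ^ k.+1)%:R :> R by rewrite divr_gt0// ltr0n expn_gt0.
  have [n [E bE AE]] := aA _ e0; exists E => //.
  apply: le_lt_trans (mass_setY_trans mA (mpre n mA) (base_measurable bE)) _.
  by rewrite (_ : mass m _ = 0) ?add0r// /mass inAn.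
pose E k := s2val (cid2 (close k)).
have bE k : base (E k) := s2valP (cid2 (close k)).
have AE k : mass m (A `+` E k) < 1 / (2 ^ k.+1)%:R := s2valP' (cid2 (close k)).
have mE k := base_measurable (bE k).
have mN k : measurable (A `+` E k) by exact: measurable_setY.
have bL n : base (\bigcup_(j >= n) E j).
  rewrite bigcup_mkcond; apply: base_bigcup => k; case: ifP => // _.
  by rewrite -setCT; exact: baseC.
have bLS : base (lim_sup_set E).
  rewrite /lim_sup_set -[X in base X]setCK setC_bigcap; apply: baseC; apply: base_bigcup => n.
  exact: baseC.
exists (lim_sup_set E) => //.
have N0 : m (lim_sup_set (fun k => A `+` E k)) = 0%E.
  apply: lim_sup_set_cvg0 => //; apply: (@le_lt_trans _ _ 1%:E); last exact: ltry.
  apply: le_trans (epsilon_trick0 xpredT (ler01 : 0 <= 1 :> R)).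
  apply: lee_nneseries => [k *|k *]; first by [].
  have h : ((mass m (A `+` E k))%:E <= (1 / (2 ^ k.+1)%:R)%:E)%E by rewrite lee_fin ltW.
  by rewrite massE in h.
apply: (measure_sub0 _ _ _ N0).
- by apply: measurable_setY => //; exact: base_measurable.
- rewrite /lim_sup_set; apply: bigcap_measurable => // n _.
  by apply: bigcup_measurable => k _.
- move=> p [[Ap nL]|[Lp nA]] n _.
    have [k kE] : exists k, forall j, (k <= j)%N -> ~ E j p.
      apply: contrapT => no; apply: nL => k _; apply: contrapT => no'; apply: no; exists k => j kj Ej.
      by apply: no'; exists j.
    by exists (maxn n k); [exact: leq_maxl|left; split => //; apply: kE; exact: leq_maxr].
  by have [j nj Ej] := Lp n Logic.I; exists j => //; right.
Qed.

End approximation.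

(** * Natural extension and ergodicity in the plane *)

Section planar_conclusions.
Context (R : realType).
Variables (I : set R) (T : R -> R) (B : Type) (K : B -> set R) (M : B -> 'M[R]_2).
Variable Omega : set (R * R).
Hypothesis hT : piecewise_mobius I T K M.
Hypothesis lbI : has_lbound I.
Hypothesis ubI : has_ubound I.
Hypothesis I0 : I° !=set0.
Hypothesis hO : planar_extension I T K M Omega.
Hypothesis ha : fibers_bounded_measure I Omega.
Hypothesis hb : away_from_locus Omega.
Hypothesis hc : full_cylinder_with_bounded_ratios I T K M Omega.
Hypothesis hd : bounded_nonfull_range I T K.
Local Notation plane := (@plane_measure R).
Local Notation P := (planar_map T K M).
Local Notation T' := (extension I T).
Hypothesis finO : (plane Omega < +oo)%E.
Hypothesis posO : (0 < plane Omega)%E.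
Local Notation m := (omega_measure hO finO).
Local Notation nu := (strip_measure hO finO).
Local Notation F := (planar_total I T K M Omega).
Local Notation mun := (mu_normalized Omega).

Let mO := pe_borel hO.
Let mI := measurable_domain hT.
Let mF := measurable_planar_total hT lbI ubI hO.
Let Finv := planar_total_invariant hT lbI ubI hO finO.
Let mpre (A : set (R * R)) : measurable A -> measurable (F @^-1` A).
Proof. by move=> mA; rewrite -[X in measurable X]setTI; exact: mF. Qed.

Lemma eq_mod0_normalized (A C : set (R * R)) : eq_mod0 mun A C <-> m (A `+` C) = 0%E.
Proof.
rewrite /eq_mod0 (mu_normalizedE finO posO) omega_measureE setIC.
exact: (normalized_eq0 finO posO).
Qed.

Lemma eq_on_null (A C : set (R * R)) : measurable A -> measurable C ->
  (forall p, Omega p -> (A p <-> C p)) -> m (A `+` C) = 0%E.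
Proof.
move=> mA mC AC; rewrite omega_measureE (_ : _ `&` _ = set0) ?measure0//.
by apply/seteqP; split => // p [[[Ap nC]|[Cp nA]] Op]; [apply: nC|apply: nA]; apply/AC.
Qed.

Lemma normalized_null (A : set (R * R)) : m A = 0%E -> mun A = 0%E.
Proof.
rewrite omega_measureE setIC => A0; rewrite (mu_normalizedE finO posO).
exact/(normalized_eq0 finO posO).
Qed.

Lemma normalized_preserving : measure_preserving P Omega mun.
Proof.
split; [exact: mO|exact: (measurable_planar_map hT lbI ubI hO)|move=> A [mA AO]].
rewrite !(mu_normalizedE finO posO) setIA setIid.
by rewrite (planar_map_invariant hT lbI ubI hO finO mA).
Qed.

Lemma normalized_invertible : invertible_mod0 P Omega mun.
Proof.
have [D [W [g [[mD DO D0] [mW WO W0] mg [DW WD] _]]]] := planar_inverse hT lbI ubI hO finO.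
exists g, ((Omega `\` D) `|` (Omega `\` W)); split.
- exact: measurable_funTS.
- exists ((Omega `\` D) `|` (Omega `\` W)); split => //.
    by apply: measurableU; exact: measurableD.
  rewrite (mu_normalizedE finO posO); apply/(normalized_eq0 finO posO).
  rewrite (_ : Omega `&` _ = (Omega `\` D) `|` (Omega `\` W)).
    by apply: plane_null_union D0 W0; exact: measurableD.
  by apply/seteqP; split => p; [case|move=> h; split => //; case: h => -[]].
- move=> p [Op nN].
  have Dp : D p by apply: contrapT => h; apply: nN; left.
  have Wp : W p by apply: contrapT => h; apply: nN; right.
  have [WP gP] := DW _ Dp; have [Dg Pg] := WD _ Wp.
  by split => //; [exact: WO|exact: DO].
Qed.

Lemma fst_factor : factor_map P Omega mun T I (marginal Omega) fst.
Proof.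
split.
- by apply: measurable_funTS; exact: measurable_fst.
- move=> E [mE EI]; rewrite (marginalE hO finO posO) strip_measureE (mu_normalizedE finO posO).
  congr (plane _ * _)%E; rewrite setIA setIid.
  by apply/seteqP; split => p [Op]; [|case].
- exists set0; first by exists set0; split; rewrite // (mu_normalizedE finO posO) setI0 measure0 mul0e.
  move=> p [Op _]; split; last exact: (planar_map_fst hT).
  by rewrite -(pe_proj hO); exists p.
Qed.

(** [S'] is the completion of [S] on the whole plane. It contains the vertical strips since [S]
    contains the pull-back of the Borel sets of [I] up to null sets, and its members are preimages
    of members by the invertibility hypothesis on [S]; the generation statement applies to it. *)
Lemma normalized_minimal : minimal_invertible P Omega mun I fst.
Proof.
move=> S sS St Sfst _ Sback.
have SO : S Omega by have [S0 SC _] := sS; have := SC _ S0; rewrite setD0.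
have mS C : S C -> measurable C by move=> /St[].
have SsubO C : S C -> C `<=` Omega by move=> /St[].
pose S' : set (set (R * R)) := [set A | measurable A /\ exists2 C, S C & m (A `+` C) = 0%E].
have self A : S A -> S' A.
  by move=> SA; split; [exact: mS|exists A => //; apply: eq_on_null => //; exact: mS].
have cS : complete_algebra m S'.
  split.
  - by move=> A [].
  - by split => //; exists Omega => //; exact: eq_on_null.
  - move=> A [mA [C SC AC]]; have mC := mS _ SC; split; first exact: measurableC.
    exists (Omega `\` C); first by have [_ h _] := sS; exact: h.
    have m1 : measurable (A `+` C) by exact: measurable_setY.
    apply: (measure_sub0 _ (measurableU _ _ m1 (measurableC mO))).
    + by apply: measurable_setY; [exact: measurableC|exact: measurableD].
    + move=> p; have [Op|nO] := pselect (Omega p); last by right.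
      move=> [[nA h]|[[_ nC] /contrapT Ap]]; left; last by left.
      by right; split => //; apply: contrapT => nC; apply: h.
    + by apply: (measureU_eq0 m1 (measurableC mO) AC); exact: omega_measure_compl.
  - move=> H SH; have mH n : measurable (H n) by have [] := SH n.
    have [C CP] : exists C : nat -> set (R * R), forall n, S (C n) /\ m (H n `+` C n) = 0%E.
      have h n : exists C, S C /\ m (H n `+` C) = 0%E by have [_ [C]] := SH n; exists C.
      by exists (fun n => sval (cid (h n))) => n; exact: svalP (cid (h n)).
    have mC n : measurable (C n) by exact: mS (CP n).1.
    have mUH : measurable (\bigcup_n H n) by apply: bigcup_measurable => n _; exact: mH.
    have mUC : measurable (\bigcup_n C n) by apply: bigcup_measurable => n _; exact: mC.
    split; first exact: mUH.
    exists (\bigcup_n C n); first by have [_ _ h] := sS; apply: h => n; exact: (CP n).1.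
    have mN n : measurable (H n `+` C n) by exact: measurable_setY (mH n) (mC n).
    have mU : measurable (\bigcup_n (H n `+` C n)) by apply: bigcup_measurable => n _; exact: mN.
    apply: (measure_sub0 _ mU).
    + exact: measurable_setY mUH mUC.
    + move=> p [[[n _ Hp] nC]|[[n _ Cp] nH]]; exists n => //.
        by left; split => // Cp; apply: nC; exists n.
      by right; split => // Hp; apply: nH; exists n.
    + apply: (negligibleP m mU).1; apply: negligible_bigcup => n.
      exact: (negligibleP m (mN n)).2 (CP n).2.
  - move=> A A' [mA [C SC AC]] mA' AA'; split => //; exists C => //.
    by apply: (@null_setY_trans _ _ _ m _ _ _ mA' mA (mS _ SC)) => //; rewrite setYC.
move=> A [mA AO]; suff [_ [C SC AC]] : S' A by exists C => //; exact/eq_mod0_normalized.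
apply: (planar_generation hT lbI ubI I0 ha hb hc hd cS) => //.
- move=> A1 [mA1 [C SC AC]]; have [C' [E SE <-] /eq_mod0_normalized CE] := Sback _ SC.
  exists E; first exact: self.
  have mE := mS _ SE; have mFE := mpre mE.
  have mPE : measurable (Omega `&` P @^-1` E) by exact: (measurable_planar_preimage hT lbI ubI hO mE).
  apply: (@null_setY_trans _ _ _ m _ _ _ mA1 (mS _ SC) mFE AC).
  apply: (@null_setY_trans _ _ _ m _ _ _ (mS _ SC) mPE mFE CE).
  apply: eq_on_null => // p Op /=; rewrite planar_totalE//.
  by split => // -[].
- move=> E mE; have mV : measurable (E `*` [set: R]) by exact: measurableX.
  split => //.
  have tE : trace_algebra I (E `&` I) by split; [exact: measurableI|move=> x []].
  have [C SC /eq_mod0_normalized CE] := Sfst _ (ex_intro2 _ _ _ tE erefl).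
  exists C => //.
  have mB : measurable (Omega `&` fst @^-1` (E `&` I)).
    rewrite (_ : fst @^-1` _ = (E `&` I) `*` setT); first by apply: measurableI => //; apply: measurableX => //; exact: measurableI.
    by apply/seteqP; split => p //= [].
  apply: (@null_setY_trans _ _ _ m _ _ _ mV mB (mS _ SC)) => //.
  apply: eq_on_null => // p Op /=; split => [[Ep _]|[_ []]//].
  by split => //; split => //; rewrite -(pe_proj hO); exists p.
Qed.

(** The planar map is invertible, so the approximable sets satisfy the hypotheses of the generation
    statement and exhaust the Borel sets. An invariant set is then a strip over a set invariant
    under [T'], up to null sets. *)
Lemma normalized_ergodic : ergodic P Omega mun.
Proof.
split; first exact: normalized_preserving.
have [D [W [g [[mD DO D0] _ mg [DW _] _]]]] := planar_inverse hT lbI ubI hO finO.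
pose base : set (set (R * R)) := [set A | exists2 E : set R, measurable E & A = E `*` setT].
have mV (E : set R) : measurable E -> measurable (E `*` [set: R]) by move=> mE; exact: measurableX.
have bM : base `<=` measurable by move=> _ [E mE ->]; exact: mV.
have bT : base setT by exists setT => //; apply/seteqP.
have bC A : base A -> base (~` A).
  move=> [E mE ->]; exists (~` E); first exact: measurableC.
  apply/seteqP; split => p /=; first by move=> h; split => // Ep; apply: h.
  by move=> [nE _] [].
have bU (H : nat -> set (R * R)) : (forall n, base (H n)) -> base (\bigcup_n H n).
  move=> bH; pose E n := s2val (cid2 (bH n)).
  exists (\bigcup_n E n); first by apply: bigcup_measurable => n _; exact: (s2valP (cid2 (bH n))).
  apply/seteqP; split => p.
    by move=> [n _]; rewrite (s2valP' (cid2 (bH n))) => -[Ep _]; split => //; exists n.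
  by move=> [[n _ Ep] _]; exists n => //; rewrite (s2valP' (cid2 (bH n))).
have mT' E : measurable E -> measurable (T' @^-1` E).
  by move=> mE; rewrite -[X in measurable X]setTI; exact: (measurable_extension hT).
have FE E : F @^-1` (E `*` [set: R]) = (T' @^-1` E) `*` [set: R].
  by apply/seteqP; split => p; rewrite /= (planar_total_fst hT hO).
have bF A : base A -> base (F @^-1` A).
  by move=> [E mE ->]; exists (T' @^-1` E); [exact: mT'|exact: FE].
have back (A : set (R * R)) : measurable A -> exists2 C, measurable C & m (A `+` F @^-1` C) = 0%E.
  move=> mA; have mg1 : measurable (g @^-1` A) by rewrite -[X in measurable X]setTI; exact: mg.
  exists (g @^-1` A) => //; have mFg := mpre mg1.
  rewrite omega_measureE; apply: (plane_null_sub _ _ _ D0).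
  - by apply: measurableI => //; exact: measurable_setY.
  - exact: measurableD.
  - move=> p [AF Op]; split => // Dp; have [_ gP] := DW _ Dp.
    by move: AF; rewrite /setY /= planar_totalE// gP => -[] [].
have cA := @approximable_complete _ _ _ m F mF Finv base bM bT bC bU bF.
have bA := @approximable_back _ _ _ m F mF Finv base bM back.
have allA : forall A, measurable A -> approximable m F base A.
  apply: (planar_generation hT lbI ubI I0 ha hb hc hd cA bA) => E mE.
  split; first exact: mV.
  move=> e e0; exists 0%N, (E `*` setT); first by exists E.
  rewrite (_ : _ `+` _ = set0) ?/mass ?measure0//.
  by apply/seteqP; split => // p [] [].
move=> A [mA AO] /eq_mod0_normalized inA.
have mFA := mpre mA.
have mPA : measurable (Omega `&` P @^-1` A) by exact: (measurable_planar_preimage hT lbI ubI hO mA).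
have inFA : m (A `+` F @^-1` A) = 0%E.
  apply: (@null_setY_trans _ _ _ m _ _ _ mA mPA mFA inA); apply: eq_on_null => // p Op /=.
  by rewrite planar_totalE//; split => // -[].
have [_ [E mE ->] AE] := @approximable_invariant _ _ _ m F mF Finv base bM bT bC bU A (allA A mA) inFA.
have mEV := mV _ mE; have mFE := mpre mEV.
have FAE : m (F @^-1` A `+` F @^-1` (E `*` setT)) = 0%E.
  rewrite -[RHS]AE -[RHS]Finv; last exact: measurable_setY.
  by [].
have EA : m ((E `*` setT) `+` A) = 0%E by rewrite setYC.
have EE : m ((E `*` setT) `+` F @^-1` (E `*` setT)) = 0%E.
  apply: (@null_setY_trans _ _ _ m _ _ _ mEV mA mFE EA).
  exact: (@null_setY_trans _ _ _ m _ _ _ mA mFA mFE inFA FAE).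
have nuE (C : set R) : nu C = m (C `*` setT).
  by rewrite strip_measureE omega_measureE setIC.
have nE0 : nu (E `+` T' @^-1` E) = 0%E.
  rewrite nuE -[RHS]EE FE; congr (m _).
  by apply/seteqP; split => p; rewrite /setY /=; tauto.
have [e0|e0] := interval_ergodic hT lbI ubI I0 ha hb hc hd mE nE0; [left|right].
  apply: normalized_null.
  apply: (@measure_sub0 _ _ _ m _ _ mA (measurableU _ _ (measurable_setY mA mEV) mEV)).
    by move=> p Ap; have [Ep|nE] := pselect ((E `*` setT) p); [right|left; left].
  by apply: measureU_eq0 => //; [exact: measurable_setY|rewrite -nuE].
apply: normalized_null.
have mEC := mV _ (measurableC mE); have mD' : measurable (Omega `\` A) by exact: measurableD.
apply: (@measure_sub0 _ _ _ m _ _ mD' (measurableU _ _ (measurable_setY mA mEV) mEC)).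
  move=> p [_ nA]; have [Ep|nE] := pselect ((E `*` setT) p); first by left; right.
  by right; split => // Ep; apply: nE.
by apply: measureU_eq0 => //; [exact: measurable_setY|rewrite -nuE].
Qed.

End planar_conclusions.

(** A null [Omega] would make [I] Lebesgue-null although it has interior points; finiteness is the
    strip bound over all of [I]. *)
Lemma plane_measure_Omega (R : realType) (I : set R) (Omega : set (R * R)) :
  is_interval I -> has_lbound I -> has_ubound I -> I° !=set0 -> (lebesgue_measure I < +oo)%E ->
  measurable Omega -> fst @` Omega = I -> fibers_bounded_measure I Omega ->
  away_from_locus Omega -> (0 < plane_measure R Omega < +oo)%E.
Proof.
move=> iI lbI ubI I0 hI mO proj ha hb; have mI := interval_measurable iI.
have OE : Omega `&` setT `*` setT = Omega by apply/seteqP; split => [p []//|p Op]; split.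
apply/andP; split.
  rewrite lt_neqAle measure_ge0 andbT eq_sym; apply/negP => /eqP O0.
  have l0 : lebesgue_measure (setT `&` I) = 0%E.
    by apply: (plane_strip_eq0 mI mO proj ha hb measurableT); rewrite OE.
  have sI : `]inf I, sup I[%classic `<=` setT `&` I.
    by rewrite -interior_itvE// setTI; exact: interior_subset.
  have : lebesgue_measure `]inf I, sup I[%classic = 0%E.
    by apply: (@subset_measure0 _ _ _ (@lebesgue_measure R) _ _ _ _ sI l0); rewrite ?setTI.
  have [x] := I0; rewrite interior_itvE//= in_itv/= => /andP[h1 h2].
  rewrite lebesgue_measure_itv/= lte_fin (lt_trans h1 h2) -EFinB => -[] /eqP.
  by rewrite subr_eq0 gt_eqF// (lt_trans h1 h2).
have [S S0 SP] := plane_strip_le mI mO proj ha hb.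
have := SP _ measurableT; rewrite OE setTI => h; apply: le_lt_trans h _.
by rewrite -(fineK (_ : lebesgue_measure I \is a fin_num)) ?ge0_fin_numE// -EFinM ltry.
Qed.

Theorem theorem3p6 (R : realType) (I : set R) (T : R -> R)
    (B : Type) (K : B -> set R) (M : B -> 'M[R]_2) (Omega : set (R * R))
    (hT : piecewise_mobius I T K M)
    (hI : (lebesgue_measure I < +oo)%E)
    (hOmega : planar_extension I T K M Omega)
    (ha : fibers_bounded_measure I Omega)
    (hb : away_from_locus Omega)
    (hc : full_cylinder_with_bounded_ratios I T K M Omega)
    (hd : bounded_nonfull_range I T K) :
  [/\ (0 < mu_plane Omega < +oo)%E,
      eventually_expansive T K,
      ergodic T I (marginal Omega) &
      natural_extension (planar_map T K M) Omega (mu_normalized Omega)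
        T I (marginal Omega) fst /\
      ergodic (planar_map T K M) Omega (mu_normalized Omega)].
Proof.
(* Condition (d) provides a cylinder, and with it interior points of [I]. *)
have [b0 _ _] := hd; have [x0 Kx0] := pm_nondegenerate hT b0.
have I0 : I° !=set0 by exists x0; exact: (interiorS (pm_sub hT (b := b0))) Kx0.
have Ix0 : I !=set0 by exists x0; apply: (pm_sub hT); exact: interior_subset Kx0.
have [lbI ubI] := finite_interval_bounded (pm_dom hT) hI Ix0.
have pO : (0 < plane_measure R Omega < +oo)%E.
  exact: plane_measure_Omega (pm_dom hT) lbI ubI I0 hI (pe_borel hOmega) (pe_proj hOmega) ha hb.
have /andP[posO finO] := pO.
split.
- exact: pO.
- exact: expansive hT lbI ubI I0 hOmega ha hb hc hd finO.
- exact: marginal_ergodic hT lbI ubI I0 hOmega ha hb hc hd finO posO.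
- split; last exact: normalized_ergodic hT lbI ubI I0 hOmega ha hb hc hd finO posO.
  split.
  + exact: marginal_preserving hT lbI ubI hOmega finO posO.
  + exact: normalized_preserving hT lbI ubI hOmega finO posO.
  + exact: normalized_invertible hT lbI ubI hOmega finO posO.
  + exact: fst_factor hT hOmega finO posO.
  + exact: normalized_minimal hT lbI ubI I0 hOmega ha hb hc hd finO posO.
Qed.
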